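(* Let $d\ge 2$ and let $P$ be a $(d-1)$-dimensional strongly regular normal pseudomanifold with $f_0(P)\ge 2d+1$ vertices and $f_{d-1}(P)\ge d+3$ facets. Then $P\ge\nabla$, i.e. $f_m(P)\ge f_m(\nabla)$ for all $0\le m\le d-1$, where $\nabla=\nabla_d$ is the $d$-polytope defined in the context, for which $f_0(\nabla)=2d+1$ and $$f_m(\nabla)=\binom{d+1}{m+1}+\binom{d}{m+1}+\binom{d-1}{m}\qquad (0<m\le d-1).$$
   Context: All CW complexes are finite. A CW complex is regular if every attaching map is a homeomorphism; its closed cells are called faces ($k$-faces in dimension $k$; $0$-faces are vertices; top-dimensional faces are facets), and $f_k(P)$ is the number of $k$-faces of $P$. A regular CW complex is strongly regular if the intersection of any two faces is a face (possibly empty). A CW complex is pure if all its facets (maximal faces) have the same dimension. A $(d-1)$-dimensional pseudomanifold is a pure regular CW complex $X$ of dimension $d-1$ such that every $(d-2)$-face is contained in exactly two $(d-1)$-faces; it is normal if $X$ is connected and $H_{d-1}(X)$ and $H_{d-1}(X,X\setminus\{x\})$ are $1$-dimensional for all $x\in X$, where homology is (relative) singular homology with coefficients in $\mathbb{Z}/2\mathbb{Z}$. Definition of $\nabla$: let $T^{d,d-2}_1$ be the $(d-2)$-fold pyramid over a square (a $d$-polytope with $d+2$ vertices). Stacking on a polytope over a simplex facet means building a shallow pyramid over that facet while maintaining convexity. Let $\mathrm{Stack}(T^{d,d-2}_1)$ be the polytope obtained by stacking over one arbitrary facet of $T^{d,d-2}_1$ that is a simplex, and let $\nabla:=\big(\mathrm{Stack}(T^{d,d-2}_1)\big)^*$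 be its dual polytope; it has $d+3$ facets. The convention $\binom{n}{j}=0$ for $0\le n<j$ is used. *)

(* Defs.v *)
From HB Require Import structures.
From mathcomp Require Import all_boot all_order all_algebra finmap.
From mathcomp Require Import all_classical all_reals all_analysis.
(* Only the free-module structures are wanted: the notations of monalg clash
   with those of the analysis library. *)
From mathcomp Require Import -(notations) monalg.

Set Implicit Arguments.
Unset Strict Implicit.
Unset Printing Implicit Defensive.

Import Order.TTheory GRing.Theory Num.Theory.
Import numFieldNormedType.Exports.

Local Open Scope classical_set_scope.
Local Open Scope ring_scope.

Definition dot (R : realType) (n : nat) (x y : 'rV[R]_n) : R :=
  \sum_i x 0 i * y 0 i.

(** * Finite CW complexes *)

(* For n = 0 the ball and the open ball are a point and the sphere is empty. *)
Definition eball (R : realType) (n : nat) : set 'rV[R]_n :=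
  [set x | dot x x <= 1].
Definition eoball (R : realType) (n : nat) : set 'rV[R]_n :=
  [set x | dot x x < 1].
Definition esphere (R : realType) (n : nat) : set 'rV[R]_n :=
  [set x | dot x x = 1].

Arguments eball : clear implicits.
Arguments eoball : clear implicits.
Arguments esphere : clear implicits.

Definition homeo_onto_image (T U : topologicalType) (A : set T) (f : T -> U) :=
  {within A, continuous f} /\
  exists2 g : U -> T, {within f @` A, continuous g} & {in A, cancel f g}.

(* A finite CW structure on X. Characteristic maps are total functions of which
   only the values on the closed ball matter. There are finitely many cells, so
   closure-finiteness and the weak topology are automatic. *)
Record cw_complex (R : realType) (X : topologicalType) := CWComplex {
  cw_cell :> finType;
  cw_dim : cw_cell -> nat;
  cw_char : forall c : cw_cell, 'rV[R]_(cw_dim c) -> X;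
  cw_hausdorff : hausdorff_space X;
  cw_char_continuous : forall c : cw_cell,
    {within eball R (cw_dim c), continuous (@cw_char c)};
  cw_char_open : forall c : cw_cell,
    homeo_onto_image (eoball R (cw_dim c)) (@cw_char c);
  cw_cover : \bigcup_(c : cw_cell) (@cw_char c @` eoball R (cw_dim c)) = setT;
  cw_disjoint : forall c c' : cw_cell,
    (@cw_char c @` eoball R (cw_dim c)) `&`
    (@cw_char c' @` eoball R (cw_dim c')) !=set0 -> c = c';
  cw_attach : forall c : cw_cell,
    @cw_char c @` esphere R (cw_dim c) `<=`
    \bigcup_(c' in [set c' : cw_cell | (cw_dim c' < cw_dim c)%N])
      (@cw_char c' @` eoball R (cw_dim c')) }.

Arguments cw_char {R X _} c.

Section CW.
Context (R : realType) (X : topologicalType) (P : cw_complex R X).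

Definition closed_cell (c : P) : set X := cw_char c @` eball R (cw_dim c).

(* Distinct cells have distinct closures, so counting cells is counting
   closed cells. *)
Definition fnum (k : nat) : nat := #|[pred c : P | cw_dim c == k]|.

(* The attaching map of c is the restriction of its characteristic map to the
   sphere. *)
Definition regular_cw : Prop :=
  forall c : P, homeo_onto_image (esphere R (cw_dim c)) (cw_char c).

Definition strongly_regular : Prop :=
  regular_cw /\
  forall s t : P, closed_cell s `&` closed_cell t = set0 \/
    exists u : P, closed_cell s `&` closed_cell t = closed_cell u.

Definition maximal_cell (c : P) : Prop :=
  forall c' : P, closed_cell c `<=` closed_cell c' -> c' = c.

Definition pure_cw : Prop :=
  forall c c' : P, maximal_cell c -> maximal_cell c' -> cw_dim c = cw_dim c'.

Definition dimension_cw (k : nat) : Prop :=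
  (exists c : P, cw_dim c = k) /\ forall c : P, (cw_dim c <= k)%N.

Definition pseudomanifold (k : nat) : Prop :=
  [/\ regular_cw, pure_cw, dimension_cw k &
    forall s : P, (cw_dim s).+1 = k ->
      #|[pred t : P | (cw_dim t == k) &&
                      `[< closed_cell s `<=` closed_cell t >]]| = 2].

End CW.

(** * Singular homology with coefficients in Z/2 *)

Definition stdsimplex (R : realType) (n : nat) : set 'rV[R]_n.+1 :=
  [set t | (forall i, 0 <= t 0 i) /\ \sum_i t 0 i = 1].

Arguments stdsimplex : clear implicits.

Section FaceInclusion.
Context (R : realType) (n : nat) (i : 'I_n.+2).

Definition insert0 (t : 'rV[R]_n.+1) : 'rV[R]_n.+2 :=
  \row_j oapp (fun k => t 0 k) 0 (unlift i j).

Lemma insert0_stdsimplex (t : stdsimplex R n) :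
  insert0 (set_val t) \in stdsimplex R n.+1.
Proof.
have /set_mem[t0 t1] := valP t; apply/mem_set; split=> [j|].
  by rewrite mxE; case: unliftP => //= k _; exact: t0.
rewrite (bigD1_ord i) //= mxE unlift_none add0r -[RHS]t1.
by apply: eq_bigr => k _; rewrite mxE liftK.
Qed.

Definition face_incl (t : stdsimplex R n) : stdsimplex R n.+1 :=
  exist (fun x => x \in stdsimplex R n.+1) _ (insert0_stdsimplex t).

Lemma insert0_continuous : continuous insert0.
Proof.
move=> t A [B tB BA] /=.
exists (fun a k => if unlift i (lift i k) is Some _ then B a (lift i k) else setT).
  move=> a k; rewrite liftK.
  by have := tB a (lift i k); rewrite mxE liftK /= (ord1 a).
move=> u uB; apply: BA => a j; rewrite mxE (ord1 a).
case: (unliftP i j) => [k ->|->] /=.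
  by have := uB 0 k; rewrite liftK.
by have := tB 0 i; rewrite mxE unlift_none /= => /nbhs_singleton.
Qed.

Lemma face_incl_continuous : continuous face_incl.
Proof.
apply: continuous_comp_initial => t.
apply: (@continuous_comp _ _ _ set_val insert0).
  exact: initial_continuous.
exact: insert0_continuous.
Qed.

HB.instance Definition _ :=
  isContinuous.Build _ _ face_incl face_incl_continuous.

End FaceInclusion.

Section Homology.
Context (R : realType) (X : topologicalType).

Definition singular (n : nat) := continuousType (stdsimplex R n) X.

Definition sface (n : nat) (i : 'I_n.+2) (s : singular n.+1) : singular n :=
  [the continuousType _ _ of s \o @face_incl R n i].

Definition chain (n : nat) := malg (singular n) 'F_2.

(* Coefficients are in Z/2, so there are no signs. *)
Definition boundary (n : nat) (c : chain n.+1) : chain n :=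
  \sum_(s <- msupp c) \sum_(i < n.+2) mkmalgU (sface i s) (mcoeff s c).

Definition carried_by (A : set X) (n : nat) (c : chain n) : Prop :=
  forall s : singular n, mcoeff s c != 0 -> range s `<=` A.

Definition rel_cycle (A : set X) (n : nat) : chain n -> Prop :=
  match n return chain n -> Prop with
  | 0 => fun=> True
  | m.+1 => fun c => carried_by A (boundary c)
  end.

Definition rel_boundary (A : set X) (n : nat) (c : chain n) : Prop :=
  exists (b : chain n.+1) (a : chain n),
    carried_by A a /\ c = boundary b + a.

(* H_n(X, A) = rel_cycle / rel_boundary is spanned by one nonzero class.
   Only the zero chain is carried by set0, so A = set0 gives H_n(X). *)
Definition homology_dim1 (A : set X) (n : nat) : Prop :=
  exists z : chain n, [/\ rel_cycle A z, ~ rel_boundary A z &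
    forall z' : chain n, rel_cycle A z' ->
      exists a : 'F_2, rel_boundary A (z' - a *: z)].

End Homology.

Definition normal_pseudomanifold (R : realType) (X : topologicalType)
    (P : cw_complex R X) (k : nat) : Prop :=
  [/\ pseudomanifold P k, connected [set: X],
    homology_dim1 R (set0 : set X) k &
    forall x : X, homology_dim1 R (~` [set x]) k].

(** * Convex polytopes *)

Section Polytopes.
Context (R : realType) (n : nat).
Local Notation V := 'rV[R]_n.

Definition conv_hull (A : set V) : set V := smallest (@convex_set R V) A.

Definition affine_set (A : set V) : Prop :=
  forall (x y : V) (t : R), A x -> A y -> A (t *: x + (1 - t) *: y).

Definition aff_hull (A : set V) : set V := smallest affine_set A.

Definition affdim (A : set V) (k : nat) : Prop :=
  exists (x0 : V) (B : 'M[R]_(k, n)),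
    row_free B /\ aff_hull A = [set x | (x - x0 <= B)%MS].

Definition valid_ineq (Q : set V) (a : V) (b : R) : Prop :=
  forall x, Q x -> dot a x <= b.

Definition exposed (Q : set V) (a : V) (b : R) : set V :=
  Q `&` [set x | dot a x = b].

(* a = 0 yields the two improper faces. *)
Definition poly_face (Q F : set V) : Prop :=
  exists a b, valid_ineq Q a b /\ F = exposed Q a b.

Definition poly_fnum (Q : set V) (k : nat) : nat :=
  #|` fset_set [set F | poly_face Q F /\ affdim F k] |%fset.

Definition is_square (Q : set V) : Prop :=
  exists a u v : V, [/\ u != 0, dot u u = dot v v, dot u v = 0 &
    Q = conv_hull [set a; a + u; a + v; a + u + v]].

Definition is_pyramid (B Q : set V) : Prop :=
  exists2 v : V, ~ aff_hull B v & Q = conv_hull (B `|` [set v]).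

Fixpoint square_pyramid (r : nat) (Q : set V) : Prop :=
  if r is r'.+1 then exists2 B, square_pyramid r' B & is_pyramid B Q
  else is_square Q.

Definition is_simplex (F : set V) (k : nat) : Prop :=
  exists (x0 : V) (B : 'M[R]_(k, n)), row_free B /\
    F = conv_hull ([set x0] `|` [set x0 + row i B | i in setT]).

End Polytopes.

Section Nabla.
Context (R : realType) (d : nat).
Local Notation V := 'rV[R]_d.

Definition is_facet (Q F : set V) : Prop := poly_face Q F /\ affdim F d.-1.

(* S is obtained from the d-polytope T by stacking over the facet F: the apex p
   violates the facet inequality of F and strictly satisfies those of all other
   facets. *)
Definition stacked_over (T F S : set V) : Prop :=
  exists2 p : V, S = conv_hull (T `|` [set p]) &
    forall a b, valid_ineq T a b -> is_facet T (exposed T a b) ->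
      (exposed T a b = F -> b < dot a p) /\
      (exposed T a b <> F -> dot a p < b).

(* The dual is the polar body with respect to an interior point c. *)
Definition polar (c : V) (S : set V) : set V :=
  [set y | forall x, S x -> dot (x - c) y <= 1].

Definition is_nabla (N : set V) : Prop :=
  exists (T F S : set V) (c : V), [/\ square_pyramid (d - 2) T,
    is_facet T F /\ is_simplex F d.-1, stacked_over T F S, S° c &
    N = polar c S].

End Nabla.

(* Main.v *)
Require Import Defs.
From mathcomp Require Import all_boot.
From mathcomp Require Import zify.

(* Add an empty and a top face to the cells of [P]. Strong regularity makes the
   result a finite meet-semilattice, and a cell of codimension two in another one
   lies in at least two intermediate cells: otherwise a neighbourhood of one of its
   points in a sphere would embed into a half-space of the same dimension, against
   invariance of domain, which follows from the Poincaré-Miranda theorem. The lower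
   bound is then proved in such semilattices by induction on the rank. A facet [F]
   contributes its own faces and, over each of them, one more face outside [F]; if
   some facet again has many vertices and facets, or misses exactly two vertices,
   the missing summand comes from induction or from faces over a common ridge.
   Otherwise one removes vertices outside [F] one at a time, as in Xue's proof of
   the lower bound theorem for few vertices, or, when every facet has few vertices,
   one counts around a simple vertex or double counts flags.

   A face of the polar of [S] is the set of affine functions, normalised to be [1]
   at [c] and nonnegative on [S], that vanish on a given set of vertices of [S]. An
   affine function takes independent values at the vertices of the iterated pyramid
   except that the sums over the two diagonals of the square agree. Its value at the
   stacking apex is a combination with positive coefficients, except that the slope
   across the square enters negatively. Hence the zero sets can be listed, and the
   dimension of the face is [d] minus the number of zeros, where a vanishing square
   counts for three. *)

Set Implicit Arguments.
Unset Strict Implicit.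
Unset Printing Implicit Defensive.

(** * Face numbers of thin semilattices *)

(** At [m = 0] the formula gives [2d + 2], one more than the number of vertices assumed. For
    [m >= 2] the bounds for a facet in dimensions [m] and [m - 1] add up by Pascal's rule to the
    bound for the whole. For edges the deficit shows, and one extra edge has to be found outside the
    facet. The other obstacle is that a facet need not inherit both hypotheses: it may have many
    vertices but few ridges, or be a simplex. If some facet [F] is not a simplex and misses more
    than two vertices, the lower bound for [F], combined with a count over vertices outside [F] as
    in a simplex, falls short by ['C(d - 2, m - 1)]. The [d + 3] facets supply this summand: were
    all vertices outside [F] simple and pairwise adjacent, there would be at most [d + 2] facets,
    whereas a vertex that is not simple, or two that are not adjacent, yield the summand. For the
    polytope the deficit at [m = 0] has a geometric meaning: the absent vertex of the dual is the
    facet that stacking buries. *)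

Module Thin.

(** * Cardinality and binomial inequalities *)

Section FiniteSets.
Context (T : finType).
Implicit Types A B C : {set T}.

Lemma leq_card_disjoint A B C : A \subset C -> B \subset C ->
  (forall z, z \in A -> z \in B -> False) -> #|A| + #|B| <= #|C|.
Proof.
move=> AC BC dAB; have -> : #|A| + #|B| = #|A :|: B|.
  rewrite cardsU; suff -> : A :&: B = set0 by rewrite cards0 subn0.
  by apply/setP => z; rewrite !inE; apply/negP => /andP[zA zB]; exact: dAB zA zB.
by apply: subset_leq_card; rewrite subUset AC BC.
Qed.

Lemma exists_subset_card A C (m : nat) : A \subset C -> #|A| <= m <= #|C| ->
  exists2 B : {set T}, (A \subset B) && (B \subset C) & #|B| = m.
Proof.
move=> AC; elim: m => [|m IHm] /andP[Am mC].
  by exists A; [rewrite subxx | apply/eqP; rewrite -leqn0].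
have [->|Am'] := eqVneq m.+1 #|A|; first by exists A; rewrite ?subxx.
have /IHm[B /andP[AB BC] Bm] : #|A| <= m <= #|C| by lia.
have /properP[_ [z zC zB]] : B \proper C by rewrite properEcard BC Bm.
exists (z |: B); last by rewrite cardsU1 zB Bm.
by rewrite (subset_trans AB (subsetU1 _ _)) subUset sub1set zC.
Qed.

End FiniteSets.

(** A section of [g] over [A] has an image of size [#|A|], and each point of [S] has a second
    preimage outside that image. *)
Lemma leq_card_fibers (T T' : finType) (g : T -> T') (R : {set T}) (A S : {set T'}) :
  S \subset A ->
  (forall a, a \in A -> exists2 b, b \in R & g b = a) ->
  (forall a, a \in S -> exists b1 b2,
     [/\ b1 != b2, b1 \in R, b2 \in R, g b1 = a & g b2 = a]) ->
  #|A| + #|S| <= #|R|.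
Proof.
move=> SA gA gS.
have /fin_all_exists[f fP] (a : {a | a \in A}) : exists b, b \in R /\ g b = val a.
  by have [b bR gb] := gA _ (valP a); exists b.
pose I := [set f a | a in {: {a | a \in A}}].
have cI : #|I| = #|A|.
  rewrite card_imset; first by rewrite card_sig.
  by move=> a a' /(congr1 g); have [_ ->] := fP a; have [_ ->] := fP a'; exact: val_inj.
rewrite -cI -(cardsID I R); apply: leq_add.
  apply: subset_leq_card; apply/subsetP => _ /imsetP[a _ ->].
  by rewrite inE imset_f // andbT; have [] := fP a.
apply: leq_trans (leq_imset_card g _); apply: subset_leq_card.
apply/subsetP => a aS; have [b1 [b2 [b12 b1R b2R gb1 gb2]]] := gS a aS.
suff [b bR [bI gb]] : exists2 b, b \in R & b \notin I /\ g b = a.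
  by apply/imsetP; exists b; rewrite // inE bI.
have aA := subsetP SA a aS.
have notI b : b \in R -> g b = a -> b != f (Sub a aA) -> b \notin I.
  move=> bR gb; apply: contraNN => /imsetP[a' _ ba']; rewrite ba'.
  apply/eqP; congr f; apply: val_inj; rewrite SubK -gb ba'.
  by have [_ ->] := fP a'.
have [e|ne] := eqVneq b1 (f (Sub a aA)).
  by exists b2 => //; split=> //; apply: notI => //; rewrite -e eq_sym.
by exists b1 => //; split=> //; exact: notI.
Qed.

Lemma leq_card_fibers1 (T T' : finType) (g : T -> T') (R : {set T}) (A : {set T'}) :
  (forall a, a \in A -> exists2 b, b \in R & g b = a) -> #|A| <= #|R|.
Proof.
move=> gA; rewrite -[#|A|]addn0 -(cards0 T').
by apply: leq_card_fibers gA _; rewrite ?sub0set // => a; rewrite inE.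
Qed.

Lemma leq_card_in_inj (T T' : finType) (f : T -> T') (A : {set T}) (B : {set T'}) :
  {in A &, injective f} -> (forall z, z \in A -> f z \in B) -> #|A| <= #|B|.
Proof.
move=> fI fB; rewrite -(card_in_imset fI); apply: subset_leq_card.
by apply/subsetP => _ /imsetP[z zA ->]; exact: fB.
Qed.

Lemma leq_bin2r m n k : m <= n -> 'C(m, k) <= 'C(n, k).
Proof. exact: leq_bin2l. Qed.

(** Discrete convexity: the increment over [c] steps is at least as large from [b] as from [a]. It
    serves to trade the deficit of a facet against the deficit outside it. *)
Lemma bin_convex a b c k : a <= b -> 'C(a + c, k) + 'C(b, k) <= 'C(a, k) + 'C(b + c, k).
Proof.
move=> ab; elim: c => [|c IHc]; first by rewrite !addn0.
case: k IHc => [|k] IHc; first by rewrite !bin0.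
rewrite !addnS !binS; have := @leq_bin2r (a + c) (b + c) k.
by move=> /(_ ltac:(lia)); lia.
Qed.

(** * Graded meet-semilattices with thin intervals *)

Section ThinSemilattice.
Context (L : finType) (le : rel L) (meet : L -> L -> L) (rk : L -> nat).

Definition strict x y := (x != y) && le x y.

Local Notation "x ⊑ y" := (le x y) (at level 70, y at next level).
Local Notation "x ⊏ y" := (strict x y) (at level 70, y at next level).
Local Notation "x &&& y" := (meet x y) (at level 48, left associativity).
Implicit Types x y z u v w F G : L.

Context (lexx : reflexive le) (le_anti : antisymmetric le) (le_transitive : transitive le)
  (lexI : forall x y z, (z ⊑ x &&& y) = (z ⊑ x) && (z ⊑ y)).
Context (rk_lt : forall x y, x ⊏ y -> rk x < rk y)
  (rk_cocover : forall x y, x ⊏ y ->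
     exists w, [/\ x ⊑ w, w ⊏ y & rk y = (rk w).+1])
  (thin : forall x y, x ⊏ y -> rk y = (rk x).+2 ->
     exists w1 w2, [/\ w1 != w2, x ⊏ w1, w1 ⊏ y, x ⊏ w2 & w2 ⊏ y]).

Lemma le_trans y x z : x ⊑ y -> y ⊑ z -> x ⊑ z. Proof. exact: le_transitive. Qed.
Lemma ltW x y : x ⊏ y -> x ⊑ y. Proof. by case/andP. Qed.
Lemma lt_neqAle x y : (x ⊏ y) = (x != y) && (x ⊑ y). Proof. by []. Qed.
Lemma le_eqVlt x y : (x ⊑ y) = (x == y) || (x ⊏ y).
Proof. by rewrite /strict; case: eqVneq => [->|]; rewrite ?lexx. Qed.
Lemma lt_geF x y : x ⊏ y -> (y ⊑ x) = false.
Proof.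
by case/andP=> xy lexy; apply: contra_neqF xy => yx; apply: le_anti; rewrite lexy.
Qed.
Lemma lt_le_trans y x z : x ⊏ y -> y ⊑ z -> x ⊏ z.
Proof.
move=> xy yz; rewrite lt_neqAle (le_trans (ltW xy) yz) andbT.
by apply: contraTneq yz => <-; rewrite (lt_geF xy).
Qed.
Lemma le_lt_trans y x z : x ⊑ y -> y ⊏ z -> x ⊏ z.
Proof.
move=> xy yz; rewrite lt_neqAle (le_trans xy (ltW yz)) andbT.
by apply: contraTneq xy => ->; rewrite (lt_geF yz).
Qed.
Lemma lt_trans y x z : x ⊏ y -> y ⊏ z -> x ⊏ z.
Proof. by move=> xy /ltW; exact: lt_le_trans. Qed.
Lemma leIl x y : x &&& y ⊑ x. Proof. by have := lexx (x &&& y); rewrite lexI => /andP[]. Qed.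
Lemma leIr x y : x &&& y ⊑ y. Proof. by have := lexx (x &&& y); rewrite lexI => /andP[]. Qed.
Lemma eq_meetl x y : (x &&& y == x) = (x ⊑ y).
Proof.
apply/eqP/idP => [<-|xy]; first exact: leIr.
by apply: le_anti; rewrite leIl lexI lexx xy.
Qed.

(* Without the irrelevant boolean hypotheses, on which [lia] would branch. *)
Local Ltac nlia := repeat match goal with
  | H : is_true (le _ _) |- _ => clear H
  | H : is_true (strict _ _) |- _ => clear H
  | H : is_true (negb _) |- _ => clear H
  | H : is_true (_ \in _) |- _ => clear H
  | H : is_true (_ \subset _) |- _ => clear H
  end; lia.

Lemma rk_le x y : x ⊑ y -> rk x <= rk y.
Proof. by rewrite le_eqVlt => /predU1P[->//|/rk_lt/ltnW]. Qed.

Lemma rk_eq x y : x ⊑ y -> rk y <= rk x -> x = y.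
Proof. by rewrite le_eqVlt => /predU1P[->//|/rk_lt]; nlia. Qed.

Lemma rk_ltW x y : x ⊑ y -> rk x < rk y -> x ⊏ y.
Proof. by rewrite le_eqVlt => /predU1P[->|//]; rewrite ltnn. Qed.

Lemma rk_nle x y : rk y <= rk x -> x != y -> ~~ (x ⊑ y).
Proof. by move=> yx xy; apply: contra_neqN xy => /rk_eq; apply. Qed.

Lemma rk_meet_lt x y : ~~ (x ⊑ y) -> rk (x &&& y) < rk x.
Proof. by move=> xy; apply: rk_lt; rewrite lt_neqAle leIl eq_meetl xy. Qed.

Lemma rk_cover x y : x ⊏ y -> exists w, [/\ x ⊏ w, w ⊑ y & rk w = (rk x).+1].
Proof.
move: {2}(rk y) (leqnn (rk y)) => n; elim: n y => [|n IHn] y yn xy.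
  by have := rk_lt xy; nlia.
have [w [xw wy yw]] := rk_cocover xy.
have [<-|xw'] := eqVneq w x; first by exists y; split.
have {xw xw'} xw : x ⊏ w by rewrite lt_neqAle eq_sym xw'.
have [v [xv vw vx]] := IHn w ltac:(nlia) xw.
by exists v; split=> //; exact: le_trans vw (ltW wy).
Qed.

(** Thinness makes a face the span of its vertices: two different coatoms of [y] below [F] would
    both equal [y &&& F], so one of them can be used for the induction. *)
Lemma atom_avoid x y F : x ⊏ y -> ~~ (y ⊑ F) ->
  exists v, [/\ x ⊑ v, v ⊑ y, rk v = (rk x).+1 & ~~ (v ⊑ F)].
Proof.
move: {2}(rk y) (leqnn (rk y)) => n; elim: n y => [|n IHn] y yn xy yF.
  by have := rk_lt xy; nlia.
have [w [xw wy yw]] := rk_cocover xy.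
have [wx|wx] := eqVneq w x; first by exists y; split; rewrite ?lexx ?(ltW xy) // yw wx.
have {xw wx} xw : x ⊏ w by rewrite lt_neqAle eq_sym wx.
have [v [xv vw wv]] := rk_cocover xw.
have [w1 [w2 [w12 vw1 w1y vw2 w2y]]] := thin (lt_trans vw wy) ltac:(nlia).
have r1 := rk_lt vw1; have r1' := rk_lt w1y.
have r2 := rk_lt vw2; have r2' := rk_lt w2y.
suff [u [vu uy uF]] : exists u, [/\ v ⊏ u, u ⊏ y & ~~ (u ⊑ F)].
  have [|t [xt tu tx tF]] := IHn u _ (le_lt_trans xv vu) uF.
    by have := rk_lt uy; nlia.
  by exists t; split=> //; exact: le_trans tu (ltW uy).
have [w1F|] := boolP (w1 ⊑ F); last by exists w1.
have [w2F|] := boolP (w2 ⊑ F); last by exists w2.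
have ryF := rk_meet_lt yF.
have e1 : w1 = y &&& F by apply: rk_eq; [by rewrite lexI ltW | nlia].
have e2 : w2 = y &&& F by apply: rk_eq; [by rewrite lexI ltW | nlia].
by rewrite e1 e2 eqxx in w12.
Qed.

(** Order dual of [atom_avoid]: if both middle elements of an interval of length two above [x]
    contained [u], so would their meet, which is [x]. *)
Lemma coatom_avoid x y u : x ⊏ y -> ~~ (u ⊑ x) ->
  exists G, [/\ x ⊑ G, G ⊑ y, rk y = (rk G).+1 & ~~ (u ⊑ G)].
Proof.
move: {2}(rk y - rk x) (leqnn (rk y - rk x)) => n.
elim: n x => [|n IHn] x xyn xy ux; first by have := rk_lt xy; nlia.
have [w [xw wy wx]] := rk_cover xy.
have [e|ywN] := eqVneq w y; first by exists x; split; rewrite ?lexx ?(ltW xy) // -e.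
have {wy ywN} wy : w ⊏ y by rewrite lt_neqAle ywN.
have [v [wv vy vw]] := rk_cover wy.
have [w1 [w2 [w12 xw1 w1v xw2 w2v]]] := thin (lt_trans xw wv) ltac:(nlia).
have r1 := rk_lt xw1; have r1' := rk_lt w1v.
have r2 := rk_lt xw2; have r2' := rk_lt w2v.
suff [t [xt tv tu]] : exists t, [/\ x ⊏ t, t ⊏ v & ~~ (u ⊑ t)].
  have [|G [tG Gy yG uG]] := IHn t _ (lt_le_trans tv vy) tu.
    by have := rk_lt xt; have := rk_lt xy; nlia.
  by exists G; split=> //; exact: le_trans (ltW xt) tG.
have [uw1|] := boolP (u ⊑ w1); last by exists w1.
have [uw2|] := boolP (u ⊑ w2); last by exists w2.
have w1w2 : ~~ (w1 ⊑ w2) by apply: rk_nle => //; nlia.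
have r12 := rk_meet_lt w1w2.
have e : x = w1 &&& w2 by apply: rk_eq; [rewrite lexI !ltW | nlia].
by rewrite e lexI uw1 uw2 in ux.
Qed.

Definition level x y (k : nat) : {set L} :=
  [set z | [&& x ⊑ z, z ⊑ y & rk z == rk x + k]].
Definition nlevel x y k : nat := #|level x y k|.
Definition over x y k (V : {set L}) : {set L} :=
  [set z in level x y k | [exists v in V, v ⊑ z]].

Lemma levelP x y k z :
  reflect [/\ x ⊑ z, z ⊑ y & rk z = rk x + k] (z \in level x y k).
Proof.
by rewrite inE; apply: (iffP and3P) => -[xz zy] /eqP zk; split=> //; apply/eqP.
Qed.

Lemma level_subr x F y k : F ⊑ y -> level x F k \subset level x y k.
Proof.
move=> Fy; apply/subsetP => z /levelP[xz zF zk]; apply/levelP.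
by split=> //; exact: le_trans zF Fy.
Qed.

(** Comparison with a simplex by Pascal's rule: faces below a coatom [F] and faces above an atom
    outside [F] form disjoint families. *)
Lemma bin_leq_nlevel x y r k : x ⊑ y -> rk y = rk x + r -> 'C(r, k) <= nlevel x y k.
Proof.
elim: r x y k => [|r IHr] x y k xy yx.
  case: k => [|k]; last by rewrite bin0n.
  by rewrite bin0 card_gt0; apply/set0Pn; exists x; apply/levelP; rewrite lexx addn0.
have xy' : x ⊏ y by apply: rk_ltW => //; nlia.
case: k => [|k].
  by rewrite bin0 card_gt0; apply/set0Pn; exists x; apply/levelP; rewrite lexx addn0.
have [F [xF Fy yF]] := rk_cocover xy'.
have yF' : ~~ (y ⊑ F) by rewrite (lt_geF Fy).
have [v [xv vy vx vF]] := atom_avoid xy' yF'.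
rewrite binS; apply: leq_trans (leq_add (IHr x F k.+1 xF _) (IHr v y k vy _)) _;
  [nlia | nlia | apply: leq_card_disjoint].
- exact: level_subr (ltW Fy).
- apply/subsetP => z /levelP[vz zy zk]; apply/levelP; split=> //; last nlia.
  exact: le_trans xv vz.
- move=> z /levelP[_ zF _] /levelP[vz _ _].
  by rewrite (le_trans vz zF) in vF.
Qed.

Lemma face_avoid (s : seq L) x y : x ⊑ y -> size s + rk x <= rk y ->
  all (fun u => ~~ (u ⊑ x)) s ->
  exists F, [/\ x ⊑ F, F ⊑ y, rk F + size s = rk y & all (fun u => ~~ (u ⊑ F)) s].
Proof.
move=> xy; elim: s => [|u s IHs] /=; first by move=> *; exists y; rewrite addn0.
move=> sxy /andP[ux sx]; have [F [xF Fy Fs sF]] := IHs ltac:(nlia) sx.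
have xF' : x ⊏ F by apply: rk_ltW => //; nlia.
have [G [xG GF FG uG]] := coatom_avoid xF' ux; exists G; split=> //.
- exact: le_trans GF Fy.
- nlia.
rewrite uG; apply/allP => w /(allP sF); apply: contraNN => wG.
exact: le_trans wG GF.
Qed.

Lemma over_sub x y k V : over x y k V \subset level x y k.
Proof. by apply/subsetP => z; rewrite inE => /andP[]. Qed.

Lemma over0 x y k : over x y k set0 = set0.
Proof.
by apply/setP => z; rewrite !inE; apply/negP => /andP[_ /existsP[v]]; rewrite inE.
Qed.

Lemma overU1 x y k v V : over x y k V \subset over x y k (v |: V).
Proof.
apply/subsetP => z; rewrite !inE => /andP[-> /= /existsP[u /andP[uV uz]]].
by apply/existsP; exists u; rewrite !inE uV orbT.
Qed.

(* The faces over [v] inside a face that contains [v] but no element of [V] have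
   not been counted in [over x y k V]. *)
Lemma over_step x y r k v (V : {set L}) : rk y = rk x + r ->
  V \subset level x y 1 -> v \in level x y 1 -> v \notin V -> #|V| < r ->
  #|over x y k.+1 V| + 'C(r - #|V|.+1, k) <= #|over x y k.+1 (v |: V)|.
Proof.
move=> yx Vx /levelP[xv vy vx] vV Vr.
have [||F [vF Fy FV VF]] := @face_avoid (enum V) v y vy; rewrite -?cardE; first by nlia.
  apply/allP => u; rewrite mem_enum => uV.
  have /levelP[_ _ ux] := subsetP Vx u uV.
  by apply: rk_nle; [nlia | apply: contraNneq vV => <-].
rewrite -cardE in FV.
have vFk := @bin_leq_nlevel v F (r - #|V|.+1) k vF ltac:(nlia).
apply: leq_trans (leq_add (leqnn _) vFk) _.
apply: leq_card_disjoint; first exact: overU1.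
- apply/subsetP => z /levelP[vz zF zk]; rewrite inE; apply/andP; split.
    by apply/levelP; split; [exact: le_trans vz | exact: le_trans Fy | nlia].
  by apply/existsP; exists v; rewrite !inE eqxx.
- move=> z; rewrite inE => /andP[_ /existsP[u /andP[uV uz]]] /levelP[_ zF _].
  have := allP VF u; rewrite mem_enum => /(_ uV) /negP; apply.
  exact: le_trans uz zF.
Qed.

(** [over_step] is summed over the elements of [W] outside [V]; the binomials telescope. With [V]
    empty, it yields at least as many faces over [W] as a simplex has over [#|W|] of its
    vertices. *)
Lemma over_mono x y r k (V W : {set L}) : rk y = rk x + r ->
  V \subset W -> W \subset level x y 1 -> #|W| <= r ->
  #|over x y k.+1 V| + 'C(r - #|V|, k.+1) <= #|over x y k.+1 W| + 'C(r - #|W|, k.+1).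
Proof.
move=> yx; move: {2}(#|W| - #|V|) (leqnn (#|W| - #|V|)) => n.
elim: n V => [|n IHn] V WVn VW Wx Wr.
  have -> : V = W by apply/eqP; rewrite eqEcard VW /=; nlia.
  by [].
have [->//|VW'] := eqVneq V W.
have /properP[_ [v vW vV]] : V \proper W by rewrite properEneq VW' VW.
have VvW : v |: V \subset W by rewrite subUset sub1set vW VW.
have cVv : #|v |: V| = #|V|.+1 by rewrite cardsU1 vV.
have := subset_leq_card VvW; rewrite cVv => VltW.
apply: leq_trans (IHn (v |: V) ltac:(nlia) VvW Wx Wr).
have := @over_step x y r k v V yx (subset_trans VW Wx) (subsetP Wx v vW) vV ltac:(nlia).
have -> : r - #|V| = (r - #|V|.+1).+1 by nlia.
by rewrite binS cVv; nlia.
Qed.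

Lemma facet_split x y F k (W : {set L}) : F ⊑ y ->
  (forall v, v \in W -> ~~ (v ⊑ F)) ->
  nlevel x F k + #|over x y k W| <= nlevel x y k.
Proof.
move=> Fy WF; apply: leq_card_disjoint; [exact: level_subr | exact: over_sub |].
move=> z /levelP[_ zF _]; rewrite inE => /andP[_ /existsP[v /andP[vW vz]]].
by have /negP[] := WF v vW; exact: le_trans vz zF.
Qed.


(** * Vertices outside a facet and the bound for few vertices *)

Definition out x y F : {set L} := [set v in level x y 1 | ~~ (v ⊑ F)].

Lemma outP x y F v : reflect (v \in level x y 1 /\ ~~ (v ⊑ F)) (v \in out x y F).
Proof. by rewrite [v \in out _ _ _]inE; exact: andP. Qed.

Lemma out_sub x y F : out x y F \subset level x y 1.
Proof. by apply/subsetP => v /outP[]. Qed.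

Lemma card_out x y F : F ⊑ y -> nlevel x F 1 + #|out x y F| = nlevel x y 1.
Proof.
move=> Fy; rewrite [RHS]/nlevel -(cardsID (level x F 1) (level x y 1)); congr (_ + _).
  by rewrite (setIidPr _) //; exact: level_subr.
apply: eq_card => v; rewrite !inE; case: (x ⊑ v); case: (v ⊑ F) => //=.
  by case: eqP; rewrite ?andbF.
by rewrite andbT.
Qed.

Lemma facet_split_out x y F k (W : {set L}) : F ⊑ y -> W \subset out x y F ->
  nlevel x F k + #|over x y k W| <= nlevel x y k.
Proof. by move=> Fy /subsetP WF; apply: facet_split => // v /WF /outP[]. Qed.

Lemma le_of_atoms x G F : x ⊑ F -> x ⊑ G ->
  (forall v, v \in level x G 1 -> v ⊑ F) -> G ⊑ F.
Proof.
move=> xF; rewrite le_eqVlt => /predU1P[<-//|xG] atF.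
apply: contraT => /(atom_avoid xG)[v [xv vG vx]] /negP[].
by apply: atF; apply/levelP; split=> //; rewrite addn1.
Qed.

Lemma coatom_meet F F' H : F != F' -> rk F' = rk F -> H ⊑ F -> H ⊑ F' ->
  rk F = (rk H).+1 -> F &&& F' = H.
Proof.
move=> FF' rF HF HF' FH; apply/esym/rk_eq; first by rewrite lexI HF HF'.
have /rk_meet_lt : ~~ (F ⊑ F') by apply: rk_nle => //; rewrite rF.
by rewrite FH.
Qed.

(** A facet [F] missing a single vertex has itself more vertices than a simplex, so by induction
    some ridge [H] misses two vertices of [F]. Another facet over [H] meets [F] exactly in [H] and
    misses the same two. *)
Lemma facet_missing2 x y r : x ⊑ y -> rk y = rk x + r -> r < nlevel x y 1 ->
  exists F, [/\ x ⊑ F, F ⊑ y, rk y = (rk F).+1 & 2 <= #|out x y F|].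
Proof.
elim: r y => [|r IHr] y xy yx yr.
  have : nlevel x y 1 = 0; last by move=> e; rewrite e in yr.
  apply/eqP; rewrite cards_eq0 -subset0; apply/subsetP => z /levelP[xz zy zx].
  by have := rk_le zy; lia.
have xy' : x ⊏ y by apply: rk_ltW => //; nlia.
have [F [xF Fy yF]] := rk_cocover xy'.
have [F2|F1] := leqP 2 #|out x y F|; first by exists F; split=> //; exact: ltW.
have Fr : r < nlevel x F 1 by have := card_out x (ltW Fy); nlia.
have [H [xH HF FH H2]] := IHr F xF ltac:(nlia) Fr.
have HFs : H ⊏ F by apply: rk_ltW => //; nlia.
have [w1 [w2 [w12 Hw1 w1y Hw2 w2y]]] := thin (lt_trans HFs Fy) ltac:(nlia).
have [G [HG Gy FG]] : exists G, [/\ H ⊏ G, G ⊏ y & F != G].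
  have [e|] := eqVneq F w1; last by exists w1.
  by exists w2; split=> //; rewrite e.
have rHG := rk_lt HG; have rGy := rk_lt Gy.
have FGH : F &&& G = H by apply: coatom_meet; rewrite ?(ltW HG) //; nlia.
exists G; split; [exact: le_trans xH (ltW HG) | exact: ltW | nlia |].
apply: leq_trans H2 (subset_leq_card _); apply/subsetP => v /outP[vF vH].
apply/outP; split; first exact: (subsetP (level_subr _ _ (ltW Fy))).
apply: contraNN vH => vG; rewrite -FGH lexI vG andbT.
by have /levelP[] := vF.
Qed.

(* The lower bound of Xue for at most [2 r - 2] atoms: remove a facet that misses
   at least two atoms, apply induction to it and [over_mono] to the missed atoms. *)
Lemma nlevel_lower_bound x y r s k : x ⊑ y -> rk y = rk x + r ->
  r.-1 + s <= nlevel x y 1 -> 0 < s <= r.-1 ->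
  'C(r, k) + 'C(r.-1, k) <= nlevel x y k + 'C(r - s, k).
Proof.
elim: r y s => [|r IHr] y s xy yx ns s1r; first by nlia.
have L1 := bin_leq_nlevel k xy yx.
case: k L1 IHr => [|k] L1 IHr; first by move: L1; rewrite !bin0; nlia.
move: ns s1r; rewrite /= => ns s1r.
have [s1|s2] := leqP s 1.
  have -> : r.+1 - s = r by nlia.
  by rewrite leq_add2r.
have [F [xF Fy yF F2]] := facet_missing2 xy yx ltac:(nlia).
have L1F := @bin_leq_nlevel x F r k.+1 xF ltac:(nlia).
have cF := card_out x Fy.
(* With this many missed vertices, [r.+1] of them already give the full binomial: the residual one
   in [over_mono] has upper index [0]. *)
have [mr|mr] := leqP r.+1 #|out x y F|.
  have [|W /andP[_ WF] cW] := @exists_subset_card _ set0 (out x y F) r.+1 (sub0set _).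
    by rewrite cards0 mr.
  have := over_mono k yx (sub0set W) (subset_trans WF (out_sub _ _ _)) ltac:(nlia).
  have := facet_split_out k.+1 Fy WF.
  by rewrite over0 !cards0 cW subnn subn0 bin0n; nlia.
have := over_mono k yx (sub0set _) (out_sub x y F) ltac:(nlia).
have := facet_split_out k.+1 Fy (subxx (out x y F)).
rewrite over0 !cards0 subn0 => split1 split2.
have [ms|ms] := leqP #|out x y F| s; last first.
  by have := @leq_bin2r (r.+1 - #|out x y F|) (r.+1 - s) k.+1 ltac:(nlia); nlia.
have rF : rk F = rk x + r by nlia.
have nF : r.-1 + (s - #|out x y F|).+1 <= nlevel x F 1 by nlia.
have sF : 0 < (s - #|out x y F|).+1 <= r.-1 by nlia.
have := IHr F (s - #|out x y F|).+1 xF rF nF sF.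
(* Convexity replaces the deficits of the induction hypothesis and of [over_mono] by the permitted
   one, with index [r.+1 - s], and one with index [r.-1], which cancels a summand for [F]. *)
have := @bin_convex (r.+1 - s) (r.+1 - #|out x y F|) (#|out x y F| - 2) k.+1 ltac:(nlia).
have -> : r.+1 - s + (#|out x y F| - 2) = r - (s - #|out x y F|).+1 by nlia.
have -> : r.+1 - #|out x y F| + (#|out x y F| - 2) = r.-1 by nlia.
by nlia.
Qed.


(** * Faces that meet a facet in prescribed dimension *)

Lemma extend A F y : A ⊑ F -> A ⊑ y -> ~~ (y ⊑ F) ->
  exists B, [/\ A ⊑ B, B ⊑ y, rk B = (rk A).+1 & B &&& F = A].
Proof.
move=> AF Ay yF; have Ay' : A ⊏ y.
  by rewrite lt_neqAle Ay andbT; apply: contraNneq yF => <-.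
have [B [AB By BA BF]] := atom_avoid Ay' yF; exists B; split=> //.
apply/esym/rk_eq; first by rewrite lexI AB.
by have := rk_meet_lt BF; nlia.
Qed.

Definition meeting x y F k j : {set L} := [set z in level x y k | rk (z &&& F) == rk x + j].

Lemma meetingP x y F k j z :
  reflect (z \in level x y k /\ rk (z &&& F) = rk x + j) (z \in meeting x y F k j).
Proof. by rewrite [z \in meeting _ _ _ _ _]inE; apply: (iffP andP) => -[? /eqP]. Qed.

Lemma meeting_sum x y F k i j : F ⊑ y -> i < k -> j < k -> i != j ->
  nlevel x F k + #|meeting x y F k i| + #|meeting x y F k j| <= nlevel x y k.
Proof.
move=> Fy ik jk ij; have Mk l : meeting x y F k l \subset level x y k.
  by apply/subsetP => z /meetingP[].
have inF z : z \in level x F k -> rk (z &&& F) = rk x + k.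
  by move=> /levelP[_ zF <-]; congr rk; apply/eqP; rewrite eq_meetl.
apply: leq_trans (@leq_card_disjoint _ (level x F k :|: meeting x y F k i)
  (meeting x y F k j) (level x y k) _ (Mk j) _).
- rewrite leq_add2r cardsU; set I := _ :&: _; suff -> : I = set0 by rewrite cards0 subn0.
  apply/setP => z; rewrite [in RHS]inE; apply/negP; rewrite inE.
  by case/andP => /inF + /meetingP[_]; lia.
- by rewrite subUset Mk andbT; exact: level_subr.
- move=> z; rewrite inE => /orP[/inF + /meetingP[_] | /meetingP[_] + /meetingP[_]].
    by lia.
  by move: ij => /eqP; lia.
Qed.

(** Taking the meet with [F] maps these faces onto the faces of [F], by [extend]; those in [S] have
    two preimages. *)
Lemma leq_meeting x y F k (S : {set L}) : x ⊑ F -> F ⊏ y -> S \subset level x F k ->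
  (forall A, A \in S -> exists B1 B2, [/\ B1 != B2, B1 \in level x y k.+1,
     B2 \in level x y k.+1, B1 &&& F = A & B2 &&& F = A]) ->
  nlevel x F k + #|S| <= #|meeting x y F k.+1 k|.
Proof.
move=> xF Fy SF S2; apply: (@leq_card_fibers _ _ (meet^~ F)) => //.
  move=> A /levelP[xA AF Ak].
  have [||B [AB By BA BF]] := @extend A F y AF; first exact: le_trans AF (ltW Fy).
    by rewrite (lt_geF Fy).
  exists B => //; apply/meetingP; rewrite BF Ak; split=> //; apply/levelP.
  by split=> //; [exact: le_trans xA AB | nlia].
move=> A AS; have [B1 [B2 [B12 B1y B2y B1A B2A]]] := S2 A AS.
have /levelP[_ _ Ak] := subsetP SF A AS.
by exists B1, B2; split=> //; apply/meetingP; rewrite ?B1A ?B2A Ak.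
Qed.

Lemma nlevel_facet x y F k : x ⊑ F -> F ⊏ y ->
  nlevel x F k.+1 + nlevel x F k <= nlevel x y k.+1.
Proof.
move=> xF Fy; have M : nlevel x F k <= #|meeting x y F k.+1 k|.
  have := @leq_meeting x y F k set0 xF Fy (sub0set _); rewrite cards0 addn0; apply.
  by move=> A; rewrite inE.
apply: leq_trans (leq_add (leqnn _) M) _; apply: leq_card_disjoint.
- exact/level_subr/ltW.
- by apply/subsetP => z /meetingP[].
- move=> z /levelP[_ zF zk] /meetingP[_].
  by move: zF; rewrite -eq_meetl => /eqP->; nlia.
Qed.

Lemma level_over x y k v (V : {set L}) : v \in V -> v \in level x y 1 ->
  level v y k \subset over x y k.+1 V.
Proof.
move=> vV /levelP[xv vy vx]; apply/subsetP => z /levelP[vz zy zk].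
rewrite [z \in over _ _ _ _]inE; apply/andP; split; last by apply/existsP; exists v; rewrite vV.
by apply/levelP; split=> //; [exact: le_trans xv vz | nlia].
Qed.

(** Edges at [x] have no more than two vertices, which makes the far end of an edge unique. *)
Definition thin_edges x := forall e, x ⊑ e -> rk e = rk x + 2 -> nlevel x e 1 <= 2.

Lemma edge_third x y e u v w : thin_edges x -> e \in level x y 2 ->
  u \in level x y 1 -> v \in level x y 1 -> w \in level x y 1 ->
  u ⊑ e -> v ⊑ e -> w ⊑ e -> u != v -> w != u -> w = v.
Proof.
move=> edges /levelP[xe ey ek] /levelP[xu _ uk] /levelP[xv _ vk] /levelP[xw _ wk].
move=> ue ve we uv wu; apply/eqP; apply: contraT => wv.
have nE := edges e xe ek; suff : 3 <= nlevel x e 1 by move: nE; clear; lia.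
have <- : #|[set u; v; w]| = 3.
  by rewrite -setUA !cardsU1 !inE !cards1 !negb_or uv [u == w]eq_sym wu [v == w]eq_sym wv.
apply: subset_leq_card; apply/subsetP => t; rewrite !inE -orbA.
by move=> /or3P[] /eqP->; apply/and3P; split=> //; apply/eqP.
Qed.

(** If two missed vertices are adjacent, their edge is disjoint from [F] and adds to the edges with
    one end in [F]. Otherwise their stars are disjoint and contain at least [2 * r.-1] edges outside
    [F]. *)
Lemma extra_edge x y F r : thin_edges x -> x ⊑ F -> F ⊏ y -> rk y = rk x + r ->
  2 <= #|out x y F| -> nlevel x F 1 < 2 * r.-1 ->
  nlevel x F 2 + (nlevel x F 1).+1 <= nlevel x y 2.
Proof.
move=> edges xF Fy yr /card_gt1P[v1 [v2 [/outP[v1y v1F] /outP[v2y v2F] v12]]] Fr.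
have [/exists_inP[e ey /andP[v1e v2e]]|noe] :=
    boolP [exists e in level x y 2, (v1 ⊑ e) && (v2 ⊑ e)].
  have eF : ~~ (e ⊑ F) by apply: contraNN v1F => eF; exact: le_trans v1e eF.
  have eM : e \in meeting x y F 2 0.
    apply/meetingP; split=> //; have /levelP[xe _ ek] := ey.
    have := rk_meet_lt eF; have := @rk_le x (e &&& F); rewrite lexI xe xF => /(_ isT).
    suff : rk (e &&& F) <> rk x + 1 by nlia.
    move=> e1; have e1y : e &&& F \in level x y 1.
      apply/levelP; rewrite lexI xe xF; split=> //.
      exact: le_trans (leIr _ _) (ltW Fy).
    have e1v1 : e &&& F != v1 by apply: contraNneq v1F => <-; exact: leIr.
    have := edge_third edges ey v1y v2y e1y v1e v2e (leIl _ _) v12 e1v1.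
    by move=> e1v2; rewrite -e1v2 leIr in v2F.
  have := @leq_meeting x y F 1 set0 xF Fy (sub0set _) => /(_ _) M1.
  have := @meeting_sum x y F 2 1 0 (ltW Fy) isT isT isT.
  have : 0 < #|meeting x y F 2 0| by rewrite card_gt0; apply/set0Pn; exists e.
  suff : nlevel x F 1 + #|@set0 L| <= #|meeting x y F 2 1| by rewrite cards0; nlia.
  by apply: M1 => A; rewrite inE.
have V2 : [set v1; v2] \subset out x y F.
  by apply/subsetP => v; rewrite in_set2 => /orP[] /eqP->; apply/outP.
have := facet_split_out 2 (ltW Fy) V2; suff : 2 * r.-1 <= #|over x y 2 [set v1; v2]| by nlia.
have deg v : v \in level x y 1 -> r.-1 <= nlevel v y 1.
  move=> /levelP[xv vy vk]; rewrite -[X in X <= _]bin1; apply: bin_leq_nlevel => //.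
  by have := rk_le vy; nlia.
rewrite mul2n -addnn; apply: leq_trans (leq_add (deg _ v1y) (deg _ v2y)) _.
apply: leq_card_disjoint.
- by apply: level_over => //; rewrite !inE eqxx.
- by apply: level_over => //; rewrite !inE eqxx orbT.
- move=> e /levelP[v1e ey ek] /levelP[v2e _ _]; move/exists_inP: noe; apply; exists e.
    have /levelP[xv1 _ v1k] := v1y.
    by apply/levelP; split=> //; [exact: le_trans xv1 v1e | nlia].
  by rewrite v1e.
Qed.

(** The formula for nabla with [d = q + 2] and [m = k + 1]; the whole interval has length
    [d + 1]. *)
Definition bound q k := 'C(q.+3, k.+2) + 'C(q.+2, k.+2) + 'C(q.+1, k.+1).

Lemma facet_step x y F q : thin_edges x -> x ⊑ F -> F ⊏ y -> rk y = rk x + q.+3 ->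
  (forall k, 'C(q.+2, k.+2) + 'C(q.+1, k.+2) + 'C(q, k.+1) <= nlevel x F k.+2) ->
  2 * q + 3 <= nlevel x F 1 -> (2 * q + 4 <= nlevel x F 1) || (2 <= #|out x y F|) ->
  forall k, bound q k <= nlevel x y k.+2.
Proof.
move=> edges xF Fy yq IH F1 F2 [|k]; rewrite /bound; last first.
  have := nlevel_facet k.+2 xF Fy; have := IH k.+1; have := IH k.
  by rewrite !binS; nlia.
(* The edge bound asks for [2 * q + 4] edges outside [F], while [F] may have only [2 * q + 3]
   vertices; then [extra_edge] provides the last one. *)
suff : nlevel x F 2 + (2 * q + 4) <= nlevel x y 2.
  by have := IH 0; rewrite !binS !bin0 !bin1; lia.
have := nlevel_facet 1 xF Fy.
have [F4|F4] := leqP (2 * q + 4) (nlevel x F 1); first by nlia.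
have {}F2 : 2 <= #|out x y F| by case/orP: F2 => // /(leq_trans F4); rewrite ltnn.
have := extra_edge edges xF Fy yq F2; rewrite /=; nlia.
Qed.

(** Here [y] is a pyramid over [F]: every other facet contains the apex [v] and is determined by the
    ridge in which it meets [F]. *)
Lemma pyramid_ridges x y F : x ⊑ F -> F ⊏ y -> rk y = (rk F).+1 -> #|out x y F| = 1 ->
  forall r, rk y = rk x + r.+1 -> 0 < r -> nlevel x y r <= (nlevel x F r.-1).+1.
Proof.
move=> xF Fy yF /eqP/cards1P[v outv] r yr r0.
have /outP[vy vF] : v \in out x y F by rewrite outv inE.
have outE w : w \in level x y 1 -> w != v -> w ⊑ F.
  move=> wy; apply: contraNT => wF; have : w \in out x y F by apply/outP.
  by rewrite outv inE.
have [xv vley vk] := levelP _ _ _ _ vy.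
have coat G : G \in level x y r -> G != F ->
    [/\ v ⊑ G, G &&& F \in level x F r.-1 & ~~ (v ⊑ G &&& F)].
  move=> /levelP[xG Gy Gk] GF.
  have GnF : ~~ (G ⊑ F) by apply: rk_nle => //; nlia.
  have xG' : x ⊏ G by apply: rk_ltW => //; nlia.
  have vG : v ⊑ G.
    have [w [xw wG wk wF]] := atom_avoid xG' GnF.
    have [<- //|wv] := eqVneq w v; move: wF; rewrite outE //; apply/levelP.
    by split=> //; [exact: le_trans wG Gy | nlia].
  have [|H [xH HG GH vH]] := coatom_avoid (u := v) xG'.
    by apply/negP => /rk_le; nlia.
  have HF : H ⊑ F.
    apply: (@le_of_atoms x) => // w /levelP[xw wH wk]; apply: outE.
      by apply/levelP; split=> //; apply: le_trans wH (le_trans HG Gy).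
    by apply: contraNneq vH => <-.
  have HE : H = G &&& F.
    by apply: rk_eq; [rewrite lexI HG HF | have := rk_meet_lt GnF; nlia].
  rewrite -HE; split=> //; apply/levelP; split=> //; nlia.
have Fr : F \in level x y r by apply/levelP; split=> //; [exact: ltW | nlia].
rewrite {1}/nlevel (cardsD1 F) Fr add1n ltnS.
apply: (@leq_card_in_inj _ _ (meet^~ F)) => [G G'|G]; rewrite !in_setD1; last first.
  by move=> /andP[GF Gy]; have [] := coat G Gy GF.
move=> /andP[GF Gy] /andP[G'F G'y] E.
have [vG HF nvH] := coat G Gy GF; have [vG' _ _] := coat G' G'y G'F.
have [xG Gley Gk] := levelP _ _ _ _ Gy; have [xG' G'ley G'k] := levelP _ _ _ _ G'y.
apply/eqP; apply: contraT => GG'.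
have [_ _ Hk] := levelP _ _ _ _ HF.
have HG' : G &&& F ⊑ G' by rewrite E leIl.
have H := @coatom_meet G G' (G &&& F) GG' ltac:(nlia) (leIl _ _) HG' ltac:(nlia).
by rewrite -H lexI vG vG' in nvH.
Qed.



Lemma leq_two_cofaces x y F k B B' H : F ⊏ y -> x ⊑ H -> B ⊑ y -> B' ⊑ y ->
  B &&& F = H -> B' &&& F = H -> B &&& B' = H -> ~~ (B ⊑ H) -> ~~ (B' ⊑ H) ->
  nlevel x F k + nlevel x H k <= #|meeting x y F k.+1 k|.
Proof.
move=> Fy xH By B'y BF B'F BB' BH B'H.
have HF : H ⊑ F by rewrite -BF leIr.
apply: leq_meeting => //; first exact: le_trans xH HF.
  exact: level_subr.
move=> A /levelP[xA AH Ak].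
have ext G : G &&& F = H -> G ⊑ y -> ~~ (G ⊑ H) -> exists A1,
    [/\ A1 \in level x y k.+1, A1 &&& F = A, A1 ⊑ G & A1 &&& H = A].
  move=> GF Gy GH; have AG : A ⊑ G by apply: le_trans AH _; rewrite -GF leIl.
  have [A1 [AA1 A1G A1k A1H]] := extend AH AG GH.
  exists A1; split=> //.
    by apply/levelP; split; [exact: le_trans xA AA1 | exact: le_trans A1G Gy | nlia].
  rewrite -[RHS]A1H; apply: le_anti; rewrite !lexI !leIl /=.
  by rewrite -GF lexI leIr (le_trans (leIl _ _) A1G) GF (le_trans (leIr _ _) HF).
have [A1 [A1y A1F A1B A1H]] := ext B BF By BH.
have [A2 [A2y A2F A2B A2H]] := ext B' B'F B'y B'H.
exists A1, A2; split=> //; apply/eqP => E.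
have A1leH : A1 ⊑ H by rewrite -BB' lexI A1B E A2B.
move: A1leH; rewrite -eq_meetl A1H => /eqP E1.
by have /levelP[_ _] := A1y; rewrite -E1; nlia.
Qed.

(* Either two facets over a common ridge of [F] or a facet meeting [F] in
   codimension three produce the summand ['C(q.+1, k.+1)] that the faces of [F]
   and one face over each of them leave out. *)
Lemma two_apexes x y F q k : x ⊑ F -> F ⊏ y -> rk y = (rk F).+1 -> rk y = rk x + q.+3 ->
  #|out x y F| = 2 -> (nlevel x F q.+1).+1 < nlevel x y q.+2 ->
  nlevel x F k.+2 + nlevel x F k.+1 + 'C(q.+1, k.+1) <= nlevel x y k.+2.
Proof.
move=> xF Fy yF yq F2 Fq.
have Fy' : F ⊑ y by exact: ltW.
pose Cs := level x y q.+2 :\ F.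
have CsP G : G \in Cs -> [/\ x ⊑ G, G ⊑ y, rk G = rk F, G != F & ~~ (G ⊑ F)].
  rewrite in_setD1 => /andP[GF /levelP[xG Gy Gk]]; split=> //; first nlia.
  by apply: rk_nle => //; nlia.
have [/exists_inP[B BC BF]|noB] := boolP [exists B in Cs, rk (B &&& F) < rk x + q.+1];
    last first.
  have ridge G : G \in Cs -> G &&& F \in level x F q.+1.
    move=> GC; have [xG Gy GrF GF GnF] := CsP _ GC.
    apply/levelP; split; [by rewrite lexI xG xF | exact: leIr |].
    have := rk_meet_lt GnF; have : ~~ (rk (G &&& F) < rk x + q.+1).
      by apply: contraNN noB => ?; apply/exists_inP; exists G.
    by rewrite -leqNgt; nlia.
  have CsF : #|Cs| > nlevel x F q.+1.
    have cD : nlevel x y q.+2 = (F \in level x y q.+2) + #|Cs|.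
      by rewrite /nlevel (cardsD1 F).
    by move: Fq; rewrite cD; case: (F \in _); clear; lia.
  (* Pigeonhole: there are more facets besides [F] than ridges of [F], so two of them share a ridge
     [H]. *)
  have /dinjectivePn[B BC [B' B'C /esym E]] : ~~ dinjectiveb (meet^~ F) (mem Cs).
    apply/negP => /dinjectiveP I; move: CsF; rewrite ltnNge; apply/negP/negPn.
    by apply: leq_card_in_inj ridge; exact: I.
  have {B'C}/andP[B'B B'C] : (B' != B) && (B' \in Cs) by [].
  have [xB By BrF BF _] := CsP _ BC; have [xB' B'y B'rF B'F _] := CsP _ B'C.
  have HF := ridge B BC; move: HF E; set H := B &&& F => HF E.
  have [xH HleF Hk] := levelP _ _ _ _ HF.
  have HB : H ⊑ B by exact: leIl.
  have HB' : H ⊑ B' by rewrite -E leIl.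
  have BB'H : B &&& B' = H by apply: coatom_meet => //; [rewrite eq_sym | nlia | nlia].
  have nH G : rk G = rk F -> ~~ (G ⊑ H) by move=> GF; apply/negP => /rk_le; nlia.
  have := leq_two_cofaces k.+1 Fy xH By B'y erefl E BB'H (nH _ BrF) (nH _ B'rF).
  have := meeting_sum x Fy' (ltnSn k.+1) (ltn0Sn k.+1) isT.
  by have := @bin_leq_nlevel x H q.+1 k.+1 xH ltac:(nlia); nlia.
have [xB By BrF BneF BnF] := CsP _ BC.
have /cards2P[v1 [v2 [v12 outv]]] : #|out x y F| == 2 by rewrite F2.
have v1o : v1 \in out x y F by rewrite outv !inE eqxx.
have v2o : v2 \in out x y F by rewrite outv !inE eqxx orbT.
have xB' : x ⊏ B by apply: rk_ltW => //; nlia.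
have xCm : x ⊑ B &&& F by rewrite lexI xB xF.
have leC G : x ⊑ G -> G ⊑ B -> ~~ (v1 ⊑ G) -> ~~ (v2 ⊑ G) -> G ⊑ B &&& F.
  move=> xG GB v1G v2G; rewrite lexI GB; apply: (@le_of_atoms x) => // w /levelP[xw wG wk].
  apply: contraT => wF; have : w \in out x y F.
    by apply/outP; split=> //; apply/levelP; split=> //; exact: le_trans wG (le_trans GB By).
  by rewrite outv in_set2 => /orP[]/eqP wE; rewrite -wE wG in v1G v2G.
(* A facet [G] of [B] avoiding one apex has a facet avoiding the other. The latter lies in [B &&& F]
   and equals it for reasons of rank. *)
have coat v v' : v \in out x y F -> v' \in out x y F ->
    (forall G, x ⊑ G -> G ⊑ B -> ~~ (v ⊑ G) -> ~~ (v' ⊑ G) -> G ⊑ B &&& F) ->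
    exists G, [/\ x ⊑ G, G ⊑ B, rk B = (rk G).+1, ~~ (v ⊑ G) & 
      [/\ v' ⊑ G, B &&& F ⊑ G, rk (B &&& F) = rk x + q & G &&& F = B &&& F]].
  move=> /outP[/levelP[xv vy vk] vF] /outP[/levelP[xv' v'y v'k] v'F] lC.
  have [|G [xG GB BG vG]] := coatom_avoid (u := v) xB'; first by apply/negP => /rk_le; nlia.
  have v'G : v' ⊑ G.
    by apply: contraT => v'G; have /rk_le := lC _ xG GB vG v'G; nlia.
  have xG' : x ⊏ G by apply: rk_ltW => //; have := rk_le v'G; nlia.
  have [|K [xK KG GK v'K]] := coatom_avoid (u := v') xG'; first by apply/negP => /rk_le; nlia.
  have KC := lC K xK (le_trans KG GB) (contraNN (fun vK => le_trans vK KG) vG) v'K.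
  have KE : K = B &&& F by apply: rk_eq KC _; nlia.
  exists G; split=> //; split; rewrite -?KE //; first nlia.
  apply: le_anti; apply/andP; split; last by rewrite lexI KG KE leIr.
  by rewrite KE lexI leIr andbT; exact: le_trans (leIl _ _) GB.
have [G1 [xG1 G1B BG1 v1G1 [v2G1 CG1 Ck G1F]]] := coat v1 v2 v1o v2o leC.
have [|G2 [xG2 G2B BG2 v2G2 [v1G2 CG2 _ G2F]]] := coat v2 v1 v2o v1o.
  by move=> G xG GB vG v'G; exact: leC.
have /outP[_ v1F] := v1o; have /outP[_ v2F] := v2o.
have G12 : G1 != G2 by apply: contraNneq v2G2 => <-.
have G12C : G1 &&& G2 = B &&& F by apply: coatom_meet => //; nlia.
have nC v G : v ⊑ G -> ~~ (v ⊑ F) -> ~~ (G ⊑ B &&& F).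
  by move=> vG; apply: contraNN => GC; exact: le_trans vG (le_trans GC (leIr _ _)).
have := leq_two_cofaces k.+1 Fy xCm (le_trans G1B By) (le_trans G2B By) G1F G2F G12C
  (nC _ _ v2G1 v2F) (nC _ _ v1G2 v1F).
have := @meeting_sum x y F k.+2 k.+1 k Fy' (ltnSn _) (ltnW (ltnSn _)) (negbT (gtn_eqF (ltnSn k))).
rewrite binS.
have := @bin_leq_nlevel x (B &&& F) q k.+1 xCm Ck.
(* The summand is ['C(q, k.+1) + 'C(q, k)]. The second part comes from faces meeting [F] in
   codimension two: [A] is extended inside [G1], and the result is extended out of [G1] inside
   [B]. *)
suff : 'C(q, k) <= #|meeting x y F k.+2 k| by nlia.
apply: leq_trans (bin_leq_nlevel k xCm Ck) _.
apply: (@leq_card_fibers1 _ _ (meet^~ F)) => A /levelP[xA AC Ak].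
have AG1 : A ⊑ G1 by exact: le_trans AC CG1.
have [A1 [AA1 A1G A1k A1C]] := extend AC AG1 (nC _ _ v2G1 v2F).
have BG1n : ~~ (B ⊑ G1) by apply/negP => /rk_le; nlia.
have [Z [A1Z ZB Zk ZG1]] := extend A1G (le_trans A1G G1B) BG1n.
have AZ : A ⊑ Z by exact: le_trans AA1 A1Z.
have ZE : Z &&& F = A.
  have AZF : A ⊑ Z &&& F by rewrite lexI AZ (le_trans AC (leIr _ _)).
  apply/esym/rk_eq => //; apply: contraT; rewrite -ltnNge => lt.
  have ZFC : Z &&& F ⊑ B &&& F by rewrite lexI leIr (le_trans (leIl _ _) ZB).
  have ZFA1 : Z &&& F ⊑ A1.
    by rewrite -ZG1 lexI leIl (le_trans ZFC CG1).
  have E : Z &&& F = A1 by apply: rk_eq => //; nlia.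
  have A1leC : A1 ⊑ B &&& F by rewrite -E.
  by move: A1leC; rewrite -eq_meetl A1C => /eqP E1; rewrite -E1 in A1k; nlia.
exists Z => //; apply/meetingP; rewrite ZE Ak; split=> //; apply/levelP.
by split; [exact: le_trans xA AZ | exact: le_trans ZB By | nlia].
Qed.


Lemma two_apexes_bound x y F q : x ⊑ F -> F ⊏ y -> rk y = (rk F).+1 -> rk y = rk x + q.+3 ->
  #|out x y F| = 2 -> (nlevel x F q.+1).+1 < nlevel x y q.+2 -> 2 * q + 3 <= nlevel x F 1 ->
  forall k, bound q k <= nlevel x y k.+2.
Proof.
move=> xF Fy yF yq F2 Fq F1 k.
have FE : rk F = rk x + q.+2 by nlia.
have := two_apexes k xF Fy yF yq F2 Fq.
have lb j := @nlevel_lower_bound x F q.+2 q.+1 j xF FE ltac:(nlia) ltac:(nlia).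
have := lb k.+2; have := lb k.+1; rewrite /bound /= subSnn !binS bin0n.
case: k {lb} => [|k]; rewrite ?bin0 ?bin1 ?binS ?bin0n /=; nlia.
Qed.

(** * Additional faces at the vertices outside a facet *)

Lemma over_nonadjacent x y q k v1 v2 : rk y = rk x + q.+3 ->
  v1 \in level x y 1 -> v2 \in level x y 1 -> v1 != v2 ->
  (forall e, e \in level x y 2 -> v1 ⊑ e -> v2 ⊑ e -> False) ->
  'C(q.+3, k.+2) + 'C(q, k) <= #|over x y k.+2 [set v1; v2]| + 'C(q.+1, k.+2).
Proof.
move=> yq v1y v2y v12 nadj.
have [xv1 v1ley v1k] := levelP _ _ _ _ v1y; have [xv2 v2ley v2k] := levelP _ _ _ _ v2y.
have v2y' : v2 ⊏ y by apply: rk_ltW => //; nlia.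
have v1v2 : ~~ (v1 ⊑ v2) by apply: rk_nle => //; nlia.
(* Three disjoint families are counted: the faces over [v1], the faces over [v2] inside a facet [F]
   avoiding [v1], and the faces over an edge [e] at [v2] that leaves [F], inside a facet [G].
   Nonadjacency allows [G] to avoid [v1]. *)
have [F [v2F Fy yF v1F]] := coatom_avoid v2y' v1v2.
have yFn : ~~ (y ⊑ F) by apply/negP => /rk_le; nlia.
have [e [v2e ey ek eF]] := atom_avoid v2y' yFn.
have ein : e \in level x y 2.
  by apply/levelP; split=> //; [exact: le_trans xv2 v2e | nlia].
have v1e : ~~ (v1 ⊑ e) by apply/negP => /nadj; apply.
have ey' : e ⊏ y by apply: rk_ltW => //; nlia.
have [G [eG Gy yG v1G]] := coatom_avoid ey' v1e.
have v1V : v1 \in [set v1; v2] by rewrite !inE eqxx.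
have v2V : v2 \in [set v1; v2] by rewrite !inE eqxx orbT.
have c1 := @bin_leq_nlevel v1 y q.+2 k.+1 v1ley ltac:(nlia).
have c2 := @bin_leq_nlevel v2 F q.+1 k.+1 v2F ltac:(nlia).
have c3 := @bin_leq_nlevel e G q k eG ltac:(nlia).
have sub2 := subset_trans (level_subr v2 k.+1 Fy) (level_over k.+1 v2V v2y).
have sub3 : level e G k \subset over x y k.+2 [set v1; v2].
  apply: subset_trans (level_over k.+1 v2V v2y); apply/subsetP => z /levelP[ez zG zk].
  by apply/levelP; split; [exact: le_trans v2e ez | exact: le_trans zG Gy | nlia].
have d23 : #|level v2 F k.+1| + #|level e G k| <= #|level v2 F k.+1 :|: level e G k|.
  apply: leq_card_disjoint; rewrite ?subsetUl ?subsetUr // => z /levelP[_ zF _] /levelP[ez _ _].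
  by rewrite (le_trans ez zF) in eF.
have d123 : #|level v1 y k.+1| + #|level v2 F k.+1 :|: level e G k| <=
    #|over x y k.+2 [set v1; v2]|.
  apply: leq_card_disjoint; first exact: level_over.
    by rewrite subUset sub2 sub3.
  move=> z /levelP[v1z _ _]; rewrite in_setU => /orP[] /levelP[_ zF _].
    by rewrite (le_trans v1z zF) in v1F.
  by rewrite (le_trans v1z zF) in v1G.
by move: c1 c2 c3 d23 d123; rewrite /nlevel !binS; nlia.
Qed.

(** A vertex figure that is not a simplex gains ['C(q.+1, k)] by [nlevel_lower_bound] with [s = 2],
    just as much as two nonadjacent vertices do. *)
Lemma over_nonsimple x y q k v : rk y = rk x + q.+4 -> v \in level x y 1 ->
  q.+4 <= nlevel v y 1 ->
  'C(q.+4, k.+2) + 'C(q.+1, k) <= #|over x y k.+2 [set v]| + 'C(q.+3, k.+2).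
Proof.
move=> yq vy vn; have [xv vley vk] := levelP _ _ _ _ vy.
have := @nlevel_lower_bound v y q.+3 2 k.+1 vley ltac:(nlia) ltac:(nlia) ltac:(nlia).
have := subset_leq_card (level_over k.+1 (set11 v) vy).
by rewrite /nlevel /= !binS; nlia.
Qed.

(* [r - 1] is the length of the interval above an atom of [[x, y]]; an interval
   with as many atoms as its length is a simplex. *)
Lemma simple_coatom x y r G : x ⊑ G -> G ⊑ y -> rk y = (rk G).+1 -> rk y = rk x + r.+1 ->
  nlevel x y 1 <= r.+1 ->
  exists e, [/\ e \in level x y 1, ~~ (e ⊑ G) &
    forall e', e' \in level x y 1 -> e' != e -> e' ⊑ G].
Proof.
move=> xG Gy yG yr yn.
have := card_out x Gy; have := @bin_leq_nlevel x G r 1 xG ltac:(nlia); rewrite bin1 => Gn cG.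
have xy : x ⊏ y by apply: rk_ltW; [exact: le_trans xG Gy | nlia].
have yGn : ~~ (y ⊑ G) by apply/negP => /rk_le; nlia.
have [e [xe ey ek eG]] := atom_avoid xy yGn.
have eout : e \in out x y G by apply/outP; split=> //; apply/levelP; rewrite addn1.
exists e; split=> //; first by apply/levelP; rewrite addn1.
move=> e' e'y; apply: contraNT => e'G.
have : #|out x y G| <= 1 by nlia.
by move/card_le1_eqP => le1; apply/eqP/le1 => //; apply/outP.
Qed.

Lemma simple_coatom_unique x y r G G' e : x ⊑ G -> G ⊑ y -> rk y = (rk G).+1 ->
  x ⊑ G' -> G' ⊑ y -> rk y = (rk G').+1 -> rk y = rk x + r.+1 -> nlevel x y 1 <= r.+1 ->
  e \in level x y 1 -> ~~ (e ⊑ G) -> ~~ (e ⊑ G') -> G = G'.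
Proof.
move=> xG Gy yG xG' G'y yG' yr yn ey eG eG'.
have [e1 [_ _ e1all]] := simple_coatom xG' G'y yG' yr yn.
apply: rk_eq; last nlia; apply: (@le_of_atoms x) => // w /levelP[xw wG wk].
apply: (e1all); first by apply/levelP; split=> //; exact: le_trans wG Gy.
have -> : e1 = e by apply/eqP; apply: contraNT eG' => ?; rewrite e1all // eq_sym.
by apply: contraNneq eG => <-.
Qed.

Lemma simple_coatoms x y r : x ⊑ y -> rk y = rk x + r.+1 -> nlevel x y 1 <= r.+1 ->
  nlevel x y r <= nlevel x y 1.
Proof.
move=> xy yr yn.
have sim G : G \in level x y r -> exists e, [/\ e \in level x y 1, ~~ (e ⊑ G) &
    forall e', e' \in level x y 1 -> e' != e -> e' ⊑ G].
  move=> /levelP[xG Gy Gk]; have yG : rk y = (rk G).+1 by nlia.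
  exact: simple_coatom xG Gy yG yr yn.
pose f G := odflt x [pick e | (e \in level x y 1) && ~~ (e ⊑ G)].
have fP G : G \in level x y r -> f G \in level x y 1 /\ ~~ (f G ⊑ G).
  move=> /sim[e [ey eG _]]; rewrite /f; case: pickP => [e' /andP[]//|/(_ e)].
  by rewrite ey eG.
apply: (@leq_card_in_inj _ _ f) => [G G' Gr G'r E|G /fP[]//].
have [[xG Gy Gk] [xG' G'y G'k]] := (levelP _ _ _ _ Gr, levelP _ _ _ _ G'r).
have [fy fG] := fP G Gr; have [_] := fP G' G'r; rewrite -E => fG'.
have yG : rk y = (rk G).+1 by nlia.
have yG' : rk y = (rk G').+1 by nlia.
exact: simple_coatom_unique xG Gy yG xG' G'y yG' yr yn fy fG fG'.
Qed.


(** Without such a [V] every facet is [F], or one of at most [q.+3] through [v], or avoids [v]. A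
    facet of the last kind contains a neighbour [w] of [v] outside [F], and at the simple vertex [w]
    only one facet avoids the edge to [v]. Hence there is at most one, and the total stays below
    [q.+4 + 2]. *)
Lemma exists_gain x y F q k : thin_edges x -> x ⊑ F -> F ⊏ y -> rk y = (rk F).+1 ->
  rk y = rk x + q.+4 -> q.+4 + 2 <= nlevel x y q.+3 -> 0 < #|out x y F| ->
  exists V : {set L}, [/\ V \subset out x y F, #|V| <= 2 &
    'C(q.+4, k.+2) + 'C(q.+1, k) <= #|over x y k.+2 V| + 'C(q.+4 - #|V|, k.+2)].
Proof.
move=> edges xF Fy yF yq yn /card_gt0P[v vout].
have outy w : w \in out x y F -> w \in level x y 1 by move/(subsetP (out_sub _ _ _)).
have [/exists_inP[w wout wn]|simple] :=
    boolP [exists w in out x y F, q.+4 <= nlevel w y 1].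
  exists [set w]; rewrite sub1set wout cards1 subn1; split=> //.
  exact: over_nonsimple yq (outy _ wout) wn.
have {}simple w : w \in out x y F -> nlevel w y 1 <= q.+3.
  by move=> wout; rewrite leqNgt; apply: contraNN simple => ?; apply/exists_inP; exists w.
pose adj u w := [exists e in level x y 2, (u ⊑ e) && (w ⊑ e)].
have [/exists_inP[u uo /exists_inP[w wo /andP[uw nadj]]]|alladj] := boolP
    [exists u in out x y F, exists w in out x y F, (u != w) && ~~ adj u w].
  exists [set u; w]; rewrite subUset !sub1set uo wo cards2 uw; split=> //.
  rewrite /= !subSS subn0; apply: over_nonadjacent => //; [exact: outy|exact: outy|].
  by move=> e ey ue we; move/exists_inP: nadj; apply; exists e; rewrite ?ue.
have {}alladj u w : u \in out x y F -> w \in out x y F -> u != w ->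
    exists e, [/\ e \in level x y 2, u ⊑ e & w ⊑ e].
  move=> uo wo uw; have : adj u w.
    apply: contraNT alladj => nadj; apply/exists_inP; exists u => //.
    by apply/exists_inP; exists w; rewrite ?uw.
  by case/exists_inP => e ey /andP[ue we]; exists e.
have {}adj u w : u \in out x y F -> w \in out x y F -> u != w ->
    exists e, [/\ e \in level x y 2, e \in level u y 1, u ⊑ e & w ⊑ e].
  move=> uo wo uw; have [e [ey ue we]] := alladj u w uo wo uw.
  exists e; split=> //; have [xe ley ek] := levelP _ _ _ _ ey.
  by have [xu uy uk] := levelP _ _ _ _ (outy _ uo); apply/levelP; split=> //; nlia.
have [xv vy vk] := levelP _ _ _ _ (outy _ vout).
have Fr : F \in level x y q.+3 by apply/levelP; split=> //; [exact: ltW | nlia].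
pose K := [set G in level x y q.+3 :\ F | ~~ (v ⊑ G)].
have KP G : G \in K -> [/\ x ⊑ G, G ⊑ y, rk y = (rk G).+1, ~~ (v ⊑ G) &
    exists w, [/\ w \in out x y F, w != v & w ⊑ G]].
  rewrite [G \in K]inE in_setD1 => /andP[/andP[GF /levelP[xG Gy Gk]] vG].
  split=> //; first nlia.
  have GnF : ~~ (G ⊑ F) by apply: rk_nle => //; nlia.
  have xG' : x ⊏ G by apply: rk_ltW => //; nlia.
  have [w [xw wG wk wF]] := atom_avoid xG' GnF; exists w; split=> //.
    apply/outP; split=> //; apply/levelP; rewrite addn1; split=> //.
    exact: le_trans wG Gy.
  by apply: contraNneq vG => <-.
have K1 : #|K| <= 1.
  apply/card_le1_eqP => G G' /KP[xG Gy Gk vG [w [wo wv wG]]] /KP[xG' G'y G'k vG' [w' [w'o w'v w'G']]].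
  have yw u : u \in out x y F -> rk y = rk u + q.+3.
    by move=> /outy/levelP[_ _]; nlia.
  (* At the simple vertex [w], the facet [G] lacks only the edge to [v], so it contains the edge to
     [w']. *)
  have w'G : w' ⊑ G.
    have [->//|w'w] := eqVneq w' w.
    have [e [ex ew we ve]] := adj w v wo vout wv.
    have [e' [e'x e'w we' w'e']] := adj w w' wo w'o ltac:(by rewrite eq_sym).
    have eG : ~~ (e ⊑ G) by apply: contraNN vG; exact: le_trans ve.
    have [e1 [_ _ e1all]] := simple_coatom wG Gy Gk (yw _ wo) (simple _ wo).
    have e1e : e1 = e by apply/eqP; apply: contraNT eG => ?; rewrite e1all // eq_sym.
    apply: (le_trans w'e'); apply: e1all => //; rewrite e1e; apply/eqP => e'e.
    have := edge_third edges ex (outy _ wo) (outy _ vout) (outy _ w'o) we ve.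
    by rewrite -e'e => /(_ w'e' wv w'w) E; rewrite E eqxx in w'v.
  have [e [ex ew we ve]] := adj w' v w'o vout w'v.
  apply/esym/(simple_coatom_unique w'G Gy Gk w'G' G'y G'k (yw _ w'o) (simple _ w'o) ew).
    by apply: contraNN vG; exact: le_trans ve.
  by apply: contraNN vG'; exact: le_trans ve.
have vcoat : #|level v y q.+2| <= q.+3.
  apply: leq_trans (simple _ vout); apply: simple_coatoms (simple _ vout) => //; nlia.
suff : #|level x y q.+3| <= q.+3 + 2 by move: yn; rewrite /nlevel; lia.
rewrite (cardsD1 F) Fr /= -(cardsID [set G | v ⊑ G] (_ :\ F)).
have -> : (level x y q.+3 :\ F) :\: [set G | v ⊑ G] = K.
  by apply/setP => G; rewrite [in RHS]inE [in LHS]inE [X in ~~ X && _]inE andbC.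
suff : #|(level x y q.+3 :\ F) :&: [set G | v ⊑ G]| <= #|level v y q.+2| by lia.
apply/subset_leq_card/subsetP => G; rewrite in_setI in_setD1 [X in _ && X]inE.
by move=> /andP[/andP[_ /levelP[xG Gy Gk]] vG]; apply/levelP; split=> //; nlia.
Qed.

Lemma nonsimplex_facet x y F q k : thin_edges x -> x ⊑ F -> F ⊏ y -> rk y = (rk F).+1 ->
  rk y = rk x + q.+4 -> 2 * q + 7 <= nlevel x y 1 -> q.+4 + 2 <= nlevel x y q.+3 ->
  q.+4 <= nlevel x F 1 -> 2 < #|out x y F| -> bound q.+1 k <= nlevel x y k.+2.
Proof.
move=> edges xF Fy yF yq n1 nq Fn F3; have Fy' := ltW Fy.
have [|V [VF V2 gain]] := exists_gain k edges xF Fy yF yq nq; first by lia.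
have cF := card_out x Fy'.
(* The largest value that [nlevel_lower_bound] allows for [F]. Then [q + 5 - s] vertices are
   available outside [F], and convexity turns the two deficits into ['C(1, k.+2) = 0] and
   ['C(q.+1, k.+2)]. *)
pose s := minn (nlevel x F 1 - q - 2) q.+2.
have [sle1 sle2] : s <= nlevel x F 1 - q - 2 /\ s <= q.+2 by rewrite geq_minl geq_minr.
have s2 : 2 <= s by rewrite /s leq_min; lia.
have [|W /andP[VW WF] cW] := @exists_subset_card _ V (out x y F) (q + 5 - s) VF.
  by rewrite /s; case: leqP; lia.
have := over_mono k.+1 yq VW (subset_trans WF (out_sub _ _ _)) ltac:(nlia).
have := facet_split_out k.+2 Fy' WF.
have := @nlevel_lower_bound x F q.+3 s k.+2 xF ltac:(nlia) ltac:(nlia) ltac:(nlia).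
have := @bin_convex 1 (q.+3 - s) (s - 2) k.+2 ltac:(lia).
rewrite cW; have -> : q.+4 - (q + 5 - s) = 1 + (s - 2) by lia.
have -> : q.+3 - s + (s - 2) = q.+1 by lia.
move: gain; rewrite /bound /= (@bin_small 1) //.
move: 'C(_ - #|V|, _) 'C(1 + _, _) 'C(q.+3 - s, _) => a b c.
rewrite !binS; nlia.
Qed.


(** * Intervals whose proper faces are simplices *)

Lemma simplex_faces x F z : x ⊑ z -> z ⊑ F -> nlevel x F 1 <= rk F - rk x ->
  nlevel x z 1 <= rk z - rk x.
Proof.
move=> xz; move: {2}(rk F) (leqnn (rk F)) => n; elim: n F => [|n IHn] F Fn.
  rewrite le_eqVlt => /predU1P[->//|/rk_lt]; nlia.
rewrite le_eqVlt => /predU1P[->//|zF nF].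
have [G [zG GF FG]] := rk_cocover zF; apply: (IHn G) => //; first nlia.
have xF : x ⊏ F by exact: le_lt_trans xz zF.
have [v [xv vF vk vG]] := @atom_avoid x F G xF ltac:(by rewrite (lt_geF GF)).
have vout : v \in out x F G by apply/outP; split=> //; apply/levelP; rewrite addn1.
have : 0 < #|out x F G| by apply/card_gt0P; exists v.
by have := card_out x (ltW GF); have := rk_lt xF; have := rk_le (le_trans xz zG); nlia.
Qed.

Definition simplicial x y := forall z, x ⊑ z -> z ⊏ y -> nlevel x z 1 <= rk z - rk x.

Lemma simplicial_adjacent x y z v w : simplicial x y -> v \in level x y 1 -> z ⊏ y ->
  v ⊑ z -> w \in level x y 1 -> w ⊑ z -> w != v ->
  exists2 e, e \in level v y 1 & w ⊑ e.
Proof.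
move=> simp vy zy vz wy wz wv; have [xv vley vk] := levelP _ _ _ _ vy.
have xz := le_trans xv vz.
have at_ e : e \in level v z 1 -> exists a, (a \in level x z 1 :\ v) && (a ⊑ e).
  move=> /levelP[ve ez ek]; have xe : x ⊏ e by apply: rk_ltW; [exact: le_trans xv ve | nlia].
  have [|a [xa ae ak av]] := @atom_avoid x e v xe; first by apply/negP => /rk_le; nlia.
  exists a; rewrite ae andbT in_setD1; apply/andP; split.
    by apply: contraNneq av => ->.
  by apply/levelP; rewrite addn1; split=> //; exact: le_trans ae ez.
pose f e := odflt x [pick a | (a \in level x z 1 :\ v) && (a ⊑ e)].
have fP e : e \in level v z 1 -> f e \in level x z 1 :\ v /\ f e ⊑ e.
  move=> /at_[a ae]; rewrite /f; case: pickP => [? /andP[]//|/(_ a)].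
  by rewrite ae.
have fI : {in level v z 1 &, injective f}.
  move=> e e' ez e'z E; have [[fe fle] [_ fle']] := (fP e ez, fP e' e'z).
  apply/eqP; apply: contraT => ee'.
  have [[ve _ ek] [ve' _ e'k]] := (levelP _ _ _ _ ez, levelP _ _ _ _ e'z).
  have E1 := @coatom_meet e e' v ee' ltac:(nlia) ve ve' ltac:(nlia).
  have fv : f e ⊑ v by rewrite -E1 lexI fle E.
  move: fe; rewrite in_setD1 => /andP[fnv /levelP[_ _ fk]].
  by case/eqP: fnv; apply: rk_eq => //; nlia.
have vz1 : v \in level x z 1 by apply/levelP.
have cA : nlevel x z 1 = (#|level x z 1 :\ v|).+1 by rewrite /nlevel (cardsD1 v) vz1.
have imE : f @: level v z 1 = level x z 1 :\ v.
  apply/eqP; rewrite eqEcard; apply/andP; split.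
    by apply/subsetP => _ /imsetP[e ez ->]; have [] := fP e ez.
  rewrite card_in_imset //; have := simp z xz zy; rewrite cA.
  have := @bin_leq_nlevel v z (rk z - rk v) 1 vz ltac:(have := rk_le vz; nlia).
  by rewrite bin1 /nlevel; nlia.
have : w \in level x z 1 :\ v.
  by rewrite in_setD1 wv; have [xw _ wk] := levelP _ _ _ _ wy; apply/levelP.
rewrite -imE => /imsetP[e ez wE]; exists e; last by have [_] := fP e ez; rewrite -wE.
exact: (subsetP (level_subr _ _ (ltW zy))).
Qed.

(** Three disjoint families are counted: faces through [v], faces opposite to [v] in a face through
    [v], and faces over [q.+3] vertices not adjacent to [v]. These vertices exist since [v] has at
    most [q.+3] neighbours. As [k <= q], the faces through [v] that occur are proper, so
    [simplicial_adjacent] separates the families. *)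
Lemma simplicial_bound_simple x y q k v : thin_edges x -> x ⊑ y -> rk y = rk x + q.+4 ->
  simplicial x y -> k <= q -> 2 * q + 7 <= nlevel x y 1 ->
  v \in level x y 1 -> nlevel v y 1 <= q.+3 -> bound q.+1 k <= nlevel x y k.+2.
Proof.
move=> edges xy yq simp kq n1 vy vn; have [xv vley vk] := levelP _ _ _ _ vy.
pose adj w := [exists e in level v y 1, w ⊑ e].
pose W := [set w in level x y 1 | (w != v) && ~~ adj w].
have cW : q.+3 <= #|W|.
  have : #|[set w in level x y 1 :\ v | adj w]| <= nlevel v y 1.
    pose f w := odflt x [pick e in level v y 1 | w ⊑ e].
    have fP w : adj w -> f w \in level v y 1 /\ w ⊑ f w.
      move=> /exists_inP[e ey we]; rewrite /f; case: pickP => [? /andP[]//|/(_ e)].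
      by rewrite /= ey we.
    have AP w : w \in [set w in level x y 1 :\ v | adj w] ->
        [/\ w != v, w \in level x y 1 & adj w].
      by rewrite [w \in _]inE in_setD1 => /andP[/andP[]].
    apply: (@leq_card_in_inj _ _ f) => [w w'|w /AP[_ _ /fP[]]//].
    move=> /AP[wv wy /fP[fy wf]] /AP[w'v w'y /fP[_ w'f]] E.
    have [vf fley fk] := levelP _ _ _ _ fy.
    have fx : f w \in level x y 2.
      by apply/levelP; split=> //; [exact: le_trans xv vf | nlia].
    rewrite eq_sym in wv; rewrite -E in w'f.
    by apply/esym; apply: (edge_third edges fx vy wy w'y).
  have cD : nlevel x y 1 = (#|level x y 1 :\ v|).+1 by rewrite /nlevel (cardsD1 v) vy.
  have := cardsID [set w | adj w] (level x y 1 :\ v).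
  have -> : (level x y 1 :\ v) :\: [set w | adj w] = W.
    by apply/setP => w; rewrite in_setD in_setD1 [in LHS]inE [in RHS]inE andbC andbA [X in X && _]andbC.
  rewrite setIdE; lia.
have [|W' /andP[_ W'W] cW'] := @exists_subset_card _ set0 W q.+3 (sub0set _).
  by rewrite cards0 cW.
have W'at : W' \subset level x y 1.
  by apply: subset_trans W'W _; apply/subsetP => w; rewrite [w \in W]inE => /andP[].
have clean z w : z ⊏ y -> v ⊑ z -> w \in W' -> w ⊑ z -> False.
  move=> zy vz /(subsetP W'W); rewrite [w \in W]inE => /and3P[wy wv /exists_inP nadj] wz.
  by have [e ey we] := simplicial_adjacent simp vy zy vz wy wz wv; apply: nadj; exists e.
pose g z := odflt x [pick G | [&& x ⊑ G, G ⊑ z, rk z == (rk G).+1 & ~~ (v ⊑ G)]].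
have gP z : z \in level v y k.+2 ->
    [/\ g z \in level x y k.+2, g z ⊑ z, rk z = (rk (g z)).+1, ~~ (v ⊑ g z) & z ⊏ y].
  move=> /levelP[vz zy zk]; have xz : x ⊏ z by apply: rk_ltW; [exact: le_trans vz | nlia].
  have [|G [xG Gz zG vG]] := @coatom_avoid x z v xz; first by apply/negP => /rk_le; nlia.
  rewrite /g; case: pickP => [G' /and4P[xG' G'z /eqP zG' vG']|/(_ G)] /=; last first.
    by rewrite xG Gz zG eqxx vG.
  split=> //; last by apply: rk_ltW => //; nlia.
  by apply/levelP; split=> //; [exact: le_trans G'z zy | nlia].
have gI : {in level v y k.+2 &, injective g}.
  move=> z z' zy z'y E; have [[gy gz zg vg _] [_ gz' zg' _ _]] := (gP z zy, gP z' z'y).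
  apply/eqP; apply: contraT => zz'; rewrite -E in gz' zg'.
  have M := @coatom_meet z z' (g z) zz' ltac:(nlia) gz gz' zg.
  have [[vz _ _] [vz' _ _]] := (levelP _ _ _ _ zy, levelP _ _ _ _ z'y).
  by rewrite -M lexI vz vz' in vg.
have S1 : level v y k.+1 \subset level x y k.+2.
  apply/subsetP => z /levelP[vz zy zk].
  by apply/levelP; split=> //; [exact: le_trans xv vz | nlia].
have S2 : g @: level v y k.+2 \subset level x y k.+2.
  by apply/subsetP => _ /imsetP[z /gP[gz _ _ _ _] ->].
have d12 : #|level v y k.+1| + #|level v y k.+2| <=
    #|level v y k.+1 :|: g @: level v y k.+2|.
  rewrite -(card_in_imset gI); apply: leq_card_disjoint; rewrite ?subsetUl ?subsetUr //.
  by move=> z /levelP[vz _ _] /imsetP[z' /gP[_ _ _ vg _] zE]; rewrite -zE vz in vg.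
have d123 : #|level v y k.+1 :|: g @: level v y k.+2| + #|over x y k.+2 W'| <=
    nlevel x y k.+2.
  apply: leq_card_disjoint; rewrite ?subUset ?S1 ?S2 ?over_sub // => z.
  rewrite in_setU [in X in _ -> X -> _]inE => zS /andP[_ /exists_inP[w wW' wz]].
  case/orP: zS => [/levelP[vz zy zk]|/imsetP[z' z'y zE]].
    by apply: clean vz wW' wz; apply: rk_ltW => //; nlia.
  have [vz' _ _] := levelP _ _ _ _ z'y.
  have [_ gz' _ _ z'lt] := gP _ z'y; apply: clean z'lt vz' wW' _.
  by apply: le_trans wz _; rewrite zE.
have := over_mono k.+1 yq (sub0set _) W'at ltac:(nlia).
rewrite over0 !cards0 cW' subn0 subSnn (@bin_small 1) //.
have b1 := @bin_leq_nlevel v y q.+3 k.+1 vley ltac:(nlia).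
have b2 := @bin_leq_nlevel v y q.+3 k.+2 vley ltac:(nlia).
move: b1 b2 d12 d123; rewrite /bound /nlevel !binS; nlia.
Qed.

Lemma simplicial_bound_nonsimple x y q k : x ⊑ y -> rk y = rk x + q.+4 ->
  simplicial x y -> k <= q -> 2 * q + 7 <= nlevel x y 1 ->
  (forall v, v \in level x y 1 -> q.+4 <= nlevel v y 1) -> bound q.+1 k <= nlevel x y k.+2.
Proof.
move=> xy yq simp kq n1 vn.
(* The value of [nlevel_lower_bound] for a vertex figure with [s = 2], simplified by Pascal's
   rule. *)
pose c := 'C(q.+3, k.+1) + 'C(q.+1, k).
have cn v : v \in level x y 1 -> c <= nlevel v y k.+1.
  move=> vy; have [xv vley vk] := levelP _ _ _ _ vy.
  have := @nlevel_lower_bound v y q.+3 2 k.+1 vley ltac:(nlia)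
    ltac:(have := vn v vy; nlia) ltac:(nlia).
  by rewrite /c /= !binS; nlia.
have : nlevel x y 1 * c <= k.+2 * nlevel x y k.+2.
  have -> : nlevel x y 1 * c = \sum_(v in level x y 1) c by rewrite sum_nat_const.
  have -> : k.+2 * nlevel x y k.+2 = \sum_(z in level x y k.+2) k.+2.
    by rewrite sum_nat_const mulnC.
  apply: (@leq_trans (\sum_(v in level x y 1) nlevel v y k.+1)); first exact: leq_sum.
  apply: (@leq_trans (\sum_(v in level x y 1) \sum_(z in level x y k.+2 | v ⊑ z) 1)).
    apply: leq_sum => v vy; have [xv vley vk] := levelP _ _ _ _ vy.
    rewrite sum1dep_card; apply/subset_leq_card/subsetP => z /levelP[vz zy zk].
    rewrite inE vz andbT; apply/levelP; split=> //; [exact: le_trans xv vz | nlia].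
  rewrite (exchange_big_dep (mem (level x y k.+2))) => [|v z _ /andP[]//].
  apply: leq_sum => z zy; rewrite sum1dep_card; have [xz zley zk] := levelP _ _ _ _ zy.
  have zlt : z ⊏ y by apply: rk_ltW => //; nlia.
  have := simp z xz zlt; rewrite zk addKn; apply: leq_trans.
  apply/subset_leq_card/subsetP => v; rewrite inE => /andP[/levelP[xv vy vk] /andP[_ vz]].
  by apply/levelP.
have := leq_mul n1 (leqnn c) => /leq_trans h /h {h} cN.
have e1 := mul_bin_diag q.+4 k.+1; have e2 := mul_bin_diag q.+3 k.+1.
have e3 := mul_bin_diag q.+2 k.
rewrite -(@leq_pmul2l k.+2) //; apply: leq_trans cN.
have e4 := binS q.+2 k; rewrite !succnK in e1 e2 e3.
(* Absorption gives [k.+1 * 'C(q.+2, k.+1) = q.+2 * 'C(q.+1, k)], and [k.+2] is at most twice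
   [k.+1]. *)
have kc1 : k.+2 * 'C(q.+2, k.+1) <= 2 * (q.+2 * 'C(q.+1, k)).
  by rewrite e3 mulnA leq_mul2r; apply/orP; right; lia.
rewrite /bound /c; move: kc1 e1 e2; rewrite e4.
move: 'C(q.+2, k.+1) 'C(q.+2, k) 'C(q.+1, k) 'C(_, _) 'C(_, _) => c1 a d A B.
clear; nia.
Qed.

Theorem thin_semilattice_bound x y q k : thin_edges x -> x ⊑ y -> rk y = rk x + q.+3 ->
  2 * q + 5 <= nlevel x y 1 -> q + 5 <= nlevel x y q.+2 -> bound q k <= nlevel x y k.+2.
Proof.
move=> edges; elim: q y k => [|q IHq] y k xy yq n1 nq.
all: have L1 := bin_leq_nlevel k.+2 xy yq.
  (* For a polygon the edges are the facets, and the bound is the assumed [5]. *)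
  case: k L1 => [|k] L1; first exact: nq.
  by rewrite /bound (@bin_small 2) // (@bin_small 1) // !addn0.
have [kq|] := ltnP q k.
  (* For [k = q.+1] the faces are the facets and the bound is the assumed [q + 6]; beyond that it
     reduces to the simplex bound. *)
  have [E|kq'] := eqVneq k q.+1; last first.
    by move: L1; rewrite /bound (@bin_small q.+3) ?(@bin_small q.+2); lia.
  rewrite /bound E !binn; apply: leq_trans nq.
  by rewrite -[X in 'C(X, _)]/(1 + q.+3) binSn; lia.
move=> kq; have xy' : x ⊏ y by apply: rk_ltW => //; nlia.
have coat F : x ⊑ F -> rk y = (rk F).+1 -> rk F = rk x + q.+3 by move=> ? ?; nlia.
have out1 F : x ⊑ F -> F ⊏ y -> 0 < #|out x y F|.
  move=> xF Fy; have [|v [xv vy vk vF]] := @atom_avoid x y F xy'; first by rewrite (lt_geF Fy).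
  by apply/card_gt0P; exists v; apply/outP; split=> //; apply/levelP; rewrite addn1.
have step F : x ⊑ F -> F ⊏ y -> rk y = (rk F).+1 -> q + 5 <= nlevel x F q.+2 ->
    2 * q + 5 <= nlevel x F 1 -> (2 * q + 6 <= nlevel x F 1) || (2 <= #|out x y F|) ->
    bound q.+1 k <= nlevel x y k.+2.
  move=> xF Fy yF Fq F1 F2; have FE := coat F xF yF.
  apply: (facet_step edges xF Fy yq) => [j||].
  - exact: IHq xF FE F1 Fq.
  - by move: F1; clear; lia.
  - by case/orP: F2 => F2; apply/orP; [left; move: F2; clear; lia | right].
pose facet F := [&& x ⊑ F, F ⊏ y & rk y == (rk F).+1].
(* A facet that misses one vertex is the base of a pyramid; it has [2 * q + 6] vertices and, by
   [pyramid_ridges], enough ridges for the induction. *)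
have [/existsP[F /andP[/and3P[xF Fy /eqP yF] /eqP F1]]|pyr] :=
    boolP [exists F, facet F && (#|out x y F| == 1)].
  have cF := card_out x (ltW Fy).
  have := pyramid_ridges xF Fy yF F1 yq isT; rewrite /= => rF.
  by apply: step xF Fy yF _ _ _; [nlia | nlia | apply/orP; left; nlia].
have {out1 pyr}out2 F : x ⊑ F -> F ⊏ y -> rk y = (rk F).+1 -> 2 <= #|out x y F|.
  move=> xF Fy yF; rewrite ltn_neqAle out1 // andbT eq_sym.
  by apply: contraNN pyr => F1; apply/existsP; exists F; rewrite /facet xF Fy yF eqxx.
have [/existsP[F /andP[/and3P[xF Fy /eqP yF] nF]]|simplex] :=
    boolP [exists F, facet F && (q.+4 <= nlevel x F 1)].
  have F2 := out2 F xF Fy yF; have cF := card_out x (ltW Fy).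
  have [F3|F3] := ltnP 2 #|out x y F|.
    by apply: nonsimplex_facet edges xF Fy yF yq _ _ nF F3; nlia.
  have {F2 F3}F2 : #|out x y F| = 2 by apply/eqP; rewrite eqn_leq F3.
  have [Fq|Fq] := leqP (q + 5) (nlevel x F q.+2).
    by apply: step xF Fy yF Fq _ _; [nlia | apply/orP; right; rewrite F2].
  have Fq' : (nlevel x F q.+2).+1 < nlevel x y q.+3 by nlia.
  have F1 : 2 * q.+1 + 3 <= nlevel x F 1 by nlia.
  exact: two_apexes_bound xF Fy yF yq F2 Fq' F1 k.
have simp : simplicial x y.
  move=> z xz zy; have [F [zF Fy yF]] := rk_cocover zy.
  have xF := le_trans xz zF; apply: simplex_faces xz zF _.
  rewrite leqNgt; apply: contraNN simplex => nF; apply/existsP; exists F.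
  by rewrite /facet xF Fy yF eqxx /=; have := coat F xF yF; nlia.
have [/exists_inP[v vy vn]|nonsimple] :=
    boolP [exists v in level x y 1, nlevel v y 1 <= q.+3].
  by apply: simplicial_bound_simple edges xy yq simp kq _ vy vn; nlia.
apply: simplicial_bound_nonsimple xy yq simp kq _ _ => [|v vy]; first nlia.
by rewrite ltnNge; apply: contraNN nonsimple => ?; apply/exists_inP; exists v.
Qed.

End ThinSemilattice.

End Thin.

(** * Invariance of domain *)

From mathcomp Require Import all_order all_algebra.
Import GRing.Theory.
Local Open Scope ring_scope.

Lemma F2_addrr (x : 'F_2) : x + x = 0.
Proof. by apply/val_inj; case: x => -[|[|]]. Qed.

Lemma F2_eq (x y : 'F_2) : x + y = 0 -> x = y.
Proof. by move=> xy; rewrite -[x]addr0 -(F2_addrr y) addrA xy add0r. Qed.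

(** * Modulo 2 cup products of cubical cochains *)

Section CubicalCochains.
Context (n N : nat).
Local Notation point := {ffun 'I_n -> 'I_N.+1}.
Implicit Types (k l : 'I_n) (p q : point) (D : {set 'I_n}) (b : point -> 'F_2).

(** Past the last grid point [inord] falls back to [0], so [shift] wraps around. Points of [box D]
    have coordinates below [N] in the directions of [D], where this does not happen. *)
Definition shift k q : point := [ffun i => if i == k then inord (q i).+1 else q i].

Lemma shiftC k l q : k != l -> shift k (shift l q) = shift l (shift k q).
Proof.
move=> kl; apply/ffunP => i; rewrite !ffunE.
by case: eqVneq => [->|//]; rewrite (negbTE kl).
Qed.

Lemma sum_pairs_swap D (f : 'I_n -> 'I_n -> 'F_2) :
  \sum_(k in D) \sum_(l in D :\ k) f k l = \sum_(k in D) \sum_(l in D :\ k) f l k.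
Proof.
rewrite (exchange_big_dep (mem D)) => [|k l _] /=; last by rewrite !inE => /andP[].
by apply: eq_bigr => k kD; apply: eq_bigl => l; rewrite !inE kD eq_sym andbT andbC.
Qed.

Lemma sum_pairs_sym D (f : 'I_n -> 'I_n -> 'F_2) :
  (forall k l, k != l -> f k l = f l k) -> \sum_(k in D) \sum_(l in D :\ k) f k l = 0.
Proof.
move=> fC; pose S (P : rel 'I_n) := \sum_(k in D) \sum_(l in D :\ k) (if P k l then f k l else 0).
have -> : \sum_(k in D) \sum_(l in D :\ k) f k l =
    S (fun k l => k < l)%N + S (fun k l => l < k)%N.
  rewrite -big_split /=; apply: eq_bigr => k _; rewrite -big_split /=.
  apply: eq_bigr => l; rewrite !inE => /andP[lk _].
  by case: ltngtP lk => [||/val_inj->]; rewrite ?addr0 ?add0r ?eqxx.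
have -> : S (fun k l => l < k)%N = S (fun k l => k < l)%N; last exact: F2_addrr.
rewrite /S sum_pairs_swap; apply: eq_bigr => k _; apply: eq_bigr => l.
by rewrite !inE => /andP[lk _]; rewrite fC.
Qed.

(* The value on the cube with lowest vertex [q] and edge directions [D] of the cup
   product of the coboundaries of the vertex labellings in [bs]. *)
Fixpoint cup (bs : seq (point -> 'F_2)) q D : 'F_2 :=
  if bs is b :: bs' then \sum_(k in D) (b (shift k q) + b q) * cup bs' (shift k q) (D :\ k)
  else 1.

(** A product of coboundaries is a cocycle: of the double sums over pairs of directions, some are
    symmetric and vanish modulo 2, the others cancel by induction. *)
Lemma cup_closed bs q D : #|D| = (size bs).+1 ->
  \sum_(k in D) (cup bs (shift k q) (D :\ k) + cup bs q (D :\ k)) = 0.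
Proof.
elim: bs q D => [|b bs IHbs] q D cD; first by rewrite big1 // => k _; exact: F2_addrr.
have cDk k : k \in D -> #|D :\ k| = (size bs).+1.
  by move=> kD; move: cD; rewrite (cardsD1 k) kD => -[].
have DC k l : D :\ k :\ l = D :\ l :\ k by rewrite !setDDl setUC.
pose c k l := cup bs (shift l (shift k q)) (D :\ k :\ l).
pose T1 := \sum_(k in D) \sum_(l in D :\ k) b (shift l (shift k q)) * c k l.
pose T2 := \sum_(k in D) \sum_(l in D :\ k) b (shift k q) * c k l.
pose T3 := \sum_(k in D) \sum_(l in D :\ k)
  b (shift l q) * cup bs (shift l q) (D :\ k :\ l).
pose T4 := \sum_(k in D) \sum_(l in D :\ k) b q * cup bs (shift l q) (D :\ k :\ l).
have -> : \sum_(k in D) (cup (b :: bs) (shift k q) (D :\ k) + cup (b :: bs) q (D :\ k)) =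
    T1 + (T2 + T3) + T4.
  rewrite -!big_split; apply: eq_bigr => k _ /=; rewrite -!big_split.
  by apply: eq_bigr => l _ /=; rewrite !mulrDl !addrA.
have -> : T1 = 0.
  by apply: sum_pairs_sym => k l kl; rewrite /c (shiftC _ kl) DC.
have -> : T2 + T3 = 0.
  rewrite /T3 sum_pairs_swap -big_split big1 //= => k kD.
  under [X in _ + X]eq_bigr do rewrite DC.
  by rewrite -!big_distrr -mulrDr -big_split /= IHbs ?mulr0 // cDk.
rewrite !add0r /T4.
have E k : k \in D -> \sum_(l in D :\ k) cup bs (shift l q) (D :\ k :\ l) =
    \sum_(l in D :\ k) cup bs q (D :\ k :\ l).
  by move=> kD; apply: F2_eq; rewrite -big_split /= IHbs // cDk.
under eq_bigr => k kD do rewrite -big_distrr /= E //.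
rewrite -big_distrr /= sum_pairs_sym ?mulr0 // => k l _.
by rewrite DC.
Qed.

(** The product is the coboundary of [b] times the remaining product, so that its sum over a box
    reduces to the boundary. *)
Lemma cup_exact b bs q D : #|D| = (size bs).+1 ->
  cup (b :: bs) q D =
    \sum_(k in D) (b (shift k q) * cup bs (shift k q) (D :\ k) + b q * cup bs q (D :\ k)).
Proof.
move=> cD; apply: F2_eq => /=; rewrite -big_split /=.
rewrite (eq_bigr (fun k => b q * (cup bs (shift k q) (D :\ k) + cup bs q (D :\ k)))).
  by rewrite -big_distrr /= cup_closed ?mulr0.
move=> k _; set x := b _ * cup _ _ _.
by rewrite mulrDl mulrDr -/x addrACA F2_addrr add0r.
Qed.

(** Lowest vertices of the cubes with directions [D] that subdivide the face of the big cube on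
    which all coordinates outside [D] equal [N]. *)
Definition box D : {set point} := [set q : point | [forall i, (q i == N :> nat) == (i \notin D)]].

Lemma boxP D q : reflect (forall i, (q i == N :> nat) = (i \notin D)) (q \in box D).
Proof.
rewrite inE; apply: (iffP forallP) => qD i; last by rewrite qD.
by have /eqP := qD i.
Qed.

Lemma box_lt D q i : q \in box D -> i \in D -> (q i < N)%N.
Proof. by move=> /boxP/(_ i) qi iD; rewrite iD in qi; have := ltn_ord (q i); lia. Qed.

Lemma box_telescope D k (c : point -> 'F_2) : (0 < N)%N -> k \in D ->
  \sum_(q in box D) (c (shift k q) + c q) =
  \sum_(q in box (D :\ k)) c q + \sum_(q in box D | q k == 0 :> nat) c q.
Proof.
move=> N0 kD.
pose wide q := [forall i, (i == k) || ((q i == N :> nat) == (i \notin D))].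
have wideD q : q \in box D = wide q && (q k < N)%N.
  apply/idP/andP => [qD|[/forallP/= qw qk]].
    split; last exact: box_lt qD kD.
    by apply/forallP => i; apply/orP; right; apply/eqP; have /boxP := qD.
  by apply/boxP => i; case: eqVneq (qw i) => [->|_ /eqP//]; rewrite kD; lia.
have wideDk q : q \in box (D :\ k) = wide q && (q k == N :> nat).
  apply/boxP/andP => [qD|[/forallP/= qw /eqP qk] i].
    split; last by rewrite qD !inE eqxx.
    by apply/forallP => i; case: eqVneq => //= ik; rewrite qD !inE ik eqxx.
  by case: eqVneq (qw i) => [->|ik /eqP ->]; rewrite !inE ?ik // qk !eqxx.
rewrite big_split /=.
have -> : \sum_(q in box D) c (shift k q) = \sum_(q | wide q && (0 < q k)%N) c q.
  pose unshift q : point := [ffun i => if i == k then inord (q i).-1 else q i].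
  rewrite [RHS](reindex_onto (shift k) unshift) => [|q /andP[_ qk]]; last first.
    apply/ffunP => i; rewrite !ffunE; case: eqVneq => [->|//].
    apply/val_inj => /=; have qN := ltn_ord (q k).
    have e : (inord (q k).-1 : 'I_N.+1) = (q k).-1 :> nat by rewrite inordK //; lia.
    by rewrite e prednK // inordK.
  apply: eq_bigl => q; rewrite wideD.
  have -> : wide (shift k q) = wide q.
    by apply: eq_forallb => i; rewrite ffunE; case: eqVneq.
  rewrite ffunE eqxx -andbA; congr (_ && _).
  have qN := ltn_ord (q k); apply/idP/andP => [qk|[i0 _]].
    have e : (inord (q k).+1 : 'I_N.+1) = (q k).+1 :> nat by rewrite inordK.
    split; first by rewrite e.
    apply/eqP/ffunP => i; rewrite !ffunE; case: eqVneq => [->|//].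
    by apply/val_inj => /=; rewrite e inordK.
  rewrite ltnNge; apply: contraTN i0 => qk.
  by rewrite /inord /insubd insubN // ltnS -ltnNge.
rewrite (bigID (fun q => q k == N :> nat)) /=.
rewrite [X in _ + X = _](bigID (fun q => q k == 0 :> nat)) /=.
have -> : \sum_(q | wide q && (0 < q k)%N && (q k == N :> nat)) c q =
    \sum_(q in box (D :\ k)) c q.
  by apply: eq_bigl => q; rewrite wideDk; case: eqP => [->|]; rewrite ?N0 ?andbF ?andbT.
have -> : \sum_(q | wide q && (0 < q k)%N && (q k != N :> nat)) c q =
    \sum_(q in box D | q k != 0 :> nat) c q.
  apply: eq_bigl => q; rewrite wideD; have := ltn_ord (q k).
  by case: (wide q) => //=; lia.
by rewrite -addrA [X in _ + X]addrCA F2_addrr addr0.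
Qed.

Definition in_cube q D p := forall i, (q i <= p i <= q i + (i \in D))%N.

(** A nonzero summand supplies, for each factor, an edge of the cube along which that labelling
    changes. *)
Lemma cup_neq0 bs q D b : (forall k, k \in D -> q k < N)%N -> cup bs q D != 0 ->
  (exists2 j, (j < size bs)%N & b = nth (fun=> 0) bs j) -> exists p p',
  [/\ in_cube q D p, in_cube q D p' & b p != b p'].
Proof.
move=> qN + [j]; elim: bs q D qN j => [|b' bs IHbs] q D qN j //= c0 jbs bE.
have [/existsP[k /andP[kD]]|] := boolP [exists k, (k \in D) &&
   ((b' (shift k q) + b' q) * cup bs (shift k q) (D :\ k) != 0)]; last first.
  rewrite negb_exists => /forallP all0; case/eqP: c0; apply: big1 => k kD.
  by have := all0 k; rewrite kD negbK => /eqP.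
rewrite mulf_eq0 negb_or => /andP[b'0 c'0].
have qk : shift k q k = (q k).+1 :> nat by rewrite ffunE eqxx inordK // ltnS qN.
case: j jbs bE => [_ ->|j jbs bE].
  exists (shift k q), q; split=> [i|i|].
  - rewrite ffunE; case: eqVneq => [->|_]; last lia.
    by move: qk; rewrite ffunE eqxx => ->; rewrite kD; lia.
  - lia.
  - by apply: contraNneq b'0 => /= ->; rewrite F2_addrr.
have [|p [p' [pc p'c pp']]] := IHbs (shift k q) (D :\ k) _ j c'0 jbs bE.
  by move=> l; rewrite !inE ffunE => /andP[/negbTE-> /qN].
have sub r : in_cube (shift k q) (D :\ k) r -> in_cube q D r.
  move=> rc i; have := rc i; have [->|ik] := eqVneq i k.
    by rewrite qk !inE eqxx kD; lia.
  by rewrite ffunE !inE (negbTE ik).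
by exists p, p'; split=> //; exact: sub.
Qed.

(** Stokes' formula: in direction [k] only the far face counts, where [a k = 1] and induction
    applies. On the faces in another direction [l] the labelling [a l] is constant, so the product
    vanishes by [cup_neq0]. *)
Lemma sum_cup (a : 'I_n -> point -> 'F_2) (ks : seq 'I_n) : (0 < N)%N -> uniq ks ->
  (forall k q, q k = 0%N :> nat -> a k q = 0) ->
  (forall k q, q k = N :> nat -> a k q = 1) ->
  \sum_(q in box [set k in ks]) cup (map a ks) q [set k in ks] = 1.
Proof.
move=> N0 + a0 a1; elim: ks => [_|k ks IHks /= /andP[kks uks]].
  rewrite (big_pred1 [ffun=> ord_max]) // => q; apply/boxP/eqP => [q0|-> i].
    apply/ffunP => i; apply/val_inj; rewrite ffunE /=; apply/eqP.
    by rewrite q0 !inE.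
  by rewrite ffunE !inE eqxx.
set D := [set j in k :: ks].
have kD : k \in D by rewrite !inE eqxx.
have cD : #|D| = (size ks).+1.
  by rewrite cardsE (card_uniqP _) //= kks.
have Dk : D :\ k = [set j in ks].
  apply/setP => j; rewrite !inE; case: eqVneq => [->|//].
  by rewrite (negbTE kks).
under eq_bigr do rewrite -[\sum_(_ in _) _]/(cup (a k :: map a ks) _ D) cup_exact ?size_map //.
rewrite exchange_big /= (bigD1 k) //= [X in _ + X]big1 ?addr0 => [|l /andP[lD lk]].
  rewrite (box_telescope (fun q => a k q * cup (map a ks) q (D :\ k))) //.
  rewrite [X in _ + X]big1 ?addr0 => [|q /andP[_ /eqP/a0->]]; last by rewrite mul0r.
  rewrite Dk -[RHS]IHks //; apply: eq_bigr => q /boxP/(_ k).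
  by rewrite inE kks => /eqP/a1->; rewrite mul1r.
have lks : l \in ks by move: lD; rewrite !inE (negbTE lk).
rewrite (box_telescope (fun q => a k q * cup (map a ks) q (D :\ l))) //.
have cup0 q : (forall j, j \in D :\ l -> q j < N)%N -> q l = 0%N :> nat \/ q l = N :> nat ->
    cup (map a ks) q (D :\ l) = 0.
  move=> qN ql; apply/eqP; apply: contraT => c0; have [|p] := @cup_neq0 _ q (D :\ l) (a l) qN c0.
    exists (index l ks); first by rewrite size_map index_mem.
    by rewrite (nth_map l) ?index_mem // nth_index.
  move=> [p' [/(_ l) + /(_ l) + /eqP[]]].
  rewrite !inE eqxx /= addn0 -!eqn_leq => /eqP pl /eqP p'l.
  by case: ql => ql; [rewrite !a0 | rewrite !a1]; rewrite -?pl -?p'l.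
rewrite !big1 ?addr0 // => q.
  move=> /andP[qD /eqP ql]; rewrite cup0 ?mulr0 //; last by left.
  by move=> j; rewrite !inE => /andP[_ jD]; apply: box_lt qD _; rewrite !inE.
move=> qD; rewrite cup0 ?mulr0 // => [j|]; first exact: box_lt.
by right; apply/eqP; have /boxP -> := qD; rewrite !inE eqxx.
Qed.

Lemma cubical_sperner (lab : 'I_n -> point -> bool) : (0 < N)%N ->
  (forall k q, q k = 0%N :> nat -> ~~ lab k q) ->
  (forall k q, q k = N :> nat -> lab k q) ->
  exists2 q : point, (forall k, q k < N)%N & forall k, exists p p' : point,
    [/\ forall i, (q i <= p i <= (q i).+1)%N, forall i, (q i <= p' i <= (q i).+1)%N
      & lab k p && ~~ lab k p'].
Proof.
move=> N0 l0 l1; pose a k q : 'F_2 := (lab k q)%:R.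
have := @sum_cup a (enum 'I_n) N0 (enum_uniq _).
move=> /(_ (fun k q qk => ltac:(by rewrite /a (negbTE (l0 k q qk))))).
move=> /(_ (fun k q qk => ltac:(by rewrite /a (l1 k q qk)))).
have -> : [set k in enum 'I_n] = setT by apply/setP => k; rewrite !inE mem_enum.
move=> sum1.
have [/existsP[q /andP[qD c0]]|] := boolP [exists q, (q \in box setT) &&
   (cup (map a (enum 'I_n)) q setT != 0)]; last first.
  rewrite negb_exists => /forallP all0; move: sum1; rewrite big1 => [/eqP//|q qD].
  by have := all0 q; rewrite qD negbK => /eqP.
have qN k : k \in setT -> (q k < N)%N by exact: box_lt.
exists q => k; first exact: qN.
have [|p [p' [pc p'c pp']]] := @cup_neq0 _ q setT (a k) qN c0.
  exists (index k (enum 'I_n)); first by rewrite size_map index_mem mem_enum.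
  by rewrite (nth_map k) ?index_mem ?mem_enum // nth_index // mem_enum.
have cube r : in_cube q setT r -> forall i, (q i <= r i <= (q i).+1)%N.
  by move=> rc i; have := rc i; rewrite !inE addn1.
case: (boolP (lab k p)) => lp; case: (boolP (lab k p')) => lp'.
- by rewrite /a lp lp' eqxx in pp'.
- by exists p, p'; split; [exact: cube | exact: cube | rewrite lp lp'].
- by exists p', p; split; [exact: cube | exact: cube | rewrite lp lp'].
- by rewrite /a (negbTE lp) (negbTE lp') eqxx in pp'.
Qed.

End CubicalCochains.


From mathcomp Require Import all_classical all_reals all_analysis.
From mathcomp Require Import ring lra.
Import Order.TTheory Num.Theory.
Import numFieldNormedType.Exports.
Local Open Scope classical_set_scope.
Local Open Scope ring_scope.

Lemma closed_le_fun (R : realType) (T : topologicalType) (g : T -> R) a :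
  continuous g -> closed [set x | g x <= a].
Proof. by move=> /continuous_closedP/(_ _ (@closed_le _ a)). Qed.

Lemma closed_ge_fun (R : realType) (T : topologicalType) (g : T -> R) a :
  continuous g -> closed [set x | a <= g x].
Proof. by move=> /continuous_closedP/(_ _ (@closed_ge _ a)). Qed.

(** * The maximum norm, and zeros of maps of the cube *)

Section MaxNorm.
Context (R : realType) (n : nat).
Implicit Types x y : 'rV[R]_n.

Lemma ler_rV_norm x (e : R) : 0 <= e -> (`|x| <= e) <-> (forall j, `|x 0 j| <= e).
Proof.
move=> e0; rewrite [`|x|]/Num.Def.normr /= mx_normrE; split=> [/bigmax_leP[_ xe] j|xe].
  exact: (xe (0, j)).
by apply/bigmax_leP; split=> // -[i j] _; rewrite /= (ord1 i).
Qed.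

Lemma ltr_rV_norm x (e : R) : 0 < e -> (`|x| < e) <-> (forall j, `|x 0 j| < e).
Proof.
move=> e0; rewrite [`|x|]/Num.Def.normr /= mx_normrE; split=> [/bigmax_ltP[_ xe] j|xe].
  exact: (xe (0, j)).
by apply/bigmax_ltP; split=> // -[i j] _; rewrite /= (ord1 i).
Qed.

Lemma coord_le_norm x j : `|x 0 j| <= `|x|.
Proof. exact: (ler_rV_norm x (normr_ge0 x)).1. Qed.

Lemma norm_coord x : x != 0 -> exists j, `|x| = `|x 0 j|.
Proof.
by move=> /eqP x0; have [|[i j] /= e] := @mx_norm_neq0 _ _ _ x; [apply/eqP => /mx_norm_eq0 |
  exists j; rewrite -[`|x|]/(mx_norm x) e (ord1 i)].
Qed.

Definition unit_cube : set 'rV[R]_n := [set x | `|x| <= 1].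

Lemma unit_cube_compact : compact unit_cube.
Proof.
apply: bounded_closed_compact.
  by exists 1; split=> // M M1 x /= x1; exact: le_trans x1 (ltW M1).
exact/closed_le_fun/norm_continuous.
Qed.

Lemma continuous_normP (T : topologicalType) (f : T -> 'rV[R]_n) :
  continuous f <-> forall (t : T) (e : R), 0 < e -> \forall u \near t, `|f t - f u| < e.
Proof.
split=> [cf x e e0|cf x]; first by have /cvgrPdist_lt/(_ e e0) := cf x.
by apply/cvgrPdist_lt => e e0; exact: cf.
Qed.

Lemma near_rVP x (A : set 'rV[R]_n) :
  nbhs x A <-> exists2 e, 0 < e & forall y, `|x - y| < e -> A y.
Proof.
split=> [/nbhs_ballP[e e0 xA]|[e e0 xA]].
  by exists e => // y xy; apply: xA; rewrite -ball_normE.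
by apply/nbhs_ballP; exists e => // y; rewrite -ball_normE => xy; exact: xA.
Qed.

End MaxNorm.

Lemma unif_continuous_cube (R : realType) (m n : nat) (h : 'rV[R]_n -> 'rV[R]_m) :
  continuous h -> forall e, 0 < e -> exists2 d, 0 < d &
    forall x y, `|x| <= 1 -> `|x - y| < d -> `|h x - h y| < e.
Proof.
move=> ch e e0.
have /compact_near_coveringP cov := @unit_cube_compact R n.
have := cov R (0^'+) (fun d x => forall y, `|x - y| < d -> `|h x - h y| < e) _.
case=> [x _|d d0 /(_ (d / 2))].
  have /near_rVP[d d0 hd] : \forall y \near x, `|h x - h y| < e / 2.
    by apply: (continuous_normP h).1; rewrite ?divr_gt0.
  exists (ball x (d / 2), [set d' | 0 < d' < d / 2]) => /=.
    split; first by apply: nbhsx_ballx; rewrite divr_gt0.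
    near=> t; apply/andP; split; near: t; first exact: nbhs_right_gt.
    by apply: nbhs_right_lt; rewrite divr_gt0.
  move=> [x' d'] /= [+ /andP[_ d'd]]; rewrite -ball_normE /= => xx' y x'y.
  rewrite -(subrKA (h x)) (le_lt_trans (ler_normD _ _)) // [e]splitr ltrD //.
    by rewrite distrC hd // (lt_trans xx') // gtr_pMr // invf_lt1 // ltr1n.
  apply: hd; rewrite -(subrKA x') (le_lt_trans (ler_normD _ _)) // [d]splitr ltrD //.
  exact: lt_trans d'd.
have d2 : 0 < d / 2 by rewrite divr_gt0.
have dd : `|0 - d / 2| < d.
  by rewrite sub0r normrN gtr0_norm // gtr_pMr // invf_lt1 // ltr1n.
by move=> /(_ dd d2) hd; exists (d / 2) => // x y x1; exact: hd.
Unshelve. all: by end_near. Qed.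

Theorem poincare_miranda (R : realType) (n : nat) (h : 'rV[R]_n -> 'rV[R]_n) :
  continuous h ->
  (forall (x : 'rV[R]_n) j, `|x| <= 1 -> x 0 j = 1 -> 0 <= h x 0 j) ->
  (forall (x : 'rV[R]_n) j, `|x| <= 1 -> x 0 j = -1 -> h x 0 j <= 0) ->
  exists2 x, `|x| <= 1 & h x = 0.
Proof.
move=> ch h1 hN1.
(* The norm of [h] is minimal at [c]. If it were positive there, a cell on which [h] varies by less,
   and on which each coordinate of [h] changes sign, would contain a point with a smaller norm. *)
have [||c] := @compact_EVT_min _ R (fun x => `|h x|) _ _ (@unit_cube_compact R n).
- by exists 0; rewrite /unit_cube /= normr0.
- apply: continuous_subspaceT => x; apply: (@continuous_comp _ _ _ h); first exact: ch.
  exact: norm_continuous.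
rewrite inE => c1 cmin; exists c => //; apply/eqP; rewrite -normr_eq0; apply: contraT => hc0.
have e0 : 0 < `|h c| by rewrite lt_neqAle eq_sym hc0 normr_ge0.
have [d d0 hd] := unif_continuous_cube ch e0.
pose N := (Num.truncn (2 / d)).+1.
have Nd : 2 / N%:R < d.
  by rewrite ltr_pdivrMr ?ltr0n // mulrC -ltr_pdivrMr // truncnS_gt.
have N0 : 0 < N%:R :> R by rewrite ltr0n.
pose pt (q : {ffun 'I_n -> 'I_N.+1}) : 'rV[R]_n := \row_i (2 * (q i)%:R / N%:R - 1).
have pt1 q : `|pt q| <= 1.
  apply/ler_rV_norm => // i; rewrite mxE ler_norml.
  have : 0 <= (q i)%:R / N%:R :> R by rewrite divr_ge0.
  have : (q i)%:R / N%:R <= 1 :> R by rewrite ler_pdivrMr // mul1r ler_nat -ltnS.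
  by rewrite -mulrA; lra.
(* Signs of the coordinates of [h], overridden on the boundary as [cubical_sperner] demands; the
   boundary hypotheses on [h] keep the overridden labels compatible with the signs. *)
pose lab (k : 'I_n) (q : {ffun 'I_n -> 'I_N.+1}) :=
  (q k == N :> nat) || ((q k != 0%N :> nat) && (0 <= h (pt q) 0 k)).
have [||k q qk|q qN cell] := @cubical_sperner n N lab.
- by [].
- by move=> k q qk; rewrite /lab qk.
- by rewrite /lab qk eqxx.
have labT k p : lab k p -> 0 <= h (pt p) 0 k.
  case/orP => [/eqP pN|/andP[]//]; apply: h1 => //.
  by rewrite mxE pN mulfK ?gt_eqF //; lra.
have labF k p : ~~ lab k p -> h (pt p) 0 k <= 0.
  rewrite negb_or negb_and negbK => /andP[_ /orP[/eqP p0|]]; last by rewrite -ltNge => /ltW.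
  by apply: hN1 => //; rewrite mxE p0 mulr0 mul0r sub0r.
suff : `|h (pt q)| < `|h c| by rewrite ltNge cmin // inE; exact: pt1.
apply/ltr_rV_norm => // k.
have [p [p' [qp qp' /andP[pk p'k]]]] := cell k.
have close (r : {ffun 'I_n -> 'I_N.+1}) : (forall i, q i <= r i <= (q i).+1)%N ->
    `|h (pt q) 0 k - h (pt r) 0 k| < `|h c|.
  move=> qr; have -> : h (pt q) 0 k - h (pt r) 0 k = (h (pt q) - h (pt r)) 0 k.
    by rewrite !mxE.
  apply: le_lt_trans (coord_le_norm _ _) _; apply: hd => //.
  apply: le_lt_trans Nd; apply/ler_rV_norm => [|i]; first by rewrite divr_ge0.
  rewrite !mxE opprB addrA subrK -mulrBl -mulrBr normrM normrM [`|N%:R^-1|]gtr0_norm ?invr_gt0 //.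
  rewrite ler_pM2r ?invr_gt0 // ger0_norm // ler_piMr // ler_norml.
  have /andP[l1 l2] := qr i.
  have := l1; rewrite -(ler_nat R); move: l2; rewrite -(ler_nat R) -natr1; lra.
have := close p qp; have := close p' qp'; rewrite !ltr_norml.
have := labT _ _ pk; have := labF _ _ p'k; lra.
Qed.

(* A sphere of the maximum norm has an [r]-net of size [O(r ^ (- n))] in dimension
   [n + 1], hence its Lipschitz image misses many points near [0]. *)
Lemma lipschitz_sphere_avoid (R : realType) (n : nat) (L : 'rV[R]_n.+1 -> 'rV[R]_n.+1)
    (M e d : R) (c : 'rV[R]_n.+1) : 0 < M -> 0 < e -> 0 < d ->
  (forall x y, `|L x - L y| <= M * `|x - y|) ->
  exists2 s, `|s| <= d & forall y, `|y - c| = e -> L y + s != 0.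
Proof.
move=> M0 e0 d0 lipL.
pose k := (Num.truncn (4 * e * M / d)).+1.
have kd : 4 * e * M < k%:R * d by rewrite -ltr_pdivrMr // truncnS_gt.
(* There are [m ^ n.+1] shifts [s h], with spacing [d / m%:R], against at most
   [2 * n.+1 * (k.+1 * m) ^ n] net points, and [m] is chosen so that the former win. By [kd] one net
   point cannot spoil two shifts. *)
pose m := (2 * n.+1 * k.+1 ^ n).+1; pose N := (k * m)%N.
have N0 : 0 < N%:R :> R by rewrite ltr0n muln_gt0.
have m0 : 0 < m%:R :> R by rewrite ltr0n.
pose T := ('I_n.+1 * bool * {ffun 'I_n -> 'I_N.+1})%type.
(* A net point is a facet of the cube around [c], given by a coordinate and a sign, together with a
   grid point of this facet. *)
pose net (t : T) : 'rV[R]_n.+1 := \row_i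
  if unlift t.1.1 i is Some i' then c 0 i - e + 2 * e * (t.2 i')%:R / N%:R
  else c 0 i + (-1) ^+ t.1.2 * e.
have netP y : `|y - c| = e -> exists t, `|y - net t| <= 2 * e / N%:R.
  move=> yc; have [|j yj] := @norm_coord _ _ (y - c).
    by rewrite -normr_eq0 yc gt_eqF.
  pose g := [ffun i' : 'I_n =>
    inord (Num.truncn ((y 0 (lift j i') - c 0 (lift j i') + e) * N%:R / (2 * e))) : 'I_N.+1].
  exists (j, (y 0 j - c 0 j < 0), g); apply/ler_rV_norm => [|i].
    by rewrite divr_ge0 // mulr_ge0 // ltW.
  rewrite !mxE /=; case: unliftP => [i' ->|->]; last first.
    have : `|y 0 j - c 0 j| = e by rewrite -yc yj !mxE.
    have [ylt|yge] := ltP (y 0 j - c 0 j) 0.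
      rewrite ltr0_norm // expr1 => ye; rewrite [X in `|X|](_ : _ = 0); last lra.
      by rewrite normr0 divr_ge0 // mulr_ge0 // ltW.
    rewrite ger0_norm // expr0 => ye; rewrite [X in `|X|](_ : _ = 0); last lra.
    by rewrite normr0 divr_ge0 // mulr_ge0 // ltW.
  have : `|y 0 (lift j i') - c 0 (lift j i')| <= e.
    by rewrite -yc; have := coord_le_norm (y - c) (lift j i'); rewrite !mxE.
  rewrite ffunE ler_norml; move: (y 0 _) (c 0 _) => a b /andP[ab1 ab2].
  pose z := (a - b + e) * N%:R / (2 * e).
  have ab0 : 0 <= a - b + e by lra.
  have ee : 0 < 2 * e by lra.
  have z0 : 0 <= z by apply: divr_ge0; [apply: mulr_ge0 => //; exact: ltW | exact: ltW].
  have zN : z <= N%:R.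
    by rewrite ler_pdivrMr ?mulr_gt0 // mulrC ler_pM2l //; lra.
  have [tz1 tz2] := andP (truncn_itv z0).
  rewrite inordK; last by rewrite ltnS -(ler_nat R) (le_trans tz1).
  have e2 : a - (b - e + 2 * e * (Num.truncn z)%:R / N%:R) =
      2 * e / N%:R * (z - (Num.truncn z)%:R).
    rewrite /z; field; apply/andP; split; exact: lt0r_neq0.
  rewrite e2 normrM ger0_norm; last by rewrite divr_ge0 // mulr_ge0 // ltW.
  rewrite ler_piMr //; first by rewrite divr_ge0 // mulr_ge0 // ltW.
  by rewrite ger0_norm; move: tz1 tz2; rewrite -natr1; lra.
pose s (h : {ffun 'I_n.+1 -> 'I_m}) : 'rV[R]_n.+1 := \row_i (d / m%:R * (h i)%:R).
have sd h : `|s h| <= d.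
  apply/ler_rV_norm => [|i]; first exact: ltW.
  rewrite mxE normrM ger0_norm; last by rewrite divr_ge0 // ltW.
  rewrite ger0_norm // mulrAC ler_pdivrMr // ler_pM2l // ler_nat.
  exact/ltnW/ltn_ord.
apply: contrapT => noS.
have bad h : exists t, `|L (net t) + s h| <= 2 * e * M / N%:R.
  have [y [yc Ly]] : exists y, `|y - c| = e /\ L y + s h = 0.
    apply: contrapT => noy; apply: noS; exists (s h) => // y yc.
    by apply/eqP => Ly; apply: noy; exists y.
  have [t yt] := netP y yc; exists t.
  have -> : L (net t) + s h = L (net t) - L y by rewrite -[RHS]addr0 -Ly addrA subrK.
  rewrite (le_trans (lipL _ _)) // distrC mulrAC mulrC ler_pM2r //.
have [f fP] := boolp.choice bad.
have : injective f.
  move=> h h' ff'; apply/ffunP => i; apply/val_inj; apply/eqP; apply: contraT => hi.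
  have lt1 : `|s h - s h'| <= 4 * e * M / N%:R.
    have -> : s h - s h' = (L (net (f h)) + s h) - (L (net (f h')) + s h').
      by rewrite ff' opprD addrACA subrr add0r.
    rewrite (le_trans (ler_normB _ _)) // (le_trans (lerD (fP h) (fP h'))) //.
    by rewrite -mulrDl; lra.
  have lt2 : d / m%:R <= `|s h - s h'|.
    apply: le_trans (coord_le_norm _ i); rewrite !mxE -mulrBr normrM.
    have dm0 : 0 <= d / m%:R by rewrite divr_ge0 // ltW.
    rewrite (ger0_norm dm0) ler_peMr //.
    have hiR (u v : nat) : (u < v)%N -> 1 <= `|u%:R - v%:R| :> R.
      move=> uv; rewrite distrC ger0_norm ?subr_ge0 ?ler_nat 1?ltnW //.
      by move: uv; rewrite -(ler_nat R) -natr1; lra.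
    by move: hi; rewrite neq_ltn => /orP[]/hiR //; rewrite distrC.
  have := le_trans lt2 lt1; rewrite ler_pdivrMr // mulrAC ler_pdivlMr // natrM.
  by rewrite (_ : d * (k%:R * m%:R) = k%:R * d * m%:R); [rewrite ler_pM2r // leNgt kd | ring].
move=> /leq_card; rewrite card_ffun !card_prod card_bool card_ffun !card_ord.
have : (N.+1 ^ n <= k.+1 ^ n * m ^ n)%N.
  have powle a b : (a <= b)%N -> (a ^ n <= b ^ n)%N by case: (n) => // n'; rewrite leq_exp2r.
  by rewrite -expnMn powle // /N mulSn; lia.
have : (n.+1 * 2 * (k.+1 ^ n * m ^ n) < m ^ n.+1)%N.
  by rewrite expnS mulnA ltn_pmul2r ?expn_gt0 // /m; lia.
have := @leq_mul (n.+1 * 2)%N (N.+1 ^ n)%N (n.+1 * 2)%N (k.+1 ^ n * m ^ n)%N (leqnn _).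
by move: (k.+1 ^ n * m ^ n)%N (N.+1 ^ n)%N (m ^ n.+1)%N => u v w h1 h2 /h1; lia.
Qed.

Lemma ler_clampB (R : realType) (u v w : R) : 0 <= w -> u - v <= w ->
  Num.max (-1) (Num.min 1 u) - Num.max (-1) (Num.min 1 v) <= w.
Proof.
move=> w0 uv; rewrite lerBlDr ge_max.
apply/andP; split.
  have : -1 <= Num.max (-1) (Num.min 1 v) by rewrite le_max lexx.
  lra.
case: (leP 1 v) => v1.
  rewrite max_r; last by lra.
  have : Num.min 1 u <= 1 by rewrite ge_min lexx.
  lra.
have : Num.min 1 u <= u by rewrite ge_min lexx orbT.
have : v <= Num.max (-1) v by rewrite le_max lexx orbT.
lra.
Qed.

Definition clamp (R : realType) (n : nat) (x : 'rV[R]_n) : 'rV[R]_n :=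
  \row_i Num.max (-1) (Num.min 1 (x 0 i)).

Lemma norm_clamp (R : realType) (n : nat) (x : 'rV[R]_n) : `|clamp x| <= 1.
Proof.
apply/ler_rV_norm => // j; rewrite mxE ler_norml le_max lexx ge_max ge_min lexx andbT /=.
by lra.
Qed.

Lemma clamp_id (R : realType) (n : nat) (x : 'rV[R]_n) : `|x| <= 1 -> clamp x = x.
Proof.
move=> /ler_rV_norm xj; apply/rowP => j; rewrite mxE.
have := xj ler01 j; rewrite ler_norml => /andP[? ?].
by rewrite min_r // max_r.
Qed.

Lemma clamp_lipschitz (R : realType) (n : nat) (x y : 'rV[R]_n) :
  `|clamp x - clamp y| <= `|x - y|.
Proof.
apply/ler_rV_norm => // j; apply: le_trans (coord_le_norm _ j).
rewrite !mxE; move: (x 0 j) (y 0 j) => u v.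
have a1 := ler_norm (u - v); have a2 : v - u <= `|u - v| by rewrite distrC ler_norm.
by rewrite ler_norml ler_clampB // andbT lerNl opprB ler_clampB.
Qed.

Lemma clamp_continuous (R : realType) (n : nat) : continuous (@clamp R n).
Proof.
apply/continuous_normP => x r r0; apply/near_rVP; exists r => // y xy.
exact: le_lt_trans (clamp_lipschitz _ _) xy.
Qed.

Section ContinuousRow.
Context (R : realType) (n : nat) (T : topologicalType).
Implicit Types u v : T -> 'rV[R]_n.

Lemma continuous_norm_sub u v : continuous u -> continuous v ->
  continuous (fun t => `|u t - v t|).
Proof.
by move=> cu cv t; apply: cvg_norm; apply: cvgB; [exact: cu | exact: cv].
Qed.

Lemma continuous_comp_add u (L : 'rV[R]_n -> 'rV[R]_n) s :
  continuous u -> continuous L -> continuous (fun t => L (u t) + s).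
Proof.
move=> cu cL t; apply: cvgD; last exact: cvg_cst.
by apply: (@continuous_comp _ _ _ u L); [exact: cu | exact: cL].
Qed.

Lemma continuous_push_out u c (e : R) : continuous u -> (forall t, u t != c) ->
  continuous (fun t => c + Num.max (e / `|u t - c|) 1 *: (u t - c)).
Proof.
move=> cu uc t; have cB : (fun z => u z - c) @ t --> u t - c.
  by apply: cvgB; [exact: cu | exact: cvg_cst].
apply: cvgD; first exact: cvg_cst.
apply: cvgZ => //; apply: (@continuous_max _ _ (fun t => e / `|u t - c|) (fun=> 1)).
  apply: cvgM; first exact: cvg_cst.
  apply: cvgV; last exact: cvg_norm.
  by rewrite normr_eq0 subr_eq0.
exact: cvg_cst.
Qed.

End ContinuousRow.

(** * Lipschitz approximation of an inverse *)

Section LipschitzInverse.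
Context (R : realType) (n : nat) (f : 'rV[R]_n -> 'rV[R]_n).
Context (cf : continuous f) (fI : forall x y, `|x| <= 1 -> `|y| <= 1 -> f x = f y -> x = y).

Lemma injective_separation d : 0 < d -> exists2 eta, 0 < eta &
  forall x y, `|x| <= 1 -> `|y| <= 1 -> d <= `|x - y| -> eta <= `|f x - f y|.
Proof.
move=> d0; pose far := [set p : 'rV[R]_n * 'rV[R]_n | d <= `|p.1 - p.2|].
pose K := (@unit_cube R n `*` @unit_cube R n) `&` far.
have cK : compact K.
  apply: compact_closedI; first by apply: compact_setX; exact: unit_cube_compact.
  apply: closed_ge_fun => p; apply: cvg_norm.
  by apply: cvgB; [exact: cvg_fst | exact: cvg_snd].
have [K0|K0] := pselect (K !=set0); last first.
  exists 1 => // x y x1 y1 xy; exfalso; apply: K0.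
  by exists (x, y).
have [|p] := @compact_EVT_min _ R (fun p => `|f p.1 - f p.2|) K K0 cK.
  apply: continuous_subspaceT => p; apply: cvg_norm.
  by apply: cvgB; apply: continuous_comp; [exact: cvg_fst | exact: cf | exact: cvg_snd | exact: cf].
rewrite inE => -[[/= p1 p2] pd] pmin; exists `|f p.1 - f p.2|.
  rewrite normr_gt0 subr_eq0; apply/eqP => /(fI p1 p2) pE.
  by move: pd; rewrite /far /= pE subrr normr0 leNgt d0.
by move=> x y x1 y1 xy; apply: (pmin (x, y)); rewrite inE.
Qed.

(** Each coordinate [j] of [L y] is the infimum of [x 0 j + M * |y - f x|] over the cube, hence
    Lipschitz in [y]. As [M * eta = 3] and coordinates lie between [-1] and [1], points at distance
    at least [d] from [x] do not lower the value at [f x] below [x 0 j]. *)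
Lemma lipschitz_left_inverse d : 0 < d -> exists L : 'rV[R]_n -> 'rV[R]_n, exists M,
  [/\ 0 < M, forall y y', `|L y - L y'| <= M * `|y - y'| &
      forall x, `|x| <= 1 -> `|L (f x) - x| <= d].
Proof.
move=> d0; have [eta eta0 sep] := injective_separation d0.
pose M := 3 / eta; have M0 : 0 < M by rewrite divr_gt0.
pose E y j := [set x 0 j + M * `|y - f x| | x in @unit_cube R n].
have Elb y j : lbound (E y j) (-1).
  move=> _ [x x1 <-]; have := le_trans (coord_le_norm x j) x1.
  by rewrite ler_norml => /andP[x0 _]; rewrite -[leLHS]addr0 lerD // mulr_ge0 // ltW.
have Einf y j : has_inf (E y j).
  split; last by exists (-1).
  by exists ((0 : 'rV[R]_n) 0 j + M * `|y - f 0|); exists 0; rewrite // /unit_cube /= normr0.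
pose L y : 'rV[R]_n := \row_j inf (E y j).
exists L, M; split=> // [y y'|x x1].
  have half u v j : inf (E u j) - inf (E v j) <= M * `|u - v|.
    rewrite lerBlDr -lerBlDl; apply: lb_le_inf; first by case: (Einf v j).
    move=> _ [x x1 <-]; rewrite lerBlDl addrCA -mulrDr.
    apply: le_trans (_ : x 0 j + M * `|u - f x| <= _).
      by apply: ge_inf; [case: (Einf u j) | exists x].
    rewrite lerD2l ler_pM2l //; have := ler_normD (u - v) (v - f x).
    by rewrite addrA subrK.
  apply/ler_rV_norm => [|j]; first by rewrite mulr_ge0 // ltW.
  rewrite !mxE ler_norml half andbT lerNl opprB distrC.
  exact: half.
apply/ler_rV_norm => [|j]; first exact: ltW.
rewrite !mxE ler_norml; apply/andP; split; last first.
  have : inf (E (f x) j) <= x 0 j; last by move: d0; lra.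
  by apply: ge_inf; [case: (Einf (f x) j) | exists x => //; rewrite subrr normr0 mulr0 addr0].
rewrite lerBrDr; apply: lb_le_inf; first by case: (Einf (f x) j).
move=> _ [x' x'1 <-]; have xj := coord_le_norm (x - x') j; rewrite !mxE in xj.
have [xx'|xx'] := leP d `|x - x'|.
  have := sep x x' x1 x'1 xx'; rewrite -(ler_pM2l M0) /M divfK ?gt_eqF // => Meta.
  have := le_trans (coord_le_norm x' j) x'1; have := le_trans (coord_le_norm x j) x1.
  by rewrite !ler_norml; lra.
have : 0 <= M * `|f x - f x'| by rewrite mulr_ge0 // ltW.
by have := le_lt_trans xj xx'; rewrite ltr_norml; lra.
Qed.

End LipschitzInverse.

(* Otherwise some [c] close to [f 0] is not a value of [f] on the cube. Pushing the
   values of [f] out of the sphere around [c] and applying a Lipschitz approximation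
   of the inverse of [f], shifted so as not to vanish on this sphere, yields a map
   without zeros that contradicts the Poincaré-Miranda theorem. *)
Theorem invariance_of_domain (R : realType) (n : nat) (f : 'rV[R]_n -> 'rV[R]_n) :
  continuous f -> (forall x y, `|x| <= 1 -> `|y| <= 1 -> f x = f y -> x = y) ->
  nbhs (f 0) [set f x | x in @unit_cube R n].
Proof.
case: n f => [|n] f cf fI.
  apply: filterS filterT => c _; exists 0; first by rewrite /unit_cube /= normr0.
  by apply/rowP => -[].
pose S := [set x : 'rV[R]_n.+1 | 1 <= `|x|] `&` @unit_cube R n.+1.
have clS : closed [set x : 'rV[R]_n.+1 | 1 <= `|x|].
  by apply: closed_ge_fun; exact: norm_continuous.
have cS : compact S by rewrite /S setIC; apply: compact_closedI => //; exact: unit_cube_compact.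
have S0 : S !=set0.
  exists (const_mx 1); have e : `|const_mx 1 : 'rV[R]_n.+1| = 1.
    apply/eqP; rewrite eq_le; apply/andP; split.
      by apply/ler_rV_norm => // j; rewrite mxE normr1.
    by have := coord_le_norm (const_mx 1 : 'rV[R]_n.+1) 0; rewrite mxE normr1.
  by rewrite /S /unit_cube /= e.
have cdist (c : 'rV[R]_n.+1) : continuous (fun x : 'rV[R]_n.+1 => `|f x - c|).
  by apply: continuous_norm_sub => //; exact: cst_continuous.
have [|x0] := @compact_EVT_min _ R (fun x => `|f x - f 0|) S S0 cS.
  by apply: continuous_subspaceT; exact: cdist.
rewrite inE => -[/= x0ge x0le] x0min.
(* Half the distance from [f 0] to the image of the sphere: a point closer than [e] to [f 0] keeps
   distance at least [e] from that image. *)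
pose e := `|f x0 - f 0| / 2.
have e0 : 0 < e.
  rewrite divr_gt0 // normr_gt0 subr_eq0; apply/eqP => /(fI _ _ x0le) x00.
  by move: x0ge; rewrite x00 ?normr0 // ler10.
apply/near_rVP; exists e => // c fc; apply: contrapT => cNf.
have {}cNf x : `|x| <= 1 -> f x != c by move=> x1; apply/eqP => fxc; apply: cNf; exists x.
have Sfar x : `|x| = 1 -> e <= `|f x - c|.
  move=> x1; have := x0min x; rewrite inE /S /unit_cube /= x1 => /(_ (conj (lexx _) (lexx _))).
  move=> h; have := ler_normD (f x - c) (c - f 0); rewrite addrA subrK [`|c - _|]distrC.
  by move: h fc; rewrite /e; lra.
pose far := [set x | e <= `|f x - c|] `&` @unit_cube R n.+1.
have cfar : compact far.
  rewrite /far setIC; apply: compact_closedI; first exact: unit_cube_compact.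
  by apply: closed_ge_fun; exact: cdist.
have [||x1] := @compact_EVT_min _ R (fun x => `|x|) far _ cfar.
- case: S0 => x [x1 x2]; exists x; split=> //; apply: Sfar.
  by apply/eqP; rewrite eq_le x1 andbT; exact: x2.
- by apply: continuous_subspaceT; exact: norm_continuous.
rewrite inE => -[/= x1far x1le] x1min.
have x1n : 0 < `|x1|.
  rewrite normr_gt0; apply/eqP => x10.
  by move: x1far; rewrite x10 leNgt fc.
have x1le' : `|x1| <= 1 by [].
(* The point [x1] is nearest to [0] among those mapped at distance at least [e] from [c]. The
   approximation error and the shift are at most [d] each, so a zero in that region would have norm
   at most [2 * d], less than that of [x1]. *)
pose d := `|x1| / 4; have d0 : 0 < d by rewrite divr_gt0.
have [L [M [M0 lipL Lf]]] := lipschitz_left_inverse cf fI d0.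
have [s sd Ls] := @lipschitz_sphere_avoid R n L M e d c M0 e0 d0 lipL.
pose push y := c + Num.max (e / `|y - c|) 1 *: (y - c).
have pushfar y : e <= `|y - c| -> push y = y.
  move=> ey; rewrite /push max_r; first by rewrite scale1r addrC subrK.
  by rewrite ler_pdivrMr ?mul1r //; exact: lt_le_trans ey.
have pushnear y : y != c -> `|y - c| < e -> `|push y - c| = e.
  move=> yc ye; rewrite /push addrC addKr normrZ max_l.
    have yc0 : `|y - c| != 0 by rewrite normr_eq0 subr_eq0.
    rewrite ger0_norm; first by rewrite divfK.
    by apply: divr_ge0 => //; exact: ltW.
  by rewrite ler_pdivlMr ?mul1r ?ltW // normr_gt0 subr_eq0.
have cL : continuous L.
  apply/continuous_normP => y r r0; apply/near_rVP; exists (r / M); first by rewrite divr_gt0.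
  by move=> z yz; apply: le_lt_trans (lipL _ _) _; rewrite mulrC -ltr_pdivlMr.
have cfc : continuous (f \o @clamp R n.+1).
  by move=> x; apply: continuous_comp; [exact: clamp_continuous | exact: cf].
have [|x j x1' xj|x j x1' xj|x x1' hx] := @poincare_miranda R n.+1 (fun x => L (push (f (clamp x))) + s).
- apply: continuous_comp_add => //; apply: (@continuous_push_out _ _ _ (f \o @clamp R n.+1)) => // x.
  by apply: cNf; exact: norm_clamp.
- have x1'' : `|x| = 1.
    by apply/eqP; rewrite eq_le x1' -[leLHS]normr1 -xj coord_le_norm.
  rewrite clamp_id // pushfar ?Sfar // !mxE.
  have := le_trans (coord_le_norm _ j) (Lf x x1'); have := le_trans (coord_le_norm _ j) sd.
  by rewrite !mxE !ler_norml xj /d => /andP[? ?] /andP[? ?]; lra.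
- have x1'' : `|x| = 1.
    have := coord_le_norm x j; rewrite xj normrN normr1 => x1''.
    by apply/eqP; rewrite eq_le x1' x1''.
  rewrite clamp_id // pushfar ?Sfar // !mxE.
  have := le_trans (coord_le_norm _ j) (Lf x x1'); have := le_trans (coord_le_norm _ j) sd.
  by rewrite !mxE !ler_norml xj /d => /andP[? ?] /andP[? ?]; lra.
rewrite clamp_id // in hx.
have [xfar|xnear] := leP e `|f x - c|; last first.
  by have /eqP[] := Ls _ (pushnear _ (cNf x x1') xnear).
rewrite pushfar // in hx.
have := x1min x; rewrite inE => /(_ (conj xfar x1')); apply/negP; rewrite -ltNge.
have xE : x = - (L (f x) - x) - s.
  by rewrite opprB -addrA -opprD hx subr0.
rewrite xE; apply: le_lt_trans (ler_normB _ _) _; rewrite normrN.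
have := Lf x x1'; move: sd; rewrite /d; lra.
Qed.

Corollary invariance_of_domain_cube (R : realType) (n : nat) (f : 'rV[R]_n -> 'rV[R]_n) :
  (forall x e, `|x| <= 1 -> 0 < e -> exists2 r, 0 < r &
     forall y, `|y| <= 1 -> `|x - y| < r -> `|f x - f y| < e) ->
  (forall x y, `|x| <= 1 -> `|y| <= 1 -> f x = f y -> x = y) ->
  nbhs (f 0) [set f x | x in @unit_cube R n].
Proof.
move=> cf fI; have c0 : clamp (0 : 'rV[R]_n) = 0 by rewrite clamp_id // normr0.
have := @invariance_of_domain R n (fun x => f (clamp x)); rewrite c0 => dom.
apply: (@filterS _ _ _ [set f (clamp x) | x in @unit_cube R n]).
  by move=> _ [x x1 <-]; exists (clamp x) => //; exact: norm_clamp.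
apply: dom => [|x y x1 y1]; last by rewrite !clamp_id //; exact: fI.
apply/continuous_normP => x e e0; apply/near_rVP.
have [r r0 fr] := cf (clamp x) e (norm_clamp _) e0; exists r => // y xy.
by apply: fr; [exact: norm_clamp | exact: le_lt_trans (clamp_lipschitz _ _) xy].
Qed.

(** * Face lattices of regular CW pseudomanifolds *)

Section DotProduct.
Context (R : realType) (n : nat).
Implicit Types x y z : 'rV[R]_n.

Lemma dotC x y : dot x y = dot y x.
Proof. by apply: eq_bigr => i _; rewrite mulrC. Qed.

Lemma dotDl x y z : dot (x + y) z = dot x z + dot y z.
Proof. by rewrite -big_split; apply: eq_bigr => i _; rewrite mxE mulrDl. Qed.

Lemma dotZl a x y : dot (a *: x) y = a * dot x y.
Proof. by rewrite /dot big_distrr /=; apply: eq_bigr => i _; rewrite mxE mulrA. Qed.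

Lemma dotNl x y : dot (- x) y = - dot x y.
Proof. by rewrite -scaleN1r dotZl mulN1r. Qed.

Lemma dotBl x y z : dot (x - y) z = dot x z - dot y z.
Proof. by rewrite dotDl dotNl. Qed.

Lemma dotDr x y z : dot z (x + y) = dot z x + dot z y.
Proof. by rewrite !(dotC z) dotDl. Qed.

Lemma dotZr a x y : dot y (a *: x) = a * dot y x.
Proof. by rewrite !(dotC y) dotZl. Qed.

Lemma dotNr x y : dot y (- x) = - dot y x.
Proof. by rewrite !(dotC y) dotNl. Qed.

Lemma dotBr x y z : dot z (x - y) = dot z x - dot z y.
Proof. by rewrite dotDr dotNr. Qed.

Lemma dot0l x : dot 0 x = 0.
Proof. by rewrite -(scale0r x) dotZl mul0r. Qed.

Lemma dot0r x : dot x 0 = 0. Proof. by rewrite dotC dot0l. Qed.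

Lemma dot_ge0 x : 0 <= dot x x.
Proof. by apply: sumr_ge0 => i _; rewrite -expr2 sqr_ge0. Qed.

Lemma coord_sqr_le_dot x j : x 0 j ^+ 2 <= dot x x.
Proof.
rewrite /dot (bigD1 j) //= -expr2 lerDl.
by apply: sumr_ge0 => i _; rewrite -expr2 sqr_ge0.
Qed.

Lemma dot_eq0 x : dot x x = 0 -> x = 0.
Proof.
move=> x0; apply/rowP => j; rewrite mxE; apply/eqP; rewrite -sqrf_eq0.
by rewrite eq_le sqr_ge0 andbT -x0 coord_sqr_le_dot.
Qed.

End DotProduct.

Lemma continuous_rowP (R : realType) (n : nat) (T : topologicalType) (u : T -> 'rV[R]_n) :
  (forall j, continuous (fun t => u t 0 j)) -> continuous u.
Proof.
move=> cu; apply/continuous_normP => t e e0.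
have : \forall s \near t, forall j, `|u t 0 j - u s 0 j| < e.
  by apply: filter_forall => j; have /cvgrPdist_lt/(_ e e0) := cu j t.
apply: filterS => s us; apply/ltr_rV_norm => // j.
by rewrite !mxE; exact: us.
Qed.

Lemma continuous_dot (R : realType) (n : nat) (T : topologicalType) (u v : T -> 'rV[R]_n) :
  (forall j, continuous (fun t => u t 0 j)) -> (forall j, continuous (fun t => v t 0 j)) ->
  continuous (fun t => dot (u t) (v t)).
Proof.
move=> cu cv t; apply: cvg_big => [|j _]; first by apply: add_continuous.
by apply: cvgM; [exact: cu | exact: cv].
Qed.

Lemma dot_continuous (R : realType) (n : nat) : continuous (fun x : 'rV[R]_n => dot x x).
Proof. by apply: continuous_dot => j; exact: coord_continuous. Qed.

Lemma eball_bounded (R : realType) (n : nat) (A : set 'rV[R]_n) :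
  A `<=` eball R n -> bounded_set A.
Proof.
move=> AB; exists 1; split=> // M M1 x /AB; rewrite /eball /= => x1.
apply: le_trans (ltW M1); apply/ler_rV_norm => // j.
by rewrite -(@expr_le1 _ 2) // real_normK ?num_real // (le_trans (coord_sqr_le_dot x j)).
Qed.

Lemma eball_compact (R : realType) (n : nat) : compact (eball R n).
Proof.
by apply: bounded_closed_compact; [exact: eball_bounded | exact/closed_le_fun/dot_continuous].
Qed.

(** Near [p] the sphere is a graph over the coordinates other than an [i] with [p 0 i != 0], and
    [scl] shrinks the cube into a suitable domain. Since [Num.sqrt] is [0] on negative numbers, the
    graph is continuous everywhere; it is injective because it retains its argument. *)
Lemma sphere_chart (R : realType) (k : nat) (p : 'rV[R]_k.+1) (V : set 'rV[R]_k.+1) :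
  esphere R k.+1 p -> nbhs p V -> exists phi : 'rV[R]_k -> 'rV[R]_k.+1,
  [/\ continuous phi, phi 0 = p, injective phi &
      forall x, `|x| <= 1 -> esphere R k.+1 (phi x) /\ V (phi x)].
Proof.
rewrite /esphere /= => p1 pV.
have [i pi0] : exists i, p 0 i != 0.
  apply: contrapT => /forallNP p0; move: p1; rewrite /dot big1 => [/eqP|i _].
    by rewrite eq_sym oner_eq0.
  by have /negP := p0 i; rewrite negbK => /eqP->; rewrite mul0r.
pose graph (y : 'rV[R]_k) : 'rV[R]_k.+1 := \row_j
  if unlift i j is Some j' then y 0 j' else Num.sg (p 0 i) * Num.sqrt (1 - dot y y).
have cgraph : continuous graph.
  apply: continuous_rowP => j; case: (unliftP i j) => [j' ->|->].
    have -> : (fun t => graph t 0 (lift i j')) = (fun t => t 0 j').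
      by apply/funext => t; rewrite mxE liftK.
    exact: coord_continuous.
  have -> : (fun t => graph t 0 i) = (fun t => Num.sg (p 0 i) * Num.sqrt (1 - dot t t)).
    by apply/funext => t; rewrite mxE unlift_none.
  move=> y; apply: (@continuous_comp _ _ _ (fun y => Num.sqrt (1 - dot y y)) ( *%R (Num.sg (p 0 i)))).
    apply: (@continuous_comp _ _ _ (fun y => 1 - dot y y) Num.sqrt); last exact: sqrt_continuous.
    apply: (@continuous_comp _ _ _ (fun y : 'rV[R]_k => dot y y) (fun r => 1 - r)).
      exact: dot_continuous.
    by apply: cvgB; [exact: cvg_cst | exact: cvg_id].
  by apply: cvgM; [exact: cvg_cst | exact: cvg_id].
have dot_graph y : dot y y <= 1 -> dot (graph y) (graph y) = 1.
  move=> y1; rewrite /dot (bigD1_ord i) //= !mxE unlift_none.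
  under eq_bigr do rewrite !mxE liftK.
  rewrite mulrACA -!expr2 sqr_sqrtr ?subr_ge0 // sqr_sg pi0 mul1r -/(dot y y).
  by rewrite subrK.
pose y0 := \row_j p 0 (lift i j).
have y01 : dot y0 y0 = 1 - p 0 i ^+ 2.
  rewrite -p1 /dot [in RHS](bigD1_ord i) //= -expr2 addrAC subrr add0r.
  by apply: eq_bigr => j _; rewrite !mxE.
have graph0 : graph y0 = p.
  apply/rowP => j; rewrite mxE; case: unliftP => [j' ->|->]; first by rewrite mxE.
  by rewrite y01 opprB addrC subrK sqrtr_sqr -numEsg.
have : \forall y \near y0, V (graph y) /\ dot y y < 1.
  have nV : nbhs (graph y0) V by rewrite graph0.
  have n1 : \forall y \near y0, dot y y < 1.
    have : dot y0 y0 < 1.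
      by rewrite y01 ltrBlDr ltrDl lt_neqAle eq_sym sqrf_eq0 pi0 sqr_ge0.
    move=> y0lt; have /cvgr_lt := @dot_continuous R k y0; exact.
  have nG : nbhs y0 (graph @^-1` V) by exact: cgraph nV.
  by apply: filterS (filterI nG n1) => y [].
move=> /near_rVP[r r0 rV].
have r2 : 0 < r / 2 by rewrite divr_gt0.
pose scl (x : 'rV[R]_k) : 'rV[R]_k := y0 + (r / 2) *: x.
exists (graph \o scl); split.
- move=> x; apply: continuous_comp; last exact: cgraph.
  apply: continuous_rowP => j z.
  have -> : (fun t => scl t 0 j) = (fun t => y0 0 j + r / 2 * t 0 j).
    by apply/funext => t; rewrite !mxE.
  apply: (@continuous_comp _ _ _ (fun x : 'rV[R]_k => x 0 j) (fun t => y0 0 j + r / 2 * t)).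
    exact: coord_continuous.
  by apply: cvgD; [exact: cvg_cst | apply: cvgM; [exact: cvg_cst | exact: cvg_id]].
- by rewrite /scl /= scaler0 addr0.
- move=> x y /rowP xy; apply/rowP => j; have := xy (lift i j).
  by rewrite !mxE !liftK !mxE => /addrI/(mulfI (lt0r_neq0 r2)).
- move=> x x1; have [|Vx x2] := rV (scl x).
    rewrite /scl opprD addrA subrr sub0r normrN normrZ gtr0_norm //.
    by apply: (@le_lt_trans _ _ (r / 2)); [rewrite ler_piMr // ltW | rewrite gtr_pMr // invf_lt1 // ltr1n].
  by split=> //; apply: dot_graph; exact: ltW.
Qed.

Lemma within_comp (T U Z : topologicalType) (B : set U) (K : set T) (G : U -> Z)
    (pi : T -> U) : continuous pi -> (forall w, K w -> B (pi w)) ->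
  {within B, continuous G} -> {within K, continuous (G \o pi)}.
Proof.
move=> cpi KB /subspace_continuousP cG; apply/subspace_continuousP => w Kw A GA.
have nA : nbhs (pi w) [set u | B u -> A (G u)] by exact: (cG _ (KB _ Kw)) GA.
have nw : nbhs w (pi @^-1` [set u | B u -> A (G u)]) by exact: cpi nA.
by apply: filterS nw => v Av /KB; exact: Av.
Qed.

(** * Spheres embedded in a Hausdorff space *)

Section SphereTransfer.
Context (R : realType) (X : topologicalType) (HX : hausdorff_space X).

Lemma image_compact_closed (m : nat) (K : set 'rV[R]_m) (G : 'rV[R]_m -> X) :
  compact K -> {within K, continuous G} -> closed (G @` K).
Proof. by move=> cK cG; apply: compact_closed => //; exact: continuous_compact. Qed.

Lemma within_avoid (m : nat) (S : set 'rV[R]_m) (F : 'rV[R]_m -> X) (C : set X) p :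
  {within S, continuous F} -> closed C -> S p -> ~ C (F p) ->
  exists V, [/\ open V, V p & forall q, V q -> S q -> ~ C (F q)].
Proof.
move=> cF cC Sp CFp.
have nC : nbhs (F p) (~` C) by apply: open_nbhs_nbhs; split => //; exact: closed_openC.
have : within S (nbhs p) (F @^-1` ~` C) by rewrite nbhs_subspace_in //; exact: cF nC.
by rewrite /within /= nbhsE => -[V [oV Vp] VC]; exists V; split=> // q; exact: VC.
Qed.

(* Two embeddings with overlapping images, of a sphere and of a compact set [K] of
   the same dimension: [K] is a neighbourhood of the points where they agree. *)
Lemma sphere_transfer (k : nat) (F : 'rV[R]_k.+1 -> X) (G : 'rV[R]_k -> X)
    (K : set 'rV[R]_k) (V : set 'rV[R]_k.+1) p z :
  {within esphere R k.+1, continuous F} ->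
  (forall x y, esphere R k.+1 x -> esphere R k.+1 y -> F x = F y -> x = y) ->
  compact K -> {within K, continuous G} ->
  (forall x y, K x -> K y -> G x = G y -> x = y) ->
  esphere R k.+1 p -> K z -> F p = G z -> nbhs p V ->
  (forall q, V q -> esphere R k.+1 q -> exists2 w, K w & F q = G w) -> nbhs z K.
Proof.
move=> cF FI cK cG GI Sp Kz FpGz pV FVG.
have [phi [cphi phi0 phiI phiSV]] := sphere_chart Sp pV.
have [h hP] : exists h : 'rV[R]_k -> 'rV[R]_k,
    forall x, `|x| <= 1 -> K (h x) /\ F (phi x) = G (h x).
  suff /boolp.choice[h hP] : forall x, exists w, `|x| <= 1 -> K w /\ F (phi x) = G w.
    by exists h.
  move=> x; have [x1|] := pselect (`|x| <= 1); last by exists 0.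
  by have [Sx Vx] := phiSV x x1; have [w Kw] := FVG _ Vx Sx; exists w.
have h0 : h 0 = z.
  by have [|Kh Fh] := hP 0; [rewrite normr0 | apply: GI; rewrite // -Fh phi0].
have : nbhs (h 0) [set h x | x in @unit_cube R k].
  apply: invariance_of_domain_cube => [x e x1 e0|x y x1 y1 hxy].
    have [Kh Fh] := hP x x1; have [Sx _] := phiSV x x1.
    pose far := K `&` [set w | e <= `|h x - w|].
    have cfar : compact far.
      apply: compact_closedI => //; apply: closed_ge_fun.
      apply: (@continuous_norm_sub _ _ _ (fun=> h x) id) => [|w A //].
      exact: cst_continuous.
    have clfar : closed (G @` far).
      by apply: image_compact_closed => //; apply: continuous_subspaceW cG => w [].
    have [|W [oW Wx WF]] := within_avoid cF clfar Sx.
      by rewrite Fh => -[w [Kw hw] /GI wE]; move: hw; rewrite /= wE // subrr normr0 leNgt e0.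
    have : nbhs x (phi @^-1` W) by apply: cphi; exact: open_nbhs_nbhs.
    move=> /near_rVP[r r0 rW]; exists r => // y y1 xy.
    have [Khy Fhy] := hP y y1; have [Sy _] := phiSV y y1.
    rewrite ltNge; apply/negP => ey; apply: (WF _ (rW y xy) Sy).
    by exists (h y) => //; rewrite Fhy.
  have [_ Fx] := hP x x1; have [_ Fy] := hP y y1.
  have [Sx _] := phiSV x x1; have [Sy _] := phiSV y y1.
  by apply/phiI/FI => //; rewrite Fx Fy hxy.
rewrite h0; apply: filterS => _ [x x1 <-].
by have [] := hP x x1.
Qed.

(** Padding with [m.+1] zero coordinates puts the ball into the dimension of the sphere, where
    [sphere_transfer] would make this flat set a neighbourhood. *)
Lemma sphere_not_lower (j m : nat) (F : 'rV[R]_(j + m.+1).+1 -> X) (G : 'rV[R]_j -> X)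
    (V : set 'rV[R]_(j + m.+1).+1) p :
  {within esphere R (j + m.+1).+1, continuous F} ->
  (forall x y, esphere R _ x -> esphere R _ y -> F x = F y -> x = y) ->
  {within eball R j, continuous G} ->
  (forall x y, eball R j x -> eball R j y -> G x = G y -> x = y) ->
  esphere R (j + m.+1).+1 p -> nbhs p V ->
  (forall q, V q -> esphere R _ q -> exists2 w, eball R j w & F q = G w) -> False.
Proof.
move=> cF FI cG GI Sp pV FVG.
pose K := [set w : 'rV[R]_(j + m.+1) | eball R j (lsubmx w) /\ rsubmx w = 0].
have clsub : continuous (@lsubmx R 1 j m.+1).
  apply: continuous_rowP => i.
  have -> : (fun w : 'rV[R]_(j + m.+1) => lsubmx w 0 i) = (fun w => w 0 (lshift m.+1 i)).
    by apply/funext => w; rewrite mxE.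
  exact: coord_continuous.
have Kproj w : eball R j w -> K (row_mx w 0) by rewrite /K /= row_mxKl row_mxKr.
have [z Bz FpGz] := FVG p (nbhs_singleton pV) Sp.
have : nbhs (row_mx z (0 : 'rV[R]_m.+1)) K.
  apply: (@sphere_transfer _ F (G \o lsubmx) K V p) => //.
  - have -> : K = (fun w : 'rV[R]_j => row_mx w (0 : 'rV[R]_m.+1)) @` eball R j.
      apply/seteqP; split=> [w [wB w0]|_ [w wB <-]]; last exact: Kproj.
      by exists (lsubmx w) => //; rewrite -w0 hsubmxK.
    apply: continuous_compact; last exact: eball_compact.
    apply: continuous_subspaceT; apply: continuous_rowP => i.
    case: (split_ordP i) => i' ->.
      have -> : (fun w : 'rV[R]_j => row_mx w (0 : 'rV[R]_m.+1) 0 (lshift m.+1 i')) = (fun w => w 0 i').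
        by apply/funext => w; rewrite row_mxEl.
      exact: coord_continuous.
    have -> : (fun w : 'rV[R]_j => row_mx w (0 : 'rV[R]_m.+1) 0 (rshift j i')) = (fun=> 0).
      by apply/funext => w; rewrite row_mxEr mxE.
    exact: cst_continuous.
  - by apply: (within_comp clsub _ cG) => w [].
  - move=> x y [Bx x0] [By y0] /= /GI xy; rewrite -[x]hsubmxK -[y]hsubmxK x0 y0.
    by rewrite xy.
  - exact: Kproj.
  - by rewrite /= row_mxKl.
  - move=> q Vq Sq; have [w Bw Fq] := FVG q Vq Sq; exists (row_mx w 0); first exact: Kproj.
    by rewrite /= row_mxKl.
move=> /near_rVP[e e0 /(_ (row_mx z (const_mx (e / 2))))].
case=> [|_ /rowP/(_ 0)]; last first.
  by rewrite row_mxKr !mxE => /eqP; rewrite gt_eqF // divr_gt0.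
rewrite opp_row_mx add_row_mx subrr sub0r; apply/ltr_rV_norm => // i.
case: (split_ordP i) => i' ->; first by rewrite row_mxEl mxE normr0.
rewrite row_mxEr !mxE normrN gtr0_norm ?divr_gt0 //.
by rewrite gtr_pMr // invf_lt1 // ltr1n.
Qed.

(** The dimension is related by an equation because [cw_dim c] is not literally a successor. *)
Lemma sphere_transfer' (n k : nat) (F : 'rV[R]_n -> X) (G : 'rV[R]_k -> X)
    (K : set 'rV[R]_k) (V : set 'rV[R]_n) p z : n = k.+1 ->
  {within esphere R n, continuous F} ->
  (forall x y, esphere R n x -> esphere R n y -> F x = F y -> x = y) ->
  compact K -> {within K, continuous G} ->
  (forall x y, K x -> K y -> G x = G y -> x = y) ->
  esphere R n p -> K z -> F p = G z -> nbhs p V ->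
  (forall q, V q -> esphere R n q -> exists2 w, K w & F q = G w) -> nbhs z K.
Proof. by move=> nk; subst n; exact: sphere_transfer. Qed.

Lemma sphere_not_lower' (n j : nat) (F : 'rV[R]_n -> X) (G : 'rV[R]_j -> X)
    (V : set 'rV[R]_n) p : (j.+1 < n)%N ->
  {within esphere R n, continuous F} ->
  (forall x y, esphere R n x -> esphere R n y -> F x = F y -> x = y) ->
  {within eball R j, continuous G} ->
  (forall x y, eball R j x -> eball R j y -> G x = G y -> x = y) ->
  esphere R n p -> nbhs p V ->
  (forall q, V q -> esphere R n q -> exists2 w, eball R j w & F q = G w) -> False.
Proof.
move=> jn; have nE : n = (j + (n - j.+2).+1).+1 by lia.
by move: (n - j.+2)%N nE => m nE {jn}; subst n; exact: sphere_not_lower.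
Qed.

End SphereTransfer.

(** * Cells of strongly regular complexes *)

Section RegularCW.
Context (R : realType) (X : topologicalType) (P : cw_complex R X).
Context (srP : strongly_regular P).
Implicit Types (a c e s : P) (x : X).

Definition open_cell c : set X := cw_char c @` eoball R (cw_dim c).
Definition cell_boundary c : set X := cw_char c @` esphere R (cw_dim c).

Let HX := cw_hausdorff P.

Lemma closed_cell_cases c x : closed_cell c x -> open_cell c x \/ cell_boundary c x.
Proof.
move=> [y]; rewrite /eball /= le_eqVlt => /predU1P[y1|y1] <-.
  by right; exists y.
by left; exists y.
Qed.

Lemma open_cell_closed c : open_cell c `<=` closed_cell c.
Proof. by move=> _ [y y1 <-]; exists y => //; exact: ltW. Qed.

Lemma cell_boundary_closed c : cell_boundary c `<=` closed_cell c.
Proof. by move=> _ [y y1 <-]; exists y => //; rewrite /eball /= y1. Qed.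

Lemma cell_boundary_lower c x : cell_boundary c x ->
  exists2 e, (cw_dim e < cw_dim c)%N & open_cell e x.
Proof. by move=> /cw_attach[e ? ?]; exists e. Qed.

Lemma open_cell_uniq e e' x : open_cell e x -> open_cell e' x -> e = e'.
Proof. by move=> ex e'x; apply: (@cw_disjoint _ _ P); exists x. Qed.

Lemma exists_open_cell x : exists e, open_cell e x.
Proof. by have : [set: X] x by []; rewrite -(cw_cover P) => -[e _ ex]; exists e. Qed.

Lemma open_in_closed e c x : open_cell e x -> closed_cell c x ->
  e = c \/ (cw_dim e < cw_dim c)%N.
Proof.
move=> ex /closed_cell_cases[cx|/cell_boundary_lower[e' e'c e'x]].
  by left; exact: open_cell_uniq cx.
by right; rewrite (open_cell_uniq ex e'x).
Qed.

Lemma open_cell_nonempty c : exists x, open_cell c x.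
Proof. by exists (cw_char c 0), 0; rewrite // /eoball /= dot0l. Qed.

(** Injectivity is given on the open ball and on the sphere separately. The two images are disjoint
    because a boundary point lies in an open cell of smaller dimension. *)
Lemma cw_char_inj c y z : eball R _ y -> eball R _ z ->
  cw_char c y = cw_char c z -> y = z.
Proof.
have mixed u v : dot u u < 1 -> dot v v = 1 -> cw_char c u <> cw_char c v.
  move=> u1 v1 uv; have [|e ec ev] := @cell_boundary_lower c (cw_char c v).
    by exists v.
  by move: ec; rewrite -(@open_cell_uniq c e _ _ ev) ?ltnn // -uv; exists u.
rewrite /eball /= !le_eqVlt => /predU1P[y1|y1] /predU1P[z1|z1] yz.
- have [_ [g _ gK]] := srP.1 c.
  by rewrite -[y]gK ?inE // -[z]gK ?inE // yz.
- by have := mixed z y z1 y1 (esym yz).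
- by have := mixed y z y1 z1 yz.
- have [_ [g _ gK]] := cw_char_open c.
  by rewrite -[y]gK ?inE // -[z]gK ?inE // yz.
Qed.

Lemma closed_cell_is_closed c : closed (closed_cell c).
Proof.
apply: image_compact_closed => //; first exact: eball_compact.
exact: cw_char_continuous.
Qed.

Lemma closed_cells_union (D : set P) : closed (\bigcup_(a in D) closed_cell a).
Proof.
by apply: closed_bigcup => [|a _]; [exact: finite_finset | exact: closed_cell_is_closed].
Qed.

Lemma cw_char_sphere_continuous c : {within esphere R (cw_dim c), continuous (cw_char c)}.
Proof.
apply: continuous_subspaceW (@cw_char_continuous _ _ P c) => y.
by rewrite /esphere /eball /= => ->.
Qed.

(** The intersection is a closed cell [u] by strong regularity. Being contained in [closed_cell e],
    it is [e] or of smaller dimension; the latter is impossible since it contains a point of the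
    open cell of [e]. *)
Lemma open_meets_closed e s x : open_cell e x -> closed_cell s x ->
  closed_cell e `<=` closed_cell s.
Proof.
move=> ex sx; have ex' := open_cell_closed ex.
have [/seteqP[/(_ x (conj ex' sx))//]|[u eu]] := srP.2 e s.
have ux : closed_cell u x by rewrite -eu.
have [y uy] := open_cell_nonempty u.
have ey : closed_cell e y by have : closed_cell u y := open_cell_closed uy; rewrite -eu => -[].
have ue : u = e.
  have [//|ue] := open_in_closed uy ey.
  by have [//|] := open_in_closed ex ux; rewrite ltnNge (ltnW ue).
by move=> z; rewrite -{1}ue -eu => -[].
Qed.

Lemma closed_cell_inj : injective (@closed_cell R X P).
Proof.
move=> c e ce; have [y cy] := open_cell_nonempty c; have [z ez] := open_cell_nonempty e.
have ey : closed_cell e y by rewrite -ce; exact: open_cell_closed.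
have cz : closed_cell c z by rewrite ce; exact: open_cell_closed.
have [//|lt1] := open_in_closed cy ey; have [//|lt2] := open_in_closed ez cz.
by move: lt1; rewrite ltnNge ltnW.
Qed.

Lemma closed_cell_sub_dim c e : closed_cell c `<=` closed_cell e ->
  c = e \/ (cw_dim c < cw_dim e)%N.
Proof.
move=> ce; have [y cy] := open_cell_nonempty c.
exact: open_in_closed cy (ce _ (open_cell_closed cy)).
Qed.

Lemma sphere_avoid c (p : 'rV[R]_(cw_dim c)) (D : set P) : esphere R _ p ->
  ~ (\bigcup_(a in D) closed_cell a) (cw_char c p) ->
  exists V, [/\ open V, V p & forall q, V q -> esphere R _ q ->
    forall a, D a -> ~ closed_cell a (cw_char c q)].
Proof.
move=> Sp Dp.
have [V [oV Vp VD]] := within_avoid (@cw_char_sphere_continuous c) (@closed_cells_union D) Sp Dp.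
by exists V; split=> // q Vq Sq a Da aq; apply: (VD q) => //; exists a.
Qed.

(* Otherwise an open subset of the boundary sphere would embed into a cell of smaller
   dimension. *)
Lemma boundary_facet c x : cell_boundary c x ->
  exists a, [/\ cw_dim c = (cw_dim a).+1, closed_cell a `<=` closed_cell c & closed_cell a x].
Proof.
move=> [p Sp px]; apply: contrapT => noa.
pose D := [set a : P | cw_dim c = (cw_dim a).+1 /\ closed_cell a `<=` closed_cell c].
have [|V [oV Vp VD]] := @sphere_avoid c p D Sp.
  by rewrite px => -[a [? ?] ?]; apply: noa; exists a.
have cellD q e : V q -> esphere R _ q -> open_cell e (cw_char c q) ->
    ((cw_dim e).+1 < cw_dim c)%N.
  move=> Vq Sq eq; have bq : cell_boundary c (cw_char c q) by exists q.
  have ec := open_meets_closed eq (cell_boundary_closed bq).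
  have [e' e'c e'q] := cell_boundary_lower bq; rewrite ltn_neqAle.
  have ee' := open_cell_uniq eq e'q; rewrite ee' e'c andbT; apply/eqP => dimE.
  by apply: (VD q Vq Sq e) (open_cell_closed eq); split; rewrite // ee' dimE.
pose hit (e : P) := `[< exists q, [/\ V q, esphere R _ q & open_cell e (cw_char c q)] >].
have [e0 e0p] := exists_open_cell (cw_char c p).
have hit0 : hit e0 by apply/asboolP; exists p.
(* Among the cells hit near [p] take one of largest dimension. Near a point of its open cell the
   sphere meets no other open cell, so a piece of the sphere embeds into [e]. *)
case: (@arg_maxnP _ e0 hit (@cw_dim _ _ P) hit0) => e /asboolP[q [Vq Sq eq]] emax.
pose D' := [set e' : P | (cw_dim e' <= cw_dim e)%N /\ e' <> e].
have [|W [oW Wq WD]] := @sphere_avoid c q D' Sq.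
  move=> [e' [e'e ne'e] e'q]; have [/esym//|] := open_in_closed eq e'q.
  by rewrite ltnNge e'e.
apply: (@sphere_not_lower' R X HX (cw_dim c) (cw_dim e) (cw_char c) (cw_char e) (V `&` W) q) => //.
- exact: cellD eq.
- exact: cw_char_sphere_continuous.
- by move=> y z Sy Sz; apply: cw_char_inj; rewrite /eball /= ?Sy ?Sz.
- exact: cw_char_continuous.
- exact: cw_char_inj.
- by apply: filterI; exact: open_nbhs_nbhs.
- move=> y [Vy Wy] Sy; have [e' e'y] := exists_open_cell (cw_char c y).
  have e'e : (cw_dim e' <= cw_dim e)%N by apply: emax; apply/asboolP; exists y.
  have -> : e = e'.
    apply: contrapT => ne; apply: (WD y Wy Sy e') (open_cell_closed e'y).
    by split=> //; exact/nesym.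
  by have [w w1 <-] := open_cell_closed e'y; exists w.
Qed.

(* Otherwise a neighbourhood of a point of the boundary sphere would embed into a
   half-space of the same dimension. *)
Lemma codim2_two_cofaces c e : cw_dim c = (cw_dim e).+2 ->
  closed_cell e `<=` closed_cell c -> exists a1 a2, a1 != a2 /\
    forall a, a = a1 \/ a = a2 -> [/\ cw_dim a = (cw_dim e).+1,
      closed_cell e `<=` closed_cell a & closed_cell a `<=` closed_cell c].
Proof.
move=> ce esub; have [x ex] := open_cell_nonempty e.
have xbd : cell_boundary c x.
  case: (closed_cell_cases (esub _ (open_cell_closed ex))) => // cx.
  by have := ce; rewrite (open_cell_uniq ex cx); lia.
have [a [ca asub ax]] := boundary_facet xbd.
have ea := open_meets_closed ex ax.
pose D := [set a' : P | [/\ cw_dim c = (cw_dim a').+1, closed_cell a' `<=` closed_cell c & a' <> a]].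
have [[a' [ca' a'sub a'a] a'x]|Dx] := pselect ((\bigcup_(a' in D) closed_cell a') x).
  exists a, a'; split; first by apply/eqP/nesym.
  move=> b [->|->]; split=> //; try lia.
  exact: open_meets_closed ex a'x.
exfalso; have [p Sp px] := xbd.
have [|V [oV Vp VD]] := @sphere_avoid c p D Sp; first by rewrite px.
have [z z1 zx] := ax.
have Sz : dot z z = 1.
  move: z1; rewrite /eball /= le_eqVlt => /predU1P[//|z1].
  have xa : open_cell a x by exists z.
  by have := ce; rewrite (open_cell_uniq ex xa); lia.
have : nbhs z (eball R (cw_dim a)).
  apply: (@sphere_transfer' R X HX (cw_dim c) (cw_dim a) (cw_char c) (cw_char a) _ V p) => //.
  - exact: cw_char_sphere_continuous.
  - by move=> y w Sy Sw; apply: cw_char_inj; rewrite /eball /= ?Sy ?Sw.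
  - exact: eball_compact.
  - exact: cw_char_continuous.
  - exact: cw_char_inj.
  - by rewrite px zx.
  - exact: open_nbhs_nbhs.
  - move=> q Vq Sq; have [|b [cb bsub bq]] := @boundary_facet c (cw_char c q); first by exists q.
    have <- : b = a; last by have [w w1 <-] := bq; exists w.
    by apply: contrapT => ba; apply: (VD q Vq Sq b) bq; split.
move=> /near_rVP[r r0 rB].
have z0 : 0 < `|z|.
  by rewrite normr_gt0; apply/eqP => z0; move: Sz; rewrite z0 dot0l => /eqP; rewrite eq_sym oner_eq0.
(* As [z] lies on the unit sphere, moving outward along its ray leaves the ball at once. *)
pose t := r / (2 * `|z|); have t0 : 0 < t by rewrite divr_gt0 // mulr_gt0.
have zt : z - (1 + t) *: z = - t *: z.
  by rewrite scalerDl scale1r scaleNr opprD addrA subrr add0r.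
have zr : `|z - (1 + t) *: z| < r.
  rewrite zt normrZ normrN (gtr0_norm t0) /t invfM mulrA mulfVK ?gt_eqF //.
  by rewrite gtr_pMr // invf_lt1 // ltr1n.
have := rB _ zr; rewrite /eball /= dotZl dotZr Sz; nra.
Qed.

End RegularCW.

(** * The semilattice of faces *)

Section FaceLattice.
Context (R : realType) (X : topologicalType) (P : cw_complex R X) (k : nat).
Context (srP : strongly_regular P) (pmP : pseudomanifold P k.+1).
Implicit Types (a c e s v F : P).

(* [None] is the empty face and [Some None] the whole complex. *)
Definition face := option (option P).

Definition face_le (x y : face) : bool :=
  match x, y with
  | None, _ | _, Some None => true
  | Some (Some c), Some (Some c') => `[< closed_cell c `<=` closed_cell c' >]
  | _, _ => false
  end.

Definition face_rk (x : face) : nat :=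
  match x with None => 0%N | Some None => k.+3 | Some (Some c) => (cw_dim c).+1 end.

(** By strong regularity [pick] fails only if the closed cells are disjoint, and then the meet is
    the empty face. *)
Definition face_meet (x y : face) : face :=
  match x, y with
  | None, _ | _, None => None
  | Some None, z | z, Some None => z
  | Some (Some c), Some (Some c') =>
    omap Some [pick u : P | `[< closed_cell c `&` closed_cell c' = closed_cell u >]]
  end.

Lemma cell_dim_max c : (cw_dim c <= k.+1)%N.
Proof. by case: pmP => _ _ [_ + _]; apply. Qed.

Lemma closed_cell_nonempty c : exists x, closed_cell c x.
Proof. by have [x cx] := open_cell_nonempty c; exists x; exact: open_cell_closed. Qed.

Lemma maximal_dim c : cw_dim c = k.+1 -> maximal_cell c.
Proof.
move=> ck c' cc'; have [->//|] := closed_cell_sub_dim cc'.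
by rewrite ck ltnNge cell_dim_max.
Qed.

Lemma exists_facet c : exists2 F : P, cw_dim F = k.+1 & closed_cell c `<=` closed_cell F.
Proof.
pose above (F : P) := `[< closed_cell c `<=` closed_cell F >].
have cc : above c by apply/asboolP.
case: (@arg_maxnP _ c above (@cw_dim _ _ P) cc) => F /asboolP cF Fmax.
exists F => //; case: pmP => _ pure [[c0 c0k] _] _; rewrite -c0k.
apply: pure; last exact: maximal_dim.
move=> F' FF'; have [->//|] := closed_cell_sub_dim FF'.
rewrite ltnNge; have -> // : (cw_dim F' <= cw_dim F)%N.
by apply: Fmax; apply/asboolP; exact: subset_trans cF FF'.
Qed.

Lemma face_lexx : reflexive face_le.
Proof. by move=> [[c|]|] //=; apply/asboolP. Qed.

Lemma face_le_anti : antisymmetric face_le.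
Proof.
move=> [[c|]|] [[c'|]|] //= /andP[/asboolP cc' /asboolP c'c].
by do 2 congr Some; apply: closed_cell_inj; apply/seteqP.
Qed.

Lemma face_le_trans : transitive face_le.
Proof.
move=> [[c|]|] [[c'|]|] [[c''|]|] //= /asboolP cc' /asboolP c'c''.
by apply/asboolP; exact: subset_trans cc' c'c''.
Qed.

Lemma face_lexI x y z : face_le z (face_meet x y) = face_le z x && face_le z y.
Proof.
case: x y z => [[c|]|] [[c'|]|] [[c''|]|] //=; rewrite ?andbT ?andbF //.
- case: pickP => [u /asboolP cc'u|no] /=.
    apply/asboolP/andP => [|[/asboolP h1 /asboolP h2]]; last by rewrite -cc'u subsetI.
    by rewrite -cc'u subsetI => -[? ?]; split; apply/asboolP.
  apply/esym/negP => /andP[/asboolP h1 /asboolP h2].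
  have [cc'0|[u cc'u]] := srP.2 c c'; last by have := no u; rewrite asboolT.
  by have [x xc] := closed_cell_nonempty c''; have : set0 x by rewrite -cc'0; split; [exact: h1 | exact: h2].
- by case: pickP.
Qed.

Local Notation strict := (Thin.strict face_le).

Lemma face_rk_lt x y : strict x y -> (face_rk x < face_rk y)%N.
Proof.
case: x y => [[c|]|] [[c'|]|] //=; rewrite /Thin.strict ?eqxx //=.
- move=> /andP[cc' /asboolP sub]; rewrite ltnS.
  by have [cE|//] := closed_cell_sub_dim sub; rewrite cE eqxx in cc'.
- by rewrite ltnS ltnS => _; exact: cell_dim_max.
Qed.

Lemma cell_strict c c' : closed_cell c `<=` closed_cell c' -> (cw_dim c < cw_dim c')%N ->
  strict (Some (Some c)) (Some (Some c')).
Proof.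
move=> sub cc'; apply/andP; split; last exact/asboolP.
by apply: contraTneq cc' => -[->]; rewrite ltnn.
Qed.

Lemma cell_boundary_nonempty c : (0 < cw_dim c)%N -> exists x, cell_boundary c x.
Proof.
rewrite /cell_boundary; move: (cw_dim c) (@cw_char _ _ P c) => [|n] F // _.
exists (F (delta_mx 0 0)), (delta_mx 0 0) => //; rewrite /esphere /= /dot (bigD1 0) //=.
by rewrite big1 ?addr0 ?mxE ?mulr1 // => i i0; rewrite mxE (negbTE i0) andbF mulr0.
Qed.

Lemma face_cocover x y : strict x y ->
  exists w, [/\ face_le x w, strict w y & face_rk y = (face_rk w).+1].
Proof.
case: y => [[c|]|]; last by case: x => [[]|]; rewrite /Thin.strict /= ?andbF ?eqxx.
  case: x => [[e|]|]; rewrite /Thin.strict //=; last first.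
    move=> _; have [c0|c0] := posnP (cw_dim c); first by exists None; rewrite /= c0.
    have [x xc] := cell_boundary_nonempty c0.
    have [a [ca ac _]] := boundary_facet srP xc.
    by exists (Some (Some a)); split; rewrite //= ?ca //; apply: cell_strict; rewrite ?ca.
  move=> /andP[ec /asboolP sub]; have [x ex] := open_cell_nonempty e.
  have xc : cell_boundary c x.
    case: (closed_cell_cases (sub _ (open_cell_closed ex))) => // cx.
    by rewrite (open_cell_uniq ex cx) eqxx in ec.
  have [a [ca ac ax]] := boundary_facet srP xc.
  exists (Some (Some a)); split; rewrite //= ?ca //; last by apply: cell_strict; rewrite ?ca.
  by apply/asboolP; exact: open_meets_closed ex ax.
case: pmP => _ _ [[c0 c0k] _] _.
case: x => [[e|]|]; rewrite /Thin.strict //= ?eqxx // => _.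
  have [F Fk eF] := exists_facet e.
  by exists (Some (Some F)); split; rewrite //= ?Fk //; exact/asboolP.
by exists (Some (Some c0)); split; rewrite //= c0k.
Qed.

Lemma edge_vertices c : cw_dim c = 1%N -> exists v1 v2 : P, v1 <> v2 /\
  forall v, (cw_dim v = 0%N /\ closed_cell v `<=` closed_cell c) <-> v = v1 \/ v = v2.
Proof.
move=> c1.
have [p [q [pq Spq]]] : exists p q : 'rV[R]_(cw_dim c), p <> q /\
    forall y, esphere R _ y <-> y = p \/ y = q.
  rewrite c1; exists (const_mx 1), (const_mx (-1)); split.
    by move=> /rowP/(_ 0); rewrite !mxE; lra.
  move=> y; rewrite /esphere /= /dot big_ord_recl big_ord0 addr0 -expr2.
  have cE z : y = const_mx z <-> y 0 0 = z.
    split=> [->|yz]; first by rewrite mxE.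
    by apply/rowP => j; rewrite (ord1 j) mxE.
  by rewrite !cE; split=> [/eqP|[]->]; rewrite ?sqrrN ?expr1n // sqrf_eq1 => /orP[]/eqP; [left|right].
have vert y : esphere R _ y -> exists v : P, cw_dim v = 0%N /\ open_cell v (cw_char c y).
  move=> Sy; have [|v vc vy] := @cell_boundary_lower _ _ _ c (cw_char c y); first by exists y.
  by exists v; split=> //; move: vc; rewrite c1 ltnS leqn0 => /eqP.
have [v1 [v10 v1p]] := vert p ((Spq p).2 (or_introl erefl)).
have [v2 [v20 v2q]] := vert q ((Spq q).2 (or_intror erefl)).
have pt (v : P) y z : cw_dim v = 0%N -> closed_cell v y -> closed_cell v z -> y = z.
  move=> v0 [u _ <-] [w _ <-]; congr cw_char; move: u w; rewrite v0 => u w.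
  by apply/rowP => -[].
have inB y : esphere R _ y -> eball R (cw_dim c) y by rewrite /esphere /eball /= => ->.
have sphere_p := (Spq p).2 (or_introl erefl); have sphere_q := (Spq q).2 (or_intror erefl).
exists v1, v2; split.
  move=> v12; apply: pq; apply: (cw_char_inj srP); [exact: inB | exact: inB |].
  apply: (pt v1) => //; apply: open_cell_closed => //.
  by rewrite v12.
have vsub (v : P) y : esphere R (cw_dim c) y -> open_cell v (cw_char c y) ->
    closed_cell v `<=` closed_cell c.
  move=> Sy vy; apply: (open_meets_closed srP vy); exists y => //; exact: inB.
move=> v; split=> [[v0 vc]|[]->]; [|by split=> //; exact: vsub v1p|by split=> //; exact: vsub v2q].
have [x vx] := open_cell_nonempty v.
case: (closed_cell_cases (vc _ (open_cell_closed vx))) => [cx|[y Sy yx]].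
  by have := c1; rewrite -(open_cell_uniq vx cx) v0.
case: ((Spq y).1 Sy) => yE; [left|right]; apply: (@open_cell_uniq _ _ _ _ _ x) => //.
  by rewrite -yx yE.
by rewrite -yx yE.
Qed.

(** Three sources: the ends of an edge above the empty face, [codim2_two_cofaces] between cells, and
    the pseudomanifold condition below the top. *)
Lemma face_thin x y : strict x y -> face_rk y = (face_rk x).+2 -> exists w1 w2,
  [/\ w1 != w2, strict x w1, strict w1 y, strict x w2 & strict w2 y].
Proof.
have ne a b : a <> b -> Some (Some a) != Some (Some b) :> face by move=> ab; apply/eqP => -[].
case: y => [[c|]|]; last by case: x => [[]|]; rewrite /Thin.strict /= ?andbF ?eqxx.
  case: x => [[e|]|] xy /= rk; last first.
  - have [|v1 [v2 [v12 vP]]] := @edge_vertices c; first by case: rk.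
    have [[v10 v1c] [v20 v2c]] := ((vP v1).2 (or_introl erefl), (vP v2).2 (or_intror erefl)).
    exists (Some (Some v1)), (Some (Some v2)); split; rewrite ?ne //.
      by apply: cell_strict; rewrite // v10; case: rk => ->.
    by apply: cell_strict; rewrite // v20; case: rk => ->.
  - by case/andP: xy => _ /=.
  case/andP: xy => _ /asboolP sub; case: rk => ce.
  have [a1 [a2 [a12 aP]]] := codim2_two_cofaces srP ce sub.
  have [[d1 ea1 a1c] [d2 ea2 a2c]] := (aP a1 (or_introl erefl), aP a2 (or_intror erefl)).
  by exists (Some (Some a1)), (Some (Some a2)); split; rewrite ?ne //;
    try exact/eqP; apply: cell_strict; rewrite // ?ce ?d1 ?d2.
case: x => [[e|]|] _ //= [] // ek.
case: pmP => _ _ _ /(_ e (congr1 S (esym ek))) two.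
have /card_gt1P[F1 [F2 [F1P F2P F12]]] : (1 < #|[pred t : P | (cw_dim t == k.+1) &&
    `[< closed_cell e `<=` closed_cell t >]]|)%N by rewrite two.
move: F1P F2P; rewrite !inE => /andP[/eqP F1k eF1] /andP[/eqP F2k eF2].
exists (Some (Some F1)), (Some (Some F2)); split=> //.
- by apply: cell_strict; [exact/asboolP | rewrite F1k ek].
- by apply: cell_strict; [exact/asboolP | rewrite F2k ek].
Qed.

Lemma face_thin_edges : Thin.thin_edges face_le face_rk (None : face).
Proof.
move=> [[c|]|] _ //= [] // c1; have [v1 [v2 [_ vP]]] := edge_vertices c1.
pose V : {set face} := [set Some (Some v1); Some (Some v2)]%SET.
apply: (@leq_trans #|V|).
  apply/subset_leq_card/fintype.subsetP => -[[v|]|]; rewrite !inE //= => /andP[/asboolP vc /eqP[v0]].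
  by have [vv|vv] := (vP v).1 (conj v0 vc); rewrite vv eqxx ?orbT.
by rewrite cards2; case: eqP.
Qed.

Lemma face_level j : (j <= k.+1)%N ->
  Thin.nlevel face_le face_rk (None : face) (Some None) j.+1 = fnum P j.
Proof.
move=> jk; rewrite /Thin.nlevel /fnum -(card_imset _ (_ : injective (fun c : P => Some (Some c)))).
  apply: eq_card => -[[c|]|]; rewrite !inE /= ?add0n.
  - by rewrite eqSS mem_imset // => a b [].
  - rewrite gtn_eqF ?ltnS //; apply/esym/negP => /imsetP[c _] //.
  - by apply/esym/negP => /imsetP[c _].
by move=> a b [].
Qed.

End FaceLattice.

Theorem fnum_lower_bound (R : realType) (X : topologicalType) (P : cw_complex R X)
    (d m : nat) : (2 <= d)%N -> strongly_regular P -> pseudomanifold P d.-1 ->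
  (2 * d + 1 <= fnum P 0)%N -> (d + 3 <= fnum P d.-1)%N -> (0 < m <= d.-1)%N ->
  ('C(d + 1, m + 1) + 'C(d, m + 1) + 'C(d.-1, m) <= fnum P m)%N.
Proof.
case: d => [|[|q]] // _ srP pmP; rewrite /= in pmP *; case: m => [|k] // f0 fd /andP[_ kq].
have := @Thin.thin_semilattice_bound _ _ (@face_meet R X P) (@face_rk R X P q)
  (@face_lexx _ _ _) (@face_le_anti _ _ _) (@face_le_trans _ _ _)
  (face_lexI srP) (face_rk_lt pmP) (face_cocover srP pmP) (face_thin srP pmP)
  None (Some None) q k (@face_thin_edges R X P q srP) isT erefl.
rewrite !face_level // /Thin.bound !addn1 => bound; apply: bound; move: f0 fd; lia.
Qed.

(** * Faces of polyhedra *)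

Section Hulls.
Context (R : realType) (n : nat).
Local Notation V := 'rV[R]_n.
Implicit Types (A B : set V) (g h x y z : V).

Lemma convex_setP A : convex_set A <->
  forall x y t, A x -> A y -> 0 < t < 1 -> A (t *: x + (1 - t) *: y).
Proof.
rewrite convex_setW; split=> [cA x y t Ax Ay /andP[t0 t1]|cA x y /set_mem Ax /set_mem Ay l l0 l1].
  by apply/set_mem/(cA x y _ _ (Itv01 (ltW t0) (ltW t1))) => //; exact/mem_set.
by apply/mem_set; apply: (cA x y) => //; apply/andP.
Qed.

Lemma conv_hull_convex A : convex_set (conv_hull A).
Proof.
move=> x y l /set_mem Hx /set_mem Hy; apply/mem_set => C [cC AC].
by apply/set_mem/cC; apply/mem_set; [exact: Hx|exact: Hy].
Qed.

Lemma sub_conv_hull A : A `<=` conv_hull A. Proof. exact: sub_gen_smallest. Qed.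

Lemma conv_hullS A B : A `<=` B -> conv_hull A `<=` conv_hull B.
Proof. move=> AB; exact: (sub_smallest2r (@conv_hull_convex B) AB). Qed.

Lemma conv_hull1 x : conv_hull [set x] = [set x].
Proof.
apply: smallest_id; apply/convex_setP => y z t -> -> _.
by rewrite -scalerDl addrC subrK scale1r.
Qed.

Lemma conv_hullU A B : conv_hull (conv_hull A `|` B) = conv_hull (A `|` B).
Proof.
apply/seteqP; split; last by apply: conv_hullS; apply: setSU; exact: sub_conv_hull.
apply: smallest_sub; first exact: conv_hull_convex.
rewrite subUset; split; first by apply: conv_hullS; exact: subsetUl.
exact: subset_trans (@subsetUr _ A B) (@sub_conv_hull _).
Qed.

Lemma affine_convex A : affine_set A -> convex_set A.
Proof. by move=> aA; apply/convex_setP => x y t Ax Ay _; exact: aA. Qed.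

Lemma aff_hull_affine A : affine_set (aff_hull A).
Proof. by move=> x y t Hx Hy C CA; apply: (CA.1); [exact: Hx|exact: Hy]. Qed.

Lemma sub_aff_hull A : A `<=` aff_hull A. Proof. exact: sub_gen_smallest. Qed.

Lemma aff_hullS A B : A `<=` B -> aff_hull A `<=` aff_hull B.
Proof. move=> AB; exact: (sub_smallest2r (@aff_hull_affine B) AB). Qed.

Lemma aff_hull_conv A : aff_hull (conv_hull A) = aff_hull A.
Proof.
apply/seteqP; split; last by apply: aff_hullS; exact: sub_conv_hull.
apply: smallest_sub; first exact: aff_hull_affine.
apply: smallest_sub; last exact: sub_aff_hull.
by apply: affine_convex; exact: aff_hull_affine.
Qed.

Lemma affine_comb A (J : finType) x0 (w : J -> V) (l : J -> R) :
  affine_set A -> A x0 -> (forall j, A (x0 + w j)) -> A (x0 + \sum_j l j *: w j).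
Proof.
move=> aA A0 Aw.
have AZ v t : A (x0 + v) -> A (x0 + t *: v).
  move=> /(fun H => aA _ _ t H A0); congr A.
  by rewrite scalerDr scalerBl scale1r addrC addrA subrK.
have AD u v : A (x0 + u) -> A (x0 + v) -> A (x0 + (u + v)).
  move=> Au Av; have := AZ _ 2 (_ : A (x0 + 2^-1 *: (u + v))).
  rewrite scalerA divff ?pnatr_eq0 // scale1r; apply.
  have := aA _ _ 2^-1 Au Av; congr A.
  have -> : 1 - 2^-1 = 2^-1 :> R by lra.
  rewrite -scalerDr addrACA -[x0 + x0]mulr2n -[x0 *+ 2]scaler_nat.
  by rewrite [LHS]scalerDr scalerA mulVf ?pnatr_eq0 ?scale1r.
elim/big_ind: _ => [|u v|j _]; [by rewrite addr0|exact: AD|exact: AZ].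
Qed.

(** Affine functions are represented as slacks of linear inequalities. *)
Definition slack g (b : R) x : R := b - dot g x.

Lemma slack_comb g b x y t :
  slack g b (t *: x + (1 - t) *: y) = t * slack g b x + (1 - t) * slack g b y.
Proof. rewrite /slack dotDr !dotZr; ring. Qed.

Lemma slackD g h b c x : slack (g + h) (b + c) x = slack g b x + slack h c x.
Proof. rewrite /slack dotDl; ring. Qed.

Lemma slackB g h b c x : slack (g - h) (b - c) x = slack g b x - slack h c x.
Proof. rewrite /slack dotBl; ring. Qed.

Lemma slackZ g b t x : slack (t *: g) (t * b) x = t * slack g b x.
Proof. rewrite /slack dotZl; ring. Qed.

Lemma slack_sum (J : finType) (g : J -> V) (b : J -> R) x :
  slack (\sum_j g j) (\sum_j b j) x = \sum_j slack (g j) (b j) x.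
Proof.
elim/big_ind3: _ => [|? ? ? ? ? ? <- <-|//]; first by rewrite /slack dot0l subr0.
by rewrite -slackD.
Qed.

Lemma valid_ineqP A g b : valid_ineq (conv_hull A) g b <-> forall x, A x -> 0 <= slack g b x.
Proof.
split=> [vA x Ax|vA x Ax]; first by rewrite subr_ge0; apply: vA; exact: sub_conv_hull.
rewrite -subr_ge0; apply: (smallest_sub _ (vA : A `<=` [set x | 0 <= slack g b x]) Ax).
apply/convex_setP => y z t /= y0 z0 /andP[/ltW t0 /ltW].
by rewrite slack_comb -subr_ge0 => t1; rewrite addr_ge0 ?mulr_ge0.
Qed.

Lemma exposedE A g b : exposed A g b = A `&` [set x | slack g b x = 0].
Proof.
apply/seteqP; split=> x [Ax] /=; rewrite /slack => /eqP.
  by move=> /eqP ->; rewrite subrr.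
by rewrite subr_eq0 => /eqP.
Qed.

Lemma exposed_conv_hull A g b : valid_ineq (conv_hull A) g b ->
  exposed (conv_hull A) g b = conv_hull (A `&` [set x | slack g b x = 0]).
Proof.
move=> /valid_ineqP vA; rewrite exposedE; apply/seteqP; split=> [x [Ax x0]|].
  pose C := [set x : V | 0 <= slack g b x /\
    (slack g b x = 0 -> conv_hull (A `&` [set x | slack g b x = 0]) x)].
  suff : C x by case=> _; exact.
  apply: (smallest_sub _ _ Ax) => [|y Ay]; last first.
    by split; [exact: vA|move=> y0; exact: sub_conv_hull].
  (* Minimality of the hull is applied to [C]: if a proper combination of nonnegative slacks
     vanishes, both slacks vanish. *)
  apply/convex_setP => y z t [y0 yC] [z0 zC] /andP[t0 t1].
  have t1' : 0 < 1 - t by rewrite subr_gt0.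
  have [/ltW t0' /ltW t1''] := (t0, t1').
  rewrite /C /= slack_comb; split; first by rewrite addr_ge0 ?mulr_ge0.
  move/eqP; rewrite paddr_eq0 ?mulr_ge0 //.
  rewrite !mulf_eq0 (gt_eqF t0) (gt_eqF t1') /= => /andP[/eqP /yC yC' /eqP /zC zC'].
  have /convex_setP := @conv_hull_convex (A `&` [set x | slack g b x = 0]).
  by apply => //; apply/andP.
rewrite subsetI; split; first by apply: conv_hullS; exact: subIsetl.
apply: smallest_sub => [|x []//].
by apply/convex_setP => y z t /= y0 z0 _; rewrite slack_comb y0 z0 !mulr0 addr0.
Qed.

Lemma slack0_affine g b : affine_set [set x | slack g b x = 0].
Proof. by move=> x y t /= x0 y0; rewrite slack_comb x0 y0 !mulr0 addr0. Qed.

Lemma dot_mxE (m : nat) (M : 'M[R]_(n, m)) x j :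
  (x *m M) 0 j = dot (col j M)^T x.
Proof. by rewrite mxE; apply: eq_bigr => i _; rewrite !mxE mulrC. Qed.

Lemma dot_mulmx g x : dot g x = (x *m g^T) 0 0.
Proof. by rewrite dot_mxE; congr dot; apply/rowP => i; rewrite !mxE. Qed.

Lemma affdim_solutions (m : nat) (M : 'M[R]_(n, m)) A x0 k :
  aff_hull A = [set x | (x - x0) *m M = 0] -> affdim A k <-> (k + \rank M = n)%N.
Proof.
move=> AE; have rM : (\rank M <= n)%N by exact: rank_leq_row.
split=> [[y0 [B [/eqP fB BE]]]|kM].
  have [By0 Bx0] : aff_hull A y0 /\ aff_hull A x0.
    rewrite {1}BE AE /=; split; first by rewrite subrr sub0mx.
    by rewrite subrr mul0mx.
  have BM : (B :=: kermx M)%MS.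
    apply/eqmxP/andP; split; apply/row_subP => i.
      have : aff_hull A (y0 + row i B) by rewrite BE /= addrC addKr row_sub.
      move: By0; rewrite AE /= => y0M iM; apply/sub_kermxP.
      by rewrite -[row i B](addrK (y0 - x0)) mulmxBl y0M subr0 addrCA addrA.
    have : aff_hull A (y0 + row i (kermx M)).
      move: By0; rewrite AE /= => y0M.
      by rewrite addrAC mulmxDl y0M add0r; apply/sub_kermxP; exact: row_sub.
    by rewrite BE /= addrC addKr.
  by rewrite -fB BM mxrank_ker subnK.
have kE : \rank (kermx M) = k by rewrite mxrank_ker; move: kM; lia.
exists x0, (castmx (kE, erefl n) (row_base (kermx M))); split.
  rewrite /row_free; have := row_base_free (kermx M); rewrite /row_free.
  by case: _ / kE.
rewrite AE; apply/seteqP; split=> x /= xM.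
  have : (x - x0 <= row_base (kermx M))%MS by rewrite eq_row_base; apply/sub_kermxP.
  by case: _ / kE.
have {}xM : (x - x0 <= row_base (kermx M))%MS by move: xM; case: _ / kE.
by apply/sub_kermxP; rewrite eq_row_base in xM.
Qed.

(** The linear part is a column of the cokernel of the differences [x j - x j0] that does not
    annihilate [v - x j0]. *)
Lemma affine_sep (J : finType) (x : J -> V) (j0 : J) v : ~ aff_hull (range x) v ->
  exists g b, (forall j, slack g b (x j) = 0) /\ slack g b v = 1.
Proof.
move=> vA; pose W := \matrix_(i < #|J|) (x (enum_val i) - x j0).
have vW : ~~ (v - x j0 <= W)%MS.
  apply/negP => /submxP[D vE]; apply: vA.
  rewrite -[v](subrK (x j0)) vE addrC mulmx_sum_row; apply: affine_comb.
  - exact: aff_hull_affine.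
  - by apply: sub_aff_hull; exists j0.
  - move=> i; rewrite rowK addrC subrK; apply: sub_aff_hull; by exists (enum_val i).
move: vW; rewrite submxE => /eqP vW.
have [j vj] : exists j, ((v - x j0) *m cokermx W) 0 j != 0.
  apply/existsP; rewrite -negb_forall; apply/negP => /forallP H; apply: vW.
  by apply/rowP => j; rewrite (eqP (H j)) mxE.
rewrite dot_mxE in vj; set g := (col j (cokermx W))^T in vj.
exists (- (dot g (v - x j0))^-1 *: g), (- (dot g (v - x j0))^-1 * dot g (x j0)).
split=> [k|]; rewrite slackZ /slack.
  suff: dot g (x k - x j0) = 0 by rewrite dotBr => /eqP; rewrite subr_eq0 => /eqP ->; rewrite subrr mulr0.
  rewrite -dot_mxE; have := mulmx_coker W => /(congr1 (row (enum_rank k))).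
  rewrite row_mul rowK enum_rankK row0 => ->; by rewrite mxE.
by rewrite mulNr -mulrN opprB -dotBr mulVf.
Qed.

End Hulls.

(** * Faces described by active constraints *)

Section Polyhedron.
Context (R : realType) (n : nat) (J : finType) (a : J -> 'rV[R]_n).
Local Notation V := 'rV[R]_n.
Implicit Types (y z : V) (I : {set J}).

Definition polyhedron : set V := [set y | forall i, dot (a i) y <= 1].

Definition active y : {set J} := [set i | dot (a i) y == 1]%SET.

Definition active_face I : set V :=
  polyhedron `&` [set y | forall i, i \in I -> dot (a i) y = 1].

Lemma active_face_self y : polyhedron y -> active_face (active y) y.
Proof. by move=> Ny; split=> // i; rewrite inE => /eqP. Qed.

Lemma polyhedron_step y w : polyhedron y ->
  (forall i, i \in active y -> dot (a i) w = 0) ->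
  exists2 e, 0 < e & polyhedron (y + e *: w).
Proof.
(* Summing all ratios of speed to slack bounds each of them without taking a maximum; the [1] keeps
   [K] positive. *)
move=> Ny w0; pose K := 1 + \sum_i `|dot (a i) w| / (1 - dot (a i) y).
have t0 i : 0 <= `|dot (a i) w| / (1 - dot (a i) y).
  by rewrite divr_ge0 // subr_ge0 Ny.
have K0 : 0 < K by rewrite ltr_pwDl // sumr_ge0.
exists K^-1; first by rewrite invr_gt0.
move=> i; rewrite dotDr dotZr; have [iy|iy] := boolP (i \in active y).
  by rewrite w0 // mulr0 addr0.
have yi : 0 < 1 - dot (a i) y.
  by rewrite subr_gt0 lt_neqAle Ny andbT; move: iy; rewrite inE.
rewrite -lerBrDl mulrC ler_pdivrMr // mulrC -ler_pdivrMr //.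
apply: le_trans (_ : `|dot (a i) w| / (1 - dot (a i) y) <= _).
  by rewrite ler_pM2r ?invr_gt0 // ler_norm.
by rewrite /K (bigD1 i) //= addrCA lerDl addr_ge0 // sumr_ge0.
Qed.

Lemma poly_face_active y : polyhedron y -> poly_face polyhedron (active_face (active y)).
Proof.
move=> Ny; exists (\sum_(i in active y) a i), #|active y|%:R.
have dotE z : dot (\sum_(i in active y) a i) z = \sum_(i in active y) dot (a i) z.
  by elim/big_ind2: _ => [|? ? ? ? <- <-|//]; rewrite ?dot0l // dotDl.
have cE : #|active y|%:R = \sum_(i in active y) 1 :> R by rewrite sumr_const.
split=> [z Nz|]; first by rewrite dotE cE; apply: ler_sum => i _; exact: Nz.
rewrite /exposed; apply/seteqP; split=> z [Nz zI]; split=> //=.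
  by rewrite dotE cE; apply: eq_bigr => i /zI.
move: zI; rewrite /= dotE cE => /eqP; rewrite eq_sym -subr_eq0 -sumrB.
rewrite psumr_eq0 => [/allP zI i iI|i _]; last by rewrite subr_ge0 Nz.
by have := zI i (mem_index_enum _); rewrite iI subr_eq0 => /eqP.
Qed.

Lemma aff_hull_active y : polyhedron y ->
  aff_hull (active_face (active y)) =
  [set z | forall i, i \in active y -> dot (a i) z = 1].
Proof.
move=> Ny; apply/seteqP; split=> [|z zI].
  apply: smallest_sub => [u v t uI vI i iI /=|u []//].
  by rewrite dotDr !dotZr uI // vI // !mulr1 addrC subrK.
have [e e0 Ne] : exists2 e, 0 < e & polyhedron (y + e *: (z - y)).
  apply: polyhedron_step => // i iI; rewrite dotBr zI //.
  by move: iI; rewrite inE => /eqP ->; rewrite subrr.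
have -> : z = e^-1 *: (y + e *: (z - y)) + (1 - e^-1) *: y.
  rewrite scalerDr scalerA mulVf ?gt_eqF // scale1r scalerBl scale1r.
  by rewrite [RHS]addrC addrA subrK addrC subrK.
apply: aff_hull_affine; apply: sub_aff_hull; last exact: active_face_self.
split=> // i iI; move: (iI); rewrite inE => /eqP yi.
by rewrite dotDr dotZr dotBr yi zI // subrr mulr0 addr0.
Qed.

(* A point of the face with the fewest active constraints is in its relative
   interior. *)
Lemma active_poly_face F : poly_face polyhedron F -> F !=set0 ->
  exists2 y, polyhedron y & F = active_face (active y).
Proof.
move=> [g [b [vN ->]]] [y1 Fy1].
have [k] := ubnP #|active y1|; elim: k y1 Fy1 => // k IH y [Ny gy] kP.
have [|] := pselect (exists2 z, exposed polyhedron g b z & ~ active y \subset active z).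
  move=> [z [Nz gz] /negP yz]; pose w := 2^-1 *: y + (1 - 2^-1) *: z.
  have wi i : dot (a i) w = (dot (a i) y + dot (a i) z) / 2.
    by rewrite /w dotDr !dotZr; field.
  apply: (IH w); first split.
  - by move=> i; rewrite wi; have := Ny i; have := Nz i; lra.
  - by rewrite /= /w dotDr !dotZr gy gz; field.
  have : active w \proper active y.
    rewrite properE; apply/andP; split.
      apply/fintype.subsetP => i; rewrite !inE wi => /eqP.
      by have := Ny i; have := Nz i => ? ? ?; apply/eqP; lra.
    apply: contra yz => /fintype.subsetP yw; apply/fintype.subsetP => i /yw.
    rewrite !inE wi => /eqP.
    by have := Ny i; have := Nz i => ? ? ?; apply/eqP; lra.
  by move/proper_card => H; apply: leq_trans H _.
move=> ymin; exists y => //; apply/seteqP; split=> z [Nz zP]; split=> //=.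
  move=> i iy; have [yz|yz] := boolP (active y \subset active z).
    by have := fintype.subsetP yz i iy; rewrite inE => /eqP.
  by case: ymin; exists z => //; exact/negP.
have [e e0 Ne] : exists2 e, 0 < e & polyhedron (y + e *: (y - z)).
  apply: polyhedron_step => // i iI; rewrite dotBr zP //.
  by move: iI; rewrite inE => /eqP ->; rewrite subrr.
apply/eqP; rewrite eq_le vN //=; have := vN _ Ne.
by rewrite dotDr dotZr dotBr gy gerDl pmulr_rle0 // subr_le0.
Qed.

Lemma active_face_inj y z : polyhedron y -> polyhedron z ->
  active_face (active y) = active_face (active z) -> active y = active z.
Proof.
have sub y1 z1 : polyhedron y1 -> active_face (active y1) = active_face (active z1) ->
    active z1 \subset active y1.
  move=> Ny yz; have := active_face_self Ny; rewrite yz => -[_ zy].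
  by apply/fintype.subsetP => i /zy yi; rewrite inE yi.
by move=> Ny Nz yz; apply/eqP; rewrite finset.eqEsubset !sub.
Qed.

(** [I] is a basis of the active constraints: the two hypotheses state its independence and that it
    spans. *)
Lemma affdim_active y I k : polyhedron y -> I \subset active y ->
  (forall w : J -> R, exists h, forall i, i \in I -> dot (a i) h = w i) ->
  (forall h, (forall i, i \in I -> dot (a i) h = 0) ->
    forall i, i \in active y -> dot (a i) h = 0) ->
  affdim (active_face (active y)) k <-> (k + #|I| = n)%N.
Proof.
move=> Ny Iy free span; pose M := \matrix_(i < n, j < #|I|) a (enum_val j) 0 i.
have ME x j : (x *m M) 0 j = dot (a (enum_val j)) x.
  by rewrite dot_mxE; congr dot; apply/rowP => i; rewrite !mxE.
have -> : #|I| = \rank M.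
  have [h hP] := choice (fun j : 'I_#|I| => free (fun i => (i == enum_val j)%:R)).
  apply/eqP; rewrite eqn_leq rank_leq_col andbT -[X in (X <= _)%N](mxrank1 R).
  suff -> : 1%:M = (\matrix_j h j) *m M by exact: mxrankM_maxr.
  apply/row_matrixP => j; rewrite row_mul rowK; apply/rowP => k'.
  by rewrite ME hP ?enum_valP // !mxE (inj_eq enum_val_inj) eq_sym.
apply: (affdim_solutions (x0 := y)); rewrite aff_hull_active //.
apply/seteqP; split=> z /= zI.
  apply/rowP => j; rewrite ME mxE dotBr zI; last exact: (fintype.subsetP Iy _ (enum_valP j)).
  by have := fintype.subsetP Iy _ (enum_valP j); rewrite inE => /eqP ->; rewrite subrr.
move=> i iy; have : dot (a i) (z - y) = 0.
  apply: span iy => l lI; rewrite -[l](enum_rankK_in lI lI) -ME zI mxE //.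
by rewrite dotBr; move: iy; rewrite inE => /eqP -> /eqP; rewrite subr_eq0 => /eqP.
Qed.

(** Nonempty faces correspond to active sets of points; the empty face has no [affdim] and is not
    counted. *)
Lemma poly_fnum_polyhedron (rk : {set J} -> nat) k :
  (forall y, polyhedron y -> exists I, [/\ I \subset active y, #|I| = rk (active y),
     forall w : J -> R, exists h, forall i, i \in I -> dot (a i) h = w i &
     forall h, (forall i, i \in I -> dot (a i) h = 0) ->
       forall i, i \in active y -> dot (a i) h = 0]) ->
  poly_fnum polyhedron k =
    #|[set I | `[< exists2 y, polyhedron y & active y = I >] && (k + rk I == n)%N]%SET|.
Proof.
move=> rkP; set A := finset _.
have AP I : reflect (exists y, [/\ polyhedron y, active y = I & (k + rk I = n)%N]) (I \in A).
  rewrite inE; apply: (iffP andP) => [[/asboolP[y Ny yI] /eqP kI]|[y [Ny yI kI]]].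
    by exists y.
  by split; [apply/asboolP; exists y|apply/eqP].
rewrite /poly_fnum; have -> : [set F | poly_face polyhedron F /\ affdim F k] = active_face @` [set` A].
  apply/seteqP; split=> [F [NF Fk]|_ [I /AP[y [Ny <- kI]] <-]]; last first.
    have [I0 [I0y I0E fI0 sI0]] := rkP y Ny.
    split; first exact: poly_face_active.
    by apply/(affdim_active _ Ny I0y fI0 sI0); rewrite I0E.
  have [y Ny FE] : exists2 y, polyhedron y & F = active_face (active y).
    apply: active_poly_face => //; apply/set0P/eqP => F0.
    case: Fk => x0 [B [_ BE]]; have : aff_hull F x0 by rewrite BE /= subrr sub0mx.
    by rewrite F0 => /(_ set0); apply; split=> // x y0 t [].
  have [I0 [I0y I0E fI0 sI0]] := rkP y Ny.
  exists (active y); last by [].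
  apply/AP; exists y; split=> //; rewrite -I0E.
  by apply/(affdim_active _ Ny I0y fI0 sI0); rewrite -FE.
rewrite fset_set_image; last exact: finite_finset.
rewrite finmap.card_in_imfset => [|I I' /=]; last first.
  rewrite !in_fset_set; [|exact: finite_finset..].
  by move=> /set_mem/AP[y [Ny <- _]] /set_mem/AP[z [Nz <- _]]; exact: active_face_inj.
rewrite [RHS]cardE; apply/perm_size/uniq_perm; rewrite ?finmap.fset_uniq ?enum_uniq // => I.
by rewrite mem_enum in_fset_set; [apply/idP/idP => [/set_mem|?]; last apply/mem_set|exact: finite_finset].
Qed.

End Polyhedron.

(** * The polytope nabla *)

(* The vertices of an [r]-fold pyramid over a square: the square vertices, then
   the apexes. *)
Definition pvertex (r : nat) := (bool * bool + 'I_r)%type.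

(** Facet functions of the pyramid: [inl (c, i)] is [1] on one side of the square and [0] on the
    opposite side and at the apexes; [inr k] is [1] at the [k]-th apex only. *)
Definition pfacet {R : realType} r (t v : pvertex r) : R :=
  match t, v with
  | inl (c, i), inl (u1, u2) => ((if c then u2 else u1) == i)%:R
  | inr k, inr l => (k == l)%:R
  | _, _ => 0
  end.

(** * Affine functions on the iterated pyramid *)

Section Balanced.
Context (R : realType) (r : nat).

Definition balanced (V : nmodType) (w : pvertex r -> V) : Prop :=
  w (inl (false, false)) + w (inl (true, true)) =
  w (inl (false, true)) + w (inl (true, false)).

Lemma balancedP (w : pvertex r -> R) : balanced w -> forall i j,
  w (inl (i, j)) + w (inl (~~ i, ~~ j)) = w (inl (~~ i, j)) + w (inl (i, ~~ j)).
Proof. by move=> wb [] [] /=; move: wb; rewrite /balanced; lra. Qed.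

Lemma pfacet_balanced t : balanced (@pfacet R r t).
Proof. by case: t => [[[] []]|k]; rewrite /balanced /= ?addr0 ?add0r. Qed.

Lemma pfacet_ge0 t v : 0 <= @pfacet R r t v.
Proof. by case: t v => [[[] i]|k] [[u1 u2]|l] //=; exact: ler0n. Qed.

End Balanced.

Section Frame.
Context (R : realType) (r n : nat).
Local Notation V := 'rV[R]_n.
Implicit Types (x : pvertex r -> V) (w : pvertex r -> R).

(* The vertices are affinely independent up to the parallelogram relation. *)
Definition frame x : Prop := balanced x /\
  forall w, balanced w -> exists g b, forall v, slack g b (x v) = w v.

Lemma slack_balanced x g b : balanced x -> balanced (fun v => slack g b (x v)).
Proof.
rewrite /balanced /slack => xb; have := congr1 (dot g) xb; rewrite !dotDr; lra.
Qed.

End Frame.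

Lemma square_frame (R : realType) n (T : set 'rV[R]_n) : is_square T ->
  exists x : pvertex 0 -> 'rV[R]_n, frame x /\ T = conv_hull (range x).
Proof.
move=> [a [u [v [u0 uv uv0 ->]]]].
have uu : dot u u != 0 by apply: contra u0 => /eqP /dot_eq0 ->.
pose x (t : pvertex 0) := if t is inl (i, j) then
  a + (if i then u else 0) + (if j then v else 0) else 0.
exists x; split.
  split; first by rewrite /balanced /x !addr0 !addrA addrAC (addrAC _ a v) addrAC.
  move=> w wb; pose al := (w (inl (false, false)) - w (inl (true, false))) / dot u u.
  pose be := (w (inl (false, false)) - w (inl (false, true))) / dot u u.
  pose g := al *: u + be *: v; exists g, (w (inl (false, false)) + dot g a).
  have gu : dot g u = w (inl (false, false)) - w (inl (true, false)).
    by rewrite /g dotDl !dotZl (dotC v) uv0 mulr0 addr0 divfK.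
  have gv : dot g v = w (inl (false, false)) - w (inl (false, true)).
    by rewrite /g dotDl !dotZl uv0 mulr0 add0r -uv divfK.
  case=> [[i j]|[]//]; rewrite /slack /x !dotDr; move: wb; rewrite /balanced.
  by case: i j => [] [] /=; rewrite ?gu ?gv ?dot0r; lra.
congr conv_hull; apply/seteqP; split=> [y|y [[[[] []]|[]//] _ <-]] /=; rewrite ?addr0.
- case=> [[[|]|]|] ->.
  + by exists (inl (false, false)); rewrite //= !addr0.
  + by exists (inl (true, false)); rewrite //= !addr0.
  + by exists (inl (false, true)); rewrite //= !addr0.
  + by exists (inl (true, true)).
- by right.
- by left; left; right.
- by left; right.
- by left; left; left.
Qed.

Lemma pyramid_frame (R : realType) n r (B T : set 'rV[R]_n) (x : pvertex r -> 'rV[R]_n) :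
  frame x -> B = conv_hull (range x) -> is_pyramid B T ->
  exists x' : pvertex r.+1 -> 'rV[R]_n, frame x' /\ T = conv_hull (range x').
Proof.
move=> [xb xf] -> [v]; rewrite aff_hull_conv => vB ->.
have [g0 [b0 [x0 v0]]] := affine_sep (inl (false, false)) vB.
pose x' (t : pvertex r.+1) := match t with inl u => x (inl u)
  | inr k => if unlift ord0 k is Some l then x (inr l) else v end.
exists x'; split.
  split=> // w wb.
  pose w' (t : pvertex r) := match t with inl u => w (inl u) | inr k => w (inr (lift ord0 k)) end.
  have [g [b gb]] := xf w' wb.
  pose c := w (inr ord0) - slack g b v.
  exists (g + c *: g0), (b + c * b0) => -[u|k]; rewrite slackD slackZ /x'.
    by rewrite x0 mulr0 addr0 gb.
  case: unliftP => [l ->|->]; first by rewrite x0 mulr0 addr0 gb.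
  by rewrite v0 mulr1 /c addrC subrK.
rewrite conv_hullU; congr conv_hull; apply/seteqP; split=> [y [[t _ <-]|->]|y [[u|k] _ <-]].
- by case: t => [u|k]; [exists (inl u)|exists (inr (lift ord0 k)); rewrite //= liftK].
- by exists (inr ord0); rewrite //= unlift_none.
- by left; exists (inl u).
- by rewrite /x'; case: unliftP => [l _|_]; [left; exists (inr l)|right].
Qed.

Lemma square_pyramid_frame (R : realType) n r (T : set 'rV[R]_n) : square_pyramid r T ->
  exists x : pvertex r -> 'rV[R]_n, frame x /\ T = conv_hull (range x).
Proof.
elim: r T => [|r IH] T /=; first exact: square_frame.
by move=> [B /IH[x [xf BE]] BT]; exact: pyramid_frame xf BE BT.
Qed.

Section FrameDirections.
Context (R : realType) (r : nat).

Lemma frame_row_free n (x : pvertex r -> 'rV[R]_n) m (e : 'I_m -> pvertex r) :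
  frame x -> injective e -> (forall i j, e i != inl (j, j)) ->
  row_free (\matrix_i (x (e i) - x (inl (false, false)))).
Proof.
move=> xf e_inj eN; set W := \matrix_i _.
(* A dual system: [1] at [e i], compensated at the corner [(true, true)] if [e i] is a corner, to
   balance the diagonals. *)
pose w i v : R := (v == e i)%:R +
  (if v == inl (true, true) then if e i is inl _ then 1 else 0 else 0).
have wb i : balanced (w i).
  have := eN i true; have := eN i false; rewrite /balanced /w.
  by case: (e i) => [[[] []]|k] //= _ _; rewrite ?eqE /=; lra.
have hE i : exists p : 'rV[R]_n * R, forall v, slack p.1 p.2 (x v) = w i v.
  by have [g1 [b1 gb]] := xf.2 _ (wb i); exists (g1, b1).
have [h hP] := choice hE.
have dotW f c i : dot f (row i W) = slack f c (x (inl (false, false))) - slack f c (x (e i)).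
  by rewrite rowK dotBr /slack; ring.
apply/row_freeP; exists (\matrix_j (- (h j).1))^T; apply/matrixP => i j; rewrite !mxE.
transitivity (- dot (h j).1 (row i W)).
  by rewrite -dotNl; apply: eq_bigr => k _; rewrite !mxE mulrC.
rewrite (dotW _ (h j).2) !hP /w (inj_eq e_inj) !(negbTE (eN _ _)) (eq_sym _ (e j)) (negbTE (eN _ _)) /=.
by rewrite !addr0 add0r opprK.
Qed.

(* All vertices but the two ends of a diagonal of the square. *)
Definition off_diagonal (i : 'I_(2 + r)) : pvertex r := match fintype.split i with
  inl o => inl (o == 0, o != 0) | inr k => inr k end.

Lemma off_diagonal_inj : injective off_diagonal.
Proof.
pose d (v : pvertex r) := match v with
  inl (i, _) => lshift r (if i then 0 else 1) | inr k => rshift 2 k end.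
apply: (can_inj (g := d)); rewrite /d => i.
rewrite /off_diagonal -[RHS]splitK; case: (fintype.split i) => [b2|k] //=; congr lshift.
by case: b2 => [[|[|//]] ?]; apply/val_inj.
Qed.

Lemma off_diagonalN i j : off_diagonal i != inl (j, j).
Proof.
by rewrite /off_diagonal; case: (fintype.split i) => [[[|[|//]] ?]|//]; case: j.
Qed.

Context (x : pvertex r -> 'rV[R]_r.+2).
Hypothesis xf : frame x.

Definition frame_mx : 'M[R]_r.+2 :=
  \matrix_(i < r.+2) (x (off_diagonal i) - x (inl (false, false))).

Lemma frame_mx_unit : frame_mx \in unitmx.
Proof.
by rewrite -row_free_unit; apply: frame_row_free => //; [exact: off_diagonal_inj|exact: off_diagonalN].
Qed.

Lemma frame_inj g b : (forall v, slack g b (x v) = 0) -> g = 0 /\ b = 0.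
Proof.
move=> g0; suff gE : g = 0.
  by split=> //; have := g0 (inl (false, false)); rewrite /slack gE dot0l subr0.
apply/trmx_inj/(can_inj (mulKmx frame_mx_unit)); rewrite trmx0 mulmx0.
apply/colP => i; transitivity (dot g (row i frame_mx)).
  by rewrite mxE; apply: eq_bigr => k _; rewrite !mxE mulrC.
rewrite rowK dotBr mxE; have := g0 (off_diagonal i); have := g0 (inl (false, false)).
rewrite /slack; lra.
Qed.

End FrameDirections.

Section FrameFacets.
Context (R : realType) (r : nat) (x : pvertex r -> 'rV[R]_r.+2).
Hypothesis xf : frame x.
Local Notation V := 'rV[R]_r.+2.
Local Notation T := (conv_hull (range x)).
Implicit Types (g : V) (v t : pvertex r).

Lemma frame_validP g b : valid_ineq T g b <-> forall v, 0 <= slack g b (x v).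
Proof.
split=> [/valid_ineqP gb v|gb]; first by apply: gb; exists v.
by apply/valid_ineqP => _ [v _ <-].
Qed.

(** The coefficients are the values at [p] of the dual affine functions; [tau] belongs to the slope
    across the square, away from the side with first coordinate [false]. *)
Lemma frame_coord (p : V) : exists (al be tau : R) (nu : 'I_r -> R), forall g b,
  slack g b p = al * slack g b (x (inl (false, false)))
    + be * slack g b (x (inl (false, true)))
    + tau * (slack g b (x (inl (true, false))) - slack g b (x (inl (false, false))))
    + \sum_k nu k * slack g b (x (inr k)).
Proof.
pose u al be ga (nu : 'I_r -> R) v : R := match v with
  | inl (i, j) => (if j then be else al) + (if i then ga else 0) | inr k => nu k end.
have ub al be ga nu : balanced (u al be ga nu) by rewrite /balanced /=; lra.
have [ga [ba aE]] := xf.2 _ (ub 1 0 0 (fun=> 0)).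
have [gb [bb bE]] := xf.2 _ (ub 0 1 0 (fun=> 0)).
have [gc [bc cE]] := xf.2 _ (ub 0 0 1 (fun=> 0)).
have hE k : exists p : V * R, forall v, slack p.1 p.2 (x v) = u 0 0 0 (fun l => (k == l)%:R) v.
  by have [h [c hc]] := xf.2 _ (ub 0 0 0 (fun l => (k == l)%:R)); exists (h, c).
have [h hP] := choice hE.
exists (slack ga ba p), (slack gb bb p), (slack gc bc p), (fun k => slack (h k).1 (h k).2 p).
move=> g b; set A := slack g b (x (inl (false, false))); set B := slack g b (x (inl (false, true))).
set C := slack g b (x (inl (true, false))).
pose g' := A *: ga + B *: gb + (C - A) *: gc + \sum_k slack g b (x (inr k)) *: (h k).1.
pose b' := A * ba + B * bb + (C - A) * bc + \sum_k slack g b (x (inr k)) * (h k).2.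
have E z : slack g' b' z = A * slack ga ba z + B * slack gb bb z + (C - A) * slack gc bc z
    + \sum_k slack g b (x (inr k)) * slack (h k).1 (h k).2 z.
  by rewrite !slackD !slackZ slack_sum; congr (_ + _); apply: eq_bigr => k _; rewrite slackZ.
have [] : g - g' = 0 /\ b - b' = 0.
  apply: (frame_inj xf) => v; rewrite slackB E aE bE cE.
  under eq_bigr => k _ do rewrite hP.
  case: v => [[i j]|k] /=.
    rewrite big1 => [|k _]; last by rewrite !if_same addr0 mulr0.
    have := slack_balanced g b xf.1; rewrite /balanced -/A -/B -/C => D.
    case: i j => [] [] /=; rewrite -?/A -?/B -?/C; lra.
  rewrite (bigD1 k) //= eqxx big1 => [|l lk]; [|by rewrite (negbTE lk) mulr0].
  by rewrite mulr1 !mulr0 !addr0 add0r subrr.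
move=> g0 b0; have /eqP : slack g b p - slack g' b' p = 0.
  by rewrite -slackB g0 b0 /slack dot0l subr0.
rewrite subr_eq0 => /eqP ->; rewrite E; congr (_ + _).
  by ring.
by apply: eq_bigr => k _; rewrite mulrC.
Qed.

(* A facet spans a hyperplane, so the functions vanishing on it are all
   proportional. *)
Lemma facet_rigid g b : valid_ineq T g b -> affdim (exposed T g b) r.+1 ->
  (exists v, slack g b (x v) != 0) /\
  forall g' b', (forall v, slack g b (x v) = 0 -> slack g' b' (x v) = 0) ->
    exists c, forall v, slack g' b' (x v) = c * slack g b (x v).
Proof.
move=> vg [x0 [B [/eqP fB BE]]].
have van g' b' : (forall v, slack g b (x v) = 0 -> slack g' b' (x v) = 0) ->
    slack g' b' x0 = 0 /\ (g' <= kermx B^T)%MS.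
  move=> g'0; have sub : aff_hull (exposed T g b) `<=` [set z | slack g' b' z = 0].
    apply: smallest_sub; first exact: slack0_affine.
    rewrite exposed_conv_hull //; apply: smallest_sub; first exact/affine_convex/slack0_affine.
    by move=> _ [[v _ <-] /= v0]; exact: g'0.
  have x00 : slack g' b' x0 = 0 by apply: sub; rewrite BE /= subrr sub0mx.
  split=> //; apply/sub_kermxP/rowP => i; rewrite [RHS]mxE dot_mxE -tr_row trmxK dotC.
  have : slack g' b' (x0 + row i B) = 0 by apply: sub; rewrite BE /= addrC addKr row_sub.
  rewrite /slack dotDr opprD addrA -/(slack g' b' x0) x00 add0r => /eqP.
  by rewrite oppr_eq0 => /eqP.
have k1 : \rank (kermx B^T) = 1 by rewrite mxrank_ker mxrank_tr fB subSnn.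
have [i ki] : exists i, row i (kermx B^T) != 0.
  apply/existsP; rewrite -negb_forall; apply/negP => /forallP k0.
  suff k0' : kermx B^T = 0 by rewrite k0' mxrank0 in k1.
  by apply/row_matrixP => i; rewrite (eqP (k0 i)) row0.
set g1 := row i (kermx B^T) in ki; pose b1 := dot g1 x0.
have kg1 : (kermx B^T <= g1)%MS.
  by rewrite -mxrank_leqif_sup ?row_sub // k1 rank_rV ki.
have mult g' b' : (forall v, slack g b (x v) = 0 -> slack g' b' (x v) = 0) ->
    exists c, forall z, slack g' b' z = c * slack g1 b1 z.
  move=> /van[x00 gk]; have /sub_rVP[c gE] := submx_trans gk kg1.
  exists c; move: x00; rewrite gE => x00 z; rewrite -slackZ; congr slack.
  by move: x00; rewrite /slack dotZl /b1 => /eqP; rewrite subr_eq0 => /eqP.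
have [c1 gE] : exists c, forall z, slack g b z = c * slack g1 b1 z by exact: mult.
have [v v0] : exists v, slack g b (x v) != 0.
  apply: contrapT => nv; have g0 v : slack g b (x v) = 0.
    by apply/eqP; apply: contra_notT nv => v0; exists v.
  have [] : g1 = 0 /\ b1 = 0; last by move=> g10; rewrite g10 eqxx in ki.
  apply: (frame_inj xf) => v.
  have : aff_hull (exposed T g b) (x v).
    apply: sub_aff_hull; rewrite exposedE; split; last exact: g0.
    by apply: sub_conv_hull; exists v.
  rewrite BE /= => /submxP[D vE]; rewrite -[x v](subrK x0) vE /slack dotDr -/b1.
  rewrite dot_mulmx -mulmxA -[B *m _]trmxK trmx_mul trmxK.
  by have /sub_kermxP -> := row_sub i (kermx B^T); rewrite trmx0 mulmx0 mxE add0r subrr.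
split; first by exists v.
move=> g' b' /mult[c cE]; exists (c / c1) => w; rewrite cE gE mulrA divfK //.
by apply: contra v0; rewrite gE => /eqP ->; rewrite mul0r.
Qed.

End FrameFacets.

Lemma neq_bool (a b : bool) : (a != b) = (a == ~~ b). Proof. by case: a b => [] []. Qed.

(** * Facets of the iterated pyramid *)

Section FacetTypes.
Context (R : realType) (r : nat) (x : pvertex r -> 'rV[R]_r.+2).
Hypothesis xf : frame x.
Local Notation V := 'rV[R]_r.+2.
Local Notation T := (conv_hull (range x)).
Implicit Types (g : V) (v t : pvertex r).

(** By [facet_rigid] only zeros have to be compared. An apex off the facet settles the type; for a
    corner off the facet, the parallelogram relation puts an adjacent corner off it as well. *)
Lemma facet_classification g b : valid_ineq T g b -> affdim (exposed T g b) r.+1 ->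
  exists t c, 0 < c /\ forall v, slack g b (x v) = c * pfacet t v.
Proof.
move=> vg /(facet_rigid xf vg)[[v v0] rigid]; have /(frame_validP x) g0 := vg.
have gt0 u : slack g b (x u) != 0 -> 0 < slack g b (x u) by move=> u0; rewrite lt_neqAle eq_sym u0 g0.
have key t : (forall u, slack g b (x u) = 0 -> pfacet t u = 0 :> R) ->
    pfacet t v = 1 :> R -> exists t c, 0 < c /\ forall u, slack g b (x u) = c * pfacet t u.
  move=> tz tv; have [h [d hd]] := xf.2 _ (pfacet_balanced R t).
  have [|c cE] := rigid h d; first by move=> u /tz; rewrite hd.
  have {}cE u : pfacet t u = c * slack g b (x u) by rewrite -hd.
  have c0 : c != 0.
    by apply/eqP => c0; have := cE v; rewrite tv c0 mul0r => /eqP; rewrite oner_eq0.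
  exists t, c^-1; split=> [|u]; last by rewrite cE mulKf.
  rewrite invr_gt0; have := cE v; rewrite tv => cv.
  by rewrite -(pmulr_lgt0 _ (gt0 v v0)) -cv.
case: v v0 key => [[i j]|k] v0 key; last first.
  apply: (key (inr k)); last by rewrite /= eqxx.
  case=> [//|l] /= l0; case: eqP => // kl; by move: v0; rewrite kl l0 eqxx.
have := balancedP (slack_balanced g b xf.1) i j.
have := gt0 _ v0; have := g0 (inl (~~ i, ~~ j)); have := g0 (inl (~~ i, j)); have := g0 (inl (i, ~~ j)).
have [ij|ij] := eqVneq (slack g b (x (inl (i, ~~ j)))) 0 => p1 p2 p3 p4 p5.
  apply: (key (inl (true, j))); last by rewrite /= eqxx.
  case=> [[u1 u2]|//] /=; case: eqP => // -> u0; exfalso.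
  by case: (u1 =P i) u0 => [->|/eqP]; [|case: (u1) (i) p3 p4 p5 ij => [] []]; lra.
apply: (key (inl (false, i))); last by rewrite /= eqxx.
case=> [[u1 u2]|//] /=; case: eqP => // -> u0; exfalso.
move/eqP: v0 => v0; move/eqP: ij => ij.
by case: (u2) (j) v0 ij u0 => [] [].
Qed.

Lemma pfacet_rigid (t : pvertex r) (w : pvertex r -> R) : balanced w ->
  (forall v, pfacet t v = 0 :> R -> w v = 0) -> exists c, forall v, w v = c * pfacet t v.
Proof.
move=> wb wt; case: t wt => [[c i]|k] wt; last first.
  exists (w (inr k)) => v; have [v0|v0] := eqVneq (pfacet (inr k) v) (0 : R).
    by rewrite v0 mulr0 wt.
  case: v v0 => [u|l] /=; first by rewrite eqxx.
  by rewrite pnatr_eq0 eqb0 negbK => /eqP ->; rewrite eqxx mulr1.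
exists (w (inl (i, i))) => v; have [v0|v0] := eqVneq (pfacet (inl (c, i)) v) (0 : R).
  by rewrite v0 mulr0 wt.
case: v v0 => [[u1 u2]|l] /=; last by rewrite eqxx.
rewrite pnatr_eq0 eqb0 negbK => ci; rewrite ci mulr1.
have := balancedP wb i i.
have ni : (~~ i == i) = false by case: (i).
have := wt (inl (~~ i, ~~ i)); rewrite /= if_same ni => -> //.
move: ci; case: c wt => wt /eqP ->.
  have := wt (inl (i, ~~ i)); rewrite /= ni => -> //.
  by case: (u1 =P i) => [->//|/eqP]; rewrite neq_bool => /eqP ->; lra.
have := wt (inl (~~ i, i)); rewrite /= ni => -> //.
by case: (u2 =P i) => [->//|/eqP]; rewrite neq_bool => /eqP ->; lra.
Qed.

Lemma pfacet_zero (t : pvertex r) : exists v, pfacet t v = 0 :> R.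
Proof.
case: t => [[c i]|k]; last by exists (inl (true, true)).
by exists (inl (~~ i, ~~ i)); case: c i => [] [].
Qed.

Lemma pfacet_slack t : exists g b,
  [/\ forall v, slack g b (x v) = pfacet t v, valid_ineq T g b & is_facet T (exposed T g b)].
Proof.
have [g [b gb]] := xf.2 _ (pfacet_balanced R t).
have vg : valid_ineq T g b by apply/(frame_validP x) => v; rewrite gb pfacet_ge0.
exists g, b; split=> //; split; first by exists g, b.
have [v0 v0E] := pfacet_zero t.
have g0 : g != 0.
  apply/eqP => g0; have [v v1] : exists v, pfacet t v = 1 :> R.
    by case: t {gb v0E} => [[c i]|k]; [exists (inl (i, i)); case: c => /=|exists (inr k)]; rewrite /= eqxx.
  have := gb v; have := gb v0; rewrite v0E v1 g0 /slack !dot0l; lra.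
apply/(affdim_solutions (M := g^T) (x0 := x v0)); last first.
  by rewrite mxrank_tr rank_rV g0 /= addn1.
rewrite exposed_conv_hull // aff_hull_conv.
transitivity [set z | slack g b z = 0]; last first.
  apply/seteqP; split=> z /=.
    move=> z0; apply/rowP => j; rewrite (ord1 j) -dot_mulmx dotBr !mxE.
    by move: z0; have := gb v0; rewrite v0E /slack; lra.
  move=> /(congr1 (fun A : 'M[R]_1 => A 0 0)); rewrite -dot_mulmx dotBr mxE.
  by have := gb v0; rewrite v0E /slack; lra.
apply/seteqP; split; first by apply: smallest_sub; [exact: slack0_affine|move=> z []].
move=> z z0; apply: contrapT => zA.
(* Vertices off the facet are replaced by [v0], so that [affine_sep] applies to a family with the
   same index type. *)
pose y v := if pfacet t v == 0 :> R then x v else x v0.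
have yE : range y = range x `&` [set z | slack g b z = 0].
  apply/seteqP; split=> [_ [v _ <-]|_ [[v _ <-] v1]].
    by rewrite /y; case: eqP => vE; split; rewrite /= ?gb //; [exists v|exists v0].
  by exists v => //; rewrite /y; move: v1; rewrite /= gb => ->; rewrite eqxx.
rewrite -yE in zA; have [g' [b' [y0 z1]]] := affine_sep v0 zA.
have [|c cE] := @pfacet_rigid t (fun v => slack g' b' (x v)) (slack_balanced g' b' xf.1).
  by move=> v v1; have := y0 v; rewrite /y v1 eqxx.
have [|g1 b1] := @frame_inj _ _ _ xf (g' - c *: g) (b' - c * b).
  by move=> v; rewrite slackB slackZ gb cE subrr.
have : slack (g' - c *: g) (b' - c * b) z = 0 by rewrite g1 b1 /slack dot0l subr0.
rewrite slackB slackZ z0 z1 mulr0 subr0 => /eqP; by rewrite oner_eq0.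
Qed.

(** This function is nonnegative and vanishes at a single vertex, so it exposes the corner. *)
Lemma corner_slack i j : exists g b, forall v, slack g b (x v) =
  match v with inl (u1, u2) => (u1 != i)%:R + (u2 != j)%:R | inr _ => 1 end.
Proof. by apply: xf.2; rewrite /balanced; case: i j => [] [] /=; lra. Qed.

Lemma square_inj : injective (fun u : bool * bool => x (inl u)).
Proof.
move=> [i1 i2] [j1 j2] ij; have [g [b gb]] := corner_slack j1 j2.
have := gb (inl (i1, i2)); rewrite [x _]ij gb !eqxx /= addr0 => /esym/eqP.
by rewrite paddr_eq0 ?ler0n // !pnatr_eq0 !eqb0 !negbK => /andP[/eqP -> /eqP ->].
Qed.

(* The square is part of any facet opposite to an apex, but no parallelogram
   has its four corners among the vertices of a simplex. *)
Lemma simplex_not_apex g b k : (forall v, slack g b (x v) = pfacet (inr k) v) ->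
  ~ is_simplex (exposed T g b) r.+1.
Proof.
move=> gb [x0 [B [fB FE]]]; set A := _ `|` _ in FE.
have vg : valid_ineq T g b by apply/(frame_validP x) => v; rewrite gb pfacet_ge0.
have corner u : x (inl u) = x0 \/ exists l, x (inl u) = x0 + row l B.
  case: u => i j; have [h [c hc]] := corner_slack i j.
  have vh : valid_ineq T h c.
    by apply/(frame_validP x) => v; rewrite hc; case: v => [[]|] *; rewrite ?addr_ge0 ?ler0n.
  have hE : exposed T h c = [set x (inl (i, j))].
    rewrite exposed_conv_hull // -[RHS]conv_hull1; congr conv_hull.
    apply/seteqP; split=> [_ [[v _ <-]]|_ ->] /=; rewrite ?hc; last first.
      by split; [exists (inl (i, j))|rewrite /= !eqxx addr0].
    case: v => [[u1 u2]|l] /=; last by move/eqP; rewrite oner_eq0.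
    move/eqP; rewrite paddr_eq0 ?ler0n // !pnatr_eq0 !eqb0 !negbK.
    by move=> /andP[/eqP -> /eqP ->].
  have : exposed (exposed T g b) h c (x (inl (i, j))).
    rewrite exposedE; split; last by rewrite /= hc !eqxx addr0.
    by rewrite exposedE; split; [apply: sub_conv_hull; exists (inl (i, j))|rewrite /= gb].
  rewrite {1}FE exposed_conv_hull => [H|]; last by rewrite -FE => z [Tz _]; exact: vh.
  have [y [Ay y0]] : (A `&` [set z | slack h c z = 0]) !=set0.
    by apply/set0P/eqP => A0; move: H; rewrite A0 => /(_ set0); apply; split=> // ? ? ? /set_mem.
  have yE : y = x (inl (i, j)).
    suff : exposed T h c y by rewrite hE.
    rewrite exposedE; split=> //; have : exposed T g b y by rewrite FE; exact: sub_conv_hull.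
    by case.
  by case: Ay; [left; rewrite -yE|case=> l _ lE; right; exists l; rewrite lE].
(* Barycentric coordinates of the simplex. A corner other than [x0] has a coordinate equal to [1]
   that vanishes at the other corners, against balance; so both ends of a diagonal would be [x0]. *)
pose f l z := ((z - x0) *m pinvmx B) 0 l.
have fB1 l l' : f l (x0 + row l' B) = (l' == l)%:R.
  by rewrite /f addrC addKr -row_mul mulmxVp // !mxE.
have fE l : f l (x0 + row l B) = 1 by rewrite fB1 eqxx.
have f0 l u : x (inl u) != x0 + row l B -> f l (x (inl u)) = 0.
  case: (corner u) => [->|[l' ->]] ul; first by rewrite /f subrr mul0mx mxE.
  by rewrite fB1; case: eqP => // ll; move: ul; rewrite ll eqxx.
have fb l : f l (x (inl (false, false))) + f l (x (inl (true, true))) =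
    f l (x (inl (false, true))) + f l (x (inl (true, false))).
  have fD y z : f l y + f l z = ((y - x0 + (z - x0)) *m pinvmx B) 0 l.
    by rewrite mulmxDl [RHS]mxE.
  by rewrite !fD addrACA xf.1 addrACA.
have last l u : x (inl u) = x0 + row l B -> forall u', u' != u -> f l (x (inl u')) = 0.
  move=> ul u' uu'; apply: f0; rewrite -ul; apply: contra uu' => /eqP uE.
  by apply/eqP/square_inj.
have [E0|[l lE]] := corner (false, false); last first.
  by have := fb l; rewrite lE fE !(last _ _ lE) //; lra.
have [E1|[l lE]] := corner (true, true); last first.
  by have := fb l; rewrite lE fE !(last _ _ lE) //; lra.
by have := @square_inj (false, false) (true, true); rewrite E0 E1 => /(_ erefl).
Qed.

End FacetTypes.

(** * Symmetries of the square and the normal form of stacking *)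

Section Relabel.
Context (r : nat).

Definition relabel (c i : bool) (v : pvertex r) : pvertex r := match v with
  | inl (u1, u2) => inl (if c then (u2, u1 == i) else (u1 == i, u2))
  | inr k => inr k end.

Definition unrelabel (c i : bool) (v : pvertex r) : pvertex r := match v with
  | inl (u1, u2) => inl (if c then (u2 == i, u1) else (u1 == i, u2))
  | inr k => inr k end.

Lemma relabelK c i : cancel (relabel c i) (unrelabel c i).
Proof. by case=> [[[] []]|k]; case: c i => [] []. Qed.

Lemma unrelabelK c i : cancel (unrelabel c i) (relabel c i).
Proof. by case=> [[[] []]|k]; case: c i => [] []. Qed.

Lemma pfacet_relabel (R : realType) c i v :
  pfacet (inl (c, i)) (relabel c i v) = pfacet (inl (false, true)) v :> R.
Proof. by case: v => [[[] []]|k]; case: c i => [] []. Qed.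

Lemma relabel_frame (R : realType) n (x : pvertex r -> 'rV[R]_n) c i : frame x ->
  frame (x \o relabel c i) /\ range (x \o relabel c i) = range x.
Proof.
move=> [xb xf]; split; last first.
  apply/seteqP; split=> _ [v _ <-]; first by exists (relabel c i v).
  by exists (unrelabel c i v); rewrite //= unrelabelK.
split=> [|w wb].
  move: xb; rewrite /balanced /=; case: c i => [] [] /= E.
  - by rewrite E addrC.
  - by rewrite -[RHS]addrC E addrC.
  - by [].
  - by rewrite -[RHS]addrC E addrC.
have [g [b gb]] : exists g b, forall v, slack g b (x v) = w (unrelabel c i v).
  by apply: xf; move: wb; rewrite /balanced; case: c i => [] [] /=; lra.
by exists g, b => v; rewrite gb relabelK.
Qed.

End Relabel.

Lemma interior_step (R : realType) n (S : set 'rV[R]_n) c w : S° c ->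
  exists2 e, 0 < e & S (c + e *: w).
Proof.
move=> /nbhs_ballP[e /= e0 eS]; exists (e / 2 / (`|w| + 1)).
  by rewrite !divr_gt0 // ltr_wpDl.
apply: eS; rewrite -ball_normE /= opprD addNKr normrN normrZ gtr0_norm; last first.
  by rewrite !divr_gt0 // ltr_wpDl.
have w1 : 0 < `|w| + 1 by rewrite ltr_wpDl.
rewrite mulrAC ltr_pdivrMr // (le_lt_trans (_ : _ <= e / 2 * (`|w| + 1))) //.
  by rewrite ler_pM2l ?divr_gt0 // lerDl.
by rewrite ltr_pM2r // ltr_pdivrMr // ltr_pMr // ltrDl.
Qed.

(** At an interior zero, a small step along [g] would make the slack negative unless [g = 0]. *)
Lemma slack_interior (R : realType) n (S : set 'rV[R]_n) g b c : S° c ->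
  (forall z, S z -> 0 <= slack g b z) -> (exists2 z, S z & slack g b z != 0) ->
  0 < slack g b c.
Proof.
move=> Sc S0 [z Sz z0]; rewrite lt_neqAle S0 ?andbT; last exact: interior_subset Sc.
apply: contra z0 => /eqP c0; have [e e0 /S0] := interior_step g Sc.
rewrite {1}/slack dotDr dotZr opprD addrA -/(slack g b c) -c0 add0r oppr_ge0.
rewrite pmulr_rle0 // => g0; have g00 : g = 0.
  by apply/dot_eq0/eqP; rewrite eq_le g0 dot_ge0.
by move: c0; rewrite g00 /slack !dot0l => <-.
Qed.

Section Structure.
Context (R : realType) (r : nat).

Lemma exposed_pfacet (x : pvertex r -> 'rV[R]_r.+2) g b (t : pvertex r) k : 0 < k ->
  (forall v, slack g b (x v) = k * pfacet t v) ->
  exposed (conv_hull (range x)) g b = conv_hull (x @` [set v | pfacet t v = 0 :> R]).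
Proof.
move=> k0 gb; rewrite exposed_conv_hull; last first.
  by apply/(frame_validP x) => v; rewrite gb mulr_ge0 ?pfacet_ge0 // ltW.
congr conv_hull; apply/seteqP; split=> [_ [[v _ <-]]|_ [v v0' <-]] /=.
  by rewrite gb => /eqP; rewrite mulf_eq0 gt_eqF //= => /eqP vt; exists v.
by split; [exists v|rewrite /= gb v0' mulr0].
Qed.

(** The stacked facet is a simplex, hence lies over a side of the square, and a symmetry moves it to
    [inl (false, true)]. The signs are those of the facet functions at [p]: the one of the stacked
    facet equals [tau] and is violated, the others isolate [al], [be] and the [nu k]. *)
Lemma nabla_structure (N : set 'rV[R]_r.+2) : is_nabla N ->
  exists (x : pvertex r -> 'rV[R]_r.+2) (p c : 'rV[R]_r.+2) (al be tau : R) (nu : 'I_r -> R),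
  [/\ frame x,
    forall g b, slack g b p = al * slack g b (x (inl (false, false)))
      + be * slack g b (x (inl (false, true)))
      + tau * (slack g b (x (inl (true, false))) - slack g b (x (inl (false, false))))
      + \sum_k nu k * slack g b (x (inr k)),
    [/\ 0 < al, 0 < be, tau < 0 & forall k, 0 < nu k],
    (conv_hull (range x `|` [set p]))° c & N = polar c (conv_hull (range x `|` [set p]))].
Proof.
move=> [T [F [S [c [sT [[[g0 [b0 [v0 FE]] dF]] sF] [p SE st] cS ->]]]]].
rewrite subn2 /= in sT dF sF.
have [x [xf TE]] := square_pyramid_frame sT.
have [t [k [k0 gt]]] : exists t k, 0 < k /\ forall v, slack g0 b0 (x v) = k * pfacet t v.
  by apply: facet_classification => //; rewrite -TE -?FE.
have {}FE : F = conv_hull (x @` [set v | pfacet t v = 0 :> R]).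
  by rewrite FE; rewrite TE; apply: exposed_pfacet gt.
case: t {gt} FE => [[cc i]|l] FE; last first.
  have [g [b [gb _ _]]] := pfacet_slack xf (inr l).
  case: (simplex_not_apex xf gb); rewrite (exposed_pfacet (x := x) (t := inr l) (k := 1)) ?ltr01 -?FE //.
  by move=> v; rewrite gb mul1r.
have [yf yE] := relabel_frame cc i xf; set y := _ \o _ in yf yE.
rewrite -yE in TE.
have {}FE : F = conv_hull (y @` [set v | pfacet (inl (false, true)) v = 0 :> R]).
  rewrite FE; congr conv_hull; apply/seteqP; split=> _ [v v1 <-].
    exists (unrelabel cc i v); last by rewrite /y /= unrelabelK.
    by rewrite /mkset -(pfacet_relabel R cc i) unrelabelK.
  by exists (relabel cc i v) => //; rewrite /mkset pfacet_relabel.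
have [al [be [tau [nu pE]]]] := frame_coord yf p.
have pos u v : pfacet (inl (false, true)) v = 0 :> R -> pfacet u v = 1 :> R ->
    exists g b, (forall v, slack g b (y v) = pfacet u v) /\ 0 < slack g b p.
  move=> v1 u1; have [g [b [gb vg fg]]] := pfacet_slack yf u; rewrite -TE in vg fg.
  exists g, b; split=> //; rewrite subr_gt0; apply: (st g b vg fg).2 => gF.
  have : F (y v) by rewrite FE; apply: sub_conv_hull; exists v.
  rewrite -gF exposedE => -[_ /=]; rewrite gb u1 => /eqP; by rewrite oner_eq0.
exists y, p, c, al, be, tau, nu; split=> //; last 2 first.
- by rewrite -conv_hullU -TE -SE.
- by rewrite -conv_hullU -TE -SE.
split.
- have [|//|g [b [gb]]] := pos (inl (true, false)) (inl (false, false)); first by [].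
  rewrite pE !gb /= big1 => [|l _]; [lra|by rewrite gb mulr0].
- have [|//|g [b [gb]]] := pos (inl (true, true)) (inl (false, true)); first by [].
  rewrite pE !gb /= big1 => [|l _]; [lra|by rewrite gb mulr0].
- have [g [b [gb vg fg]]] := pfacet_slack yf (inl (false, true)); rewrite -TE in vg fg.
  have : slack g b p < 0.
    rewrite subr_lt0; apply: (st g b vg fg).1; rewrite FE.
    by rewrite TE; apply: (exposed_pfacet (k := 1)) => // v; rewrite gb mul1r.
  rewrite pE !gb /= big1 => [|l _]; [lra|by rewrite gb mulr0].
move=> l; have [//||g [b [gb]]] := pos (inr l) (inr l); first by rewrite /= eqxx.
rewrite pE !gb /= (bigD1 l) //= big1 => [|l' ll]; first by rewrite gb /= eqxx mulr1; lra.
by rewrite gb /= eq_sym (negbTE ll) mulr0.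
Qed.

End Structure.

(** * Counting zero patterns *)

Section ZeroPatterns.
Local Open Scope nat_scope.
Context (r : nat).
Implicit Type Z : {set pvertex r + unit}.

Definition sq i j : pvertex r + unit := inl (inl (i, j)).

(* The possible zero sets of a nonzero affine function that is nonnegative on
   the vertices; [inr tt] is the stacking apex, beyond the facet through
   [sq false false] and [sq false true]. *)
Definition zero_pattern Z : bool :=
  [&& ~~ [&& sq false false \in Z, sq false true \in Z & [forall k, inl (inr k) \in Z]],
    ((sq false false \in Z) && (sq true true \in Z)) ==
      ((sq false true \in Z) && (sq true false \in Z)) &
    (inr tt \in Z) ==> (sq true false \notin Z) && (sq true true \notin Z)].

Definition pattern_basis Z : {set pvertex r + unit} :=
  if [forall u : bool * bool, inl (inl u) \in Z] then Z :\ sq true true else Z.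

Definition decode (b : bool * (bool * (bool * (bool * (bool * {set 'I_r}))))) :
    {set pvertex r + unit} :=
  let: (b00, (b01, (b10, (b11, (w, K))))) := b in
  [set i | match i with
    | inl (inl (i, j)) => if i then (if j then b11 else b10) else (if j then b01 else b00)
    | inl (inr k) => k \in K
    | inr _ => w end]%SET.

Lemma decode_bij : bijective decode.
Proof.
exists (fun Z => (sq false false \in Z, (sq false true \in Z, (sq true false \in Z,
  (sq true true \in Z, (inr tt \in Z, [set k | inl (inr k) \in Z]%SET)))))).
  move=> [b00 [b01 [b10 [b11 [w K]]]]] /=; rewrite !inE; do 5 congr (_, _).
  by apply/setP => k; rewrite !inE.
move=> Z; apply/setP => -[[[[] []]|k]|[]]; by rewrite !inE.
Qed.

Lemma card_decode b00 b01 b10 b11 w K :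
  #|decode (b00, (b01, (b10, (b11, (w, K)))))| = (b00 + b01 + b10 + b11 + w + #|K|)%N.
Proof.
have sum2 (F : bool * bool -> nat) : (\sum_u F u =
    F (true, true) + F (true, false) + (F (false, true) + F (false, false)))%N.
  transitivity (\sum_i \sum_j F (i, j))%N.
    by rewrite pair_bigA; apply: eq_bigr => -[].
  by rewrite !big_bool.
rewrite -sum1_card big_mkcond big_sumType /= big_sumType /= sum2.
under [X in (_ + X + _)%N]eq_bigr => k _ do rewrite inE.
rewrite -big_mkcond /= sum1_card !inE (big_pred1 tt) => [|[]//].
rewrite inE; set c := #|_|; have -> : c = #|K| by exact: eq_card.
by move: #|K| => m; case: b00 b01 b10 b11 w => [] [] [] [] []; lia.
Qed.

Lemma zero_pattern_decode b00 b01 b10 b11 w K :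
  zero_pattern (decode (b00, (b01, (b10, (b11, (w, K)))))) =
  [&& ~~ [&& b00, b01 & K == [set: 'I_r]%SET], (b00 && b11) == (b01 && b10) & w ==> ~~ b10 && ~~ b11].
Proof.
rewrite /zero_pattern !inE /=; congr (~~ (_ && (_ && _)) && _).
apply/forallP/eqP => [H|-> k]; last by rewrite !inE.
by apply/setP => k; have := H k; rewrite !inE.
Qed.

Lemma card_pattern_basis_decode b00 b01 b10 b11 w K :
  #|pattern_basis (decode (b00, (b01, (b10, (b11, (w, K))))))| =
  (b00 + b01 + b10 + [&& b11 & ~~ [&& b00, b01 & b10]] + w + #|K|)%N.
Proof.
rewrite /pattern_basis; set Z := decode _.
have -> : [forall u : bool * bool, inl (inl u) \in Z] = [&& b00, b01, b10 & b11].
  apply/forallP/and4P => [H|[? ? ? ?] [[] []]]; rewrite ?inE //.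
  by have := (H (false, false), H (false, true), H (true, false), H (true, true)); rewrite !inE => -[[[]]].
case: ifP => full; last first.
  rewrite card_decode; congr (_ + _ + _)%N.
  by move: full; case: b00 b01 b10 b11 {Z} => [] [] [] [].
have := cardsD1 (sq true true) Z; rewrite card_decode inE /=.
by case/and4P: full => -> -> -> -> /=; move: #|K| #|Z :\ _|%SET => m c; lia.
Qed.

(** The number of choices of pyramid apexes once the square and the stacking apex contribute [e]
    independent zeros. *)
Definition layer k e : nat := #|[pred K : {set 'I_r} | k + (e + #|K|) == r.+2]|.

Lemma layerE k e : layer k e = if (2 <= k + e)%N then 'C(r, k + e - 2) else 0%N.
Proof.
have card_le (K : {set 'I_r}) : (#|K| <= r)%N by rewrite -[X in (_ <= X)%N]card_ord max_card.
rewrite /layer; have [ke|ke] := leqP 2 (k + e); last first.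
  by apply: eq_card0 => K; rewrite !inE; have := card_le K; move: #|K| => n; lia.
have [ker|ker] := leqP (k + e - 2) r.
  rewrite -bin_sub //; have := card_draws 'I_r (r - (k + e - 2)); rewrite card_ord => <-.
  by apply: eq_card => K; rewrite !inE; move: #|K| => n; apply/eqP/eqP; lia.
by rewrite bin_small //; apply: eq_card0 => K; rewrite !inE; have := card_le K; move: #|K| => n; lia.
Qed.

Lemma layer_proper k e :
  (#|[pred K : {set 'I_r} | (K != [set: 'I_r]%SET) && (k + (e + #|K|) == r.+2)]| +
   (k + e == 2) = layer k e)%N.
Proof.
rewrite [RHS](cardD1 [set: 'I_r]%SET) inE cardsT card_ord addnC; congr (_ + _)%N.
  by congr nat_of_bool; lia.
Qed.

(** Five zeros can occur singly. Pairs are the four sides of the square, or the stacking apex with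
    one of the two near corners. Rank three arises from the near side with the stacking apex and
    from the full square. The term [k == 0] is the facet buried by stacking. *)
Lemma card_zero_patterns k :
  (#|[set Z | zero_pattern Z && (k + #|pattern_basis Z| == r.+2)]%SET| + (k == 0) =
   layer k 0 + 5 * layer k 1 + 6 * layer k 2 + 2 * layer k 3)%N.
Proof.
have boolX (B : finType) (P : pred (bool * B)) :
    #|P| = (#|[pred y | P (false, y)]| + #|[pred y | P (true, y)]|)%N.
  rewrite -!sum1_card; transitivity (\sum_i \sum_(j | P (i, j)) 1)%N.
    by rewrite pair_big_dep; apply: eq_bigl => -[].
  by rewrite big_bool addnC.
rewrite -(on_card_preimset (f := decode)); last exact/onW_bij/decode_bij.
rewrite !boolX.
pose lay b (n : nat) := if b is true then
  #|[pred K : {set 'I_r} | (K != [set: 'I_r]%SET) && (k + (n + #|K|) == r.+2)%N]| else layer k n.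
have termE b00 b01 b10 b11 w :
    #|[pred K | (b00, (b01, (b10, (b11, (w, K))))) \in decode @^-1:
      [set Z | zero_pattern Z && (k + #|pattern_basis Z| == r.+2)%N]%SET]| =
    if ((b00 && b11) == (b01 && b10)) && (w ==> ~~ b10 && ~~ b11) then
      lay (b00 && b01) (b00 + b01 + b10 + [&& b11 & ~~ [&& b00, b01 & b10]] + w)%N else 0%N.
  case: ifP => c; last first.
    by apply: eq_card0 => K; rewrite !inE zero_pattern_decode c andbF.
  rewrite /lay /layer; case: ifP => b; apply: eq_card => K;
    by rewrite !inE zero_pattern_decode card_pattern_basis_decode c andbT (andbA b00) b.
rewrite !termE /= /lay !addn0 !add0n !addn1.
have := layer_proper k 2; set a2 := #|_|; have := layer_proper k 3; set a3 := #|_|.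
by rewrite -/a2 -/a3; lia.
Qed.

Definition pattern_count k : nat :=
  #|[set Z | zero_pattern Z && (k + #|pattern_basis Z| == r.+2)]%SET|.

Lemma pattern_count0 : pattern_count 0 = 2 * r.+2 + 1.
Proof.
have := card_zero_patterns 0; rewrite -/(pattern_count 0) !layerE /= bin0 bin1; lia.
Qed.

Lemma pattern_countS k :
  pattern_count k.+1 = 'C(r.+2 + 1, k.+2) + 'C(r.+2, k.+2) + 'C(r.+1, k.+1).
Proof.
rewrite -[LHS]addn0; etransitivity; first exact: card_zero_patterns.
rewrite !layerE.
rewrite addn1 !addnS !ltnS !addn0 leq0n !subSS !subn0.
case: k => [|k]; rewrite !binS ?bin0 ?bin1 ?subn0; rewrite ?subn1 /=; lia.
Qed.

End ZeroPatterns.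

(** * Faces of the polar body *)

Section PolarFaces.
Context (R : realType) (r : nat) (x : pvertex r -> 'rV[R]_r.+2) (p c : 'rV[R]_r.+2).
Context (al be tau : R) (nu : 'I_r -> R).
Hypothesis xf : frame x.

Definition apex_value (w : pvertex r -> R) : R :=
  al * w (inl (false, false)) + be * w (inl (false, true))
    + tau * (w (inl (true, false)) - w (inl (false, false)))
    + \sum_k nu k * w (inr k).

Hypothesis pE : forall g b, slack g b p = apex_value (fun v => slack g b (x v)).
Hypotheses (al0 : 0 < al) (be0 : 0 < be) (tau0 : tau < 0) (nu0 : forall k, 0 < nu k).
Local Notation S := (conv_hull (range x `|` [set p])).
Hypothesis cS : S° c.
Local Notation V := 'rV[R]_r.+2.
Local Notation J := (pvertex r + unit)%type.
Implicit Types (g y h : V) (Z : {set J}).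

Definition stack_vertex (i : J) : V := if i is inl v then x v else p.
Local Notation pt := stack_vertex.
Local Notation P := (polyhedron (fun i => pt i - c)).
Local Notation act := (active (fun i => pt i - c)).

Lemma stack_vertexE : range x `|` [set p] = range pt.
Proof.
apply/seteqP; split=> [_ [[v _ <-]|->]|_ [[v|[]] _ <-]].
- by exists (inl v).
- by exists (inr tt).
- by left; exists v.
- by right.
Qed.

Lemma polar_slack y z : slack y (1 + dot c y) z = 1 - dot (z - c) y.
Proof. rewrite /slack dotBl (dotC y z); ring. Qed.

Lemma polar_polyhedron : polar c S = P.
Proof.
apply/seteqP; split=> y Sy.
  by move=> i; apply: Sy; apply: sub_conv_hull; rewrite stack_vertexE; exists i.
have /valid_ineqP : forall z, (range pt) z -> 0 <= slack y (1 + dot c y) z.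
  by move=> _ [i _ <-]; rewrite polar_slack subr_ge0; exact: Sy.
by rewrite -stack_vertexE => H z /H; rewrite dotBl (dotC z) lerBlDr.
Qed.

Lemma in_act y i : (i \in act y) = (slack y (1 + dot c y) (pt i) == 0).
Proof. by rewrite inE polar_slack subr_eq0 eq_sym. Qed.

Definition pattern_value (w : pvertex r -> R) (i : J) : R :=
  if i is inl v then w v else apex_value w.

Lemma pt_value g b i : slack g b (pt i) = pattern_value (fun v => slack g b (x v)) i.
Proof. by case: i. Qed.

(** Conversely, [w] extends to an affine function that is positive at the interior point [c];
    dividing by its value there gives [y]. *)
Lemma active_iff Z : (exists2 y, P y & act y = Z) <->
  exists w, [/\ balanced w, forall i, 0 <= pattern_value w i, exists v, w v != 0 &
    forall i, (i \in Z) = (pattern_value w i == 0)].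
Proof.
split=> [[y Py <-]|[w [wb w0 [v v0] wZ]]].
  exists (fun v => slack y (1 + dot c y) (x v)); split.
  - exact: slack_balanced xf.1.
  - by move=> i; rewrite -pt_value polar_slack subr_ge0; exact: Py.
  - apply: contrapT => H; have [y0] : y = 0 /\ 1 + dot c y = 0.
      by apply: (frame_inj xf) => v; apply/eqP; apply: contra_notT H => v0; exists v.
    by rewrite y0 dot0r addr0 => /eqP; rewrite oner_eq0.
  - by move=> i; rewrite in_act pt_value.
have [g [b gb]] := xf.2 _ wb.
have gbE : (fun v => slack g b (x v)) = w by apply/funext.
have ptE i : slack g b (pt i) = pattern_value w i by rewrite pt_value gbE.
have c0 : 0 < slack g b c.
  apply: (slack_interior cS); last first.
    by exists (x v); rewrite ?gb //; apply: sub_conv_hull; left; exists v.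
  move=> z Sz; rewrite subr_ge0; move: z Sz; apply/valid_ineqP; rewrite stack_vertexE.
  by move=> _ [i _ <-]; rewrite ptE.
set s := slack g b c in c0; pose y := s^-1 *: g.
have yE z : slack y (1 + dot c y) z = s^-1 * slack g b z.
  have -> : slack g b z = s + dot g c - dot g z by rewrite /s /slack subrK.
  rewrite /slack /y !dotZr dotZl (dotC c); field; exact: lt0r_neq0.
exists y.
  by move=> i; rewrite -subr_ge0 -polar_slack yE ptE mulr_ge0 // invr_ge0 ltW.
by apply/setP => i; rewrite in_act yE ptE wZ mulf_eq0 invr_eq0 gt_eqF.
Qed.

Lemma sum_nu_ge0 (w : pvertex r -> R) : (forall k, 0 <= w (inr k)) ->
  0 <= \sum_k nu k * w (inr k).
Proof. by move=> w0; apply: sumr_ge0 => k _; rewrite mulr_ge0 // ltW. Qed.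

Lemma sum_nu_eq0 (w : pvertex r -> R) : (forall k, 0 <= w (inr k)) ->
  \sum_k nu k * w (inr k) = 0 -> forall k, w (inr k) = 0.
Proof.
move=> w0 /eqP; rewrite psumr_eq0 => [/allP H k|k _]; last by rewrite mulr_ge0 // ltW.
by have := H k (mem_index_enum _); rewrite mulf_eq0 gt_eqF //= => /eqP.
Qed.

Lemma zero_pattern_necessary Z w : balanced w -> (forall i, 0 <= pattern_value w i) ->
  (exists v, w v != 0) -> (forall i, (i \in Z) = (pattern_value w i == 0)) -> zero_pattern Z.
Proof.
move=> wb w0 [v v0] wZ; have wq0 k : 0 <= w (inr k) by exact: (w0 (inl (inr k))).
have A0 := w0 (sq r false false); have B0 := w0 (sq r false true).
have C0 := w0 (sq r true false); have D0 := w0 (sq r true true).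
have W0 := w0 (inr tt); have S0 := sum_nu_ge0 wq0; have Sq := sum_nu_eq0 wq0.
have WZ := wZ (inr tt).
rewrite /zero_pattern !(wZ (sq _ _ _)) {}WZ /=.
move: W0 wb A0 B0 C0 D0; rewrite /sq /pattern_value /balanced /apex_value.
set A := w (inl (false, false)); set B := w (inl (false, true)); set C := w (inl (true, false));
set D := w (inl (true, true)); set s := \sum_k _ in S0 Sq * => W0 AD A0 B0 C0 D0.
have aA : 0 <= al * A by rewrite mulr_ge0 // ltW.
have bB : 0 <= be * B by rewrite mulr_ge0 // ltW.
(* If the near side and all pyramid apexes vanished, nonnegativity at the stacking apex and
   [tau < 0] would force the far side to vanish too. *)
have nondeg : ~ (A = 0 /\ B = 0 /\ s = 0).
  move=> [A_0 [B_0 s_0]]; have : tau * C >= 0 by move: W0; rewrite A_0 B_0 s_0; lra.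
  rewrite nmulr_rge0 // => C_0; have {}C_0 : C = 0 by lra.
  move/eqP: v0; apply; case: v => [[[] []]|k]; last exact: Sq.
  - by rewrite -/D; lra.
  - by rewrite -/C; lra.
  - by rewrite -/B; lra.
  - by rewrite -/A; lra.
apply/and3P; split.
- apply/negP => /and3P[/eqP A_0 /eqP B_0 /forallP qZ]; apply: nondeg; split=> //; split=> //.
  by rewrite /s big1 // => k _; have := qZ k; rewrite wZ /= => /eqP ->; rewrite mulr0.
- by apply/eqP; apply/andP/andP => -[/eqP ? /eqP ?]; split; apply/eqP; lra.
(* When a far corner vanishes, the slope is minus a near value, so the value at the stacking apex is
   a sum of nonnegative terms. *)
have zero (E : R) : 0 <= E -> al * A + be * B - tau * E + s = 0 -> A = 0 /\ B = 0 /\ s = 0.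
  move=> E0 W_0; have tE : tau * E <= 0 by rewrite nmulr_rle0.
  have /eqP : al * A = 0 by lra.
  have /eqP : be * B = 0 by lra.
  rewrite !mulf_eq0 (gt_eqF al0) (gt_eqF be0) /= => /eqP B_0 /eqP A_0.
  by split=> //; split=> //; lra.
apply/implyP => /eqP W_0; apply/andP; split; apply/eqP => H; apply: nondeg.
  by apply: (zero A) => //; rewrite -[RHS]W_0 -/C H; ring.
apply: (zero B) => //; rewrite -[RHS]W_0 -/C; have -> : C - A = - B by rewrite -/D in H; lra.
ring.
Qed.

Lemma zero_pattern_sufficient Z (A B E : R) (b := fun k => (inl (inr k) \notin Z)%:R : R)
    (W := al * A + be * B + tau * E + \sum_k nu k * b k) :
  zero_pattern Z -> 0 <= A -> 0 <= B -> 0 <= A + E -> 0 <= B + E -> 0 <= W ->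
  [/\ (sq r false false \in Z) = (A == 0), (sq r false true \in Z) = (B == 0),
    (sq r true false \in Z) = (A + E == 0), (sq r true true \in Z) = (B + E == 0) &
    (inr tt \in Z) = (W == 0)] ->
  exists w, [/\ balanced w, forall i, 0 <= pattern_value w i, exists v, w v != 0 &
    forall i, (i \in Z) = (pattern_value w i == 0)].
Proof.
move=> Zp A0 B0 AE0 BE0 W0 [ZA ZB ZC ZD ZW].
pose w (v : pvertex r) : R := match v with
  | inl (i, j) => (if j then B else A) + (if i then E else 0) | inr k => b k end.
have WE : apex_value w = W by rewrite /apex_value /W /=; congr (_ + _); ring.
exists w; split.
- by rewrite /balanced /=; lra.
- by case=> [[[[] []]|k]|[]]; rewrite /= ?WE ?addr0 //; exact: ler0n.
- apply: contrapT => w0; have {}w0 v : w v = 0.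
    by apply/eqP; apply: contra_notT w0 => v0; exists v.
  case/and3P: Zp => /negP; case; apply/and3P; split.
  + by rewrite ZA; have := w0 (inl (false, false)); rewrite /= addr0 => ->.
  + by rewrite ZB; have := w0 (inl (false, true)); rewrite /= addr0 => ->.
  + apply/forallP => k; have /eqP := w0 (inr k).
    by rewrite /= /b pnatr_eq0 eqb0 negbK.
- case=> [[[[] []]|k]|[]]; rewrite /= ?WE ?addr0 //.
  by rewrite /b pnatr_eq0 eqb0 negbK.
Qed.

Lemma zero_patternP Z : (exists2 y, P y & act y = Z) <-> zero_pattern Z.
Proof.
rewrite active_iff; split=> [[w [wb w0 wn wZ]]|Zp].
  exact: zero_pattern_necessary wb w0 wn wZ.
pose s : R := \sum_k nu k * (inl (inr k) \notin Z)%:R.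
have s0 : 0 <= s by apply: (sum_nu_ge0 (w := fun v => (inl v \notin Z)%:R)) => k; exact: ler0n.
have sq0 : s = 0 -> [forall k, inl (inr k) \in Z].
  move=> s_0; apply/forallP => k; apply/negPn; rewrite -eqb0 -(pnatr_eq0 R); apply/eqP.
  by apply: (sum_nu_eq0 (w := fun v => (inl v \notin Z)%:R)) => // l; exact: ler0n.
have [Z1 /eqP Z2 /implyP Z3] := and3P Zp.
have pos A B : 0 <= A -> 0 <= B -> (sq r false false \in Z) = (A == 0) ->
    (sq r false true \in Z) = (B == 0) -> 0 < al * A + be * B + s.
  move=> A0 B0 ZA ZB; have aA : 0 <= al * A by rewrite mulr_ge0 // ltW.
  have bB : 0 <= be * B by rewrite mulr_ge0 // ltW.
  rewrite lt_neqAle ?addr_ge0 // andbT eq_sym; apply: contra Z1.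
  rewrite !paddr_eq0 ?addr_ge0 // !mulf_eq0 (gt_eqF al0) (gt_eqF be0) /=.
  by rewrite -ZA -ZB => /andP[/andP[-> ->] /eqP /sq0 ->].
have build A B E := @zero_pattern_sufficient Z A B E Zp.
have ind (b : bool) : b = ((~~ b)%:R == 0 :> R) by rewrite pnatr_eq0 eqb0 negbK.
set zA := sq r false false \in Z in Z1 Z2 pos build *.
set zB := sq r false true \in Z in Z1 Z2 pos build *.
set zC := sq r true false \in Z in Z2 Z3 build *.
set zD := sq r true true \in Z in Z2 Z3 build *.
have iA : 0 <= (~~ zA)%:R :> R by exact: ler0n.
have iB : 0 <= (~~ zB)%:R :> R by exact: ler0n.
have p0 := pos _ _ iA iB (ind _) (ind _).
set S0 := _ + s in p0.
have tN : tau != 0 by rewrite lt_eqF.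
(* The slope [S0 / - tau] makes the stacking apex vanish; half of it keeps the apex and the far side
   positive. *)
have [zW|zW] := boolP (inr tt \in Z).
  have [/negbTE ZC /negbTE ZD] := andP (Z3 zW).
  have E0 : 0 < S0 / - tau by rewrite divr_gt0 // oppr_gt0.
  have W0 : al * (~~ zA)%:R + be * (~~ zB)%:R + tau * (S0 / - tau) + s = 0.
    by rewrite /S0; field.
  apply: (build (~~ zA)%:R (~~ zB)%:R (S0 / - tau)); rewrite ?W0 ?addr_ge0 //; try exact: ltW.
  by rewrite ZC ZD zW eqxx -!ind; split=> //; apply/esym/gt_eqF; rewrite ltr_wpDl.
have [/norP[/negbTE ZC /negbTE ZD]|zCD] := boolP (~~ (zC || zD)).
  have E0 : 0 < S0 / - tau / 2 by rewrite !divr_gt0 // oppr_gt0.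
  have W0 : al * (~~ zA)%:R + be * (~~ zB)%:R + tau * (S0 / - tau / 2) + s = S0 / 2.
    by rewrite /S0; field.
  have S2 : 0 < S0 / 2 by rewrite divr_gt0.
  apply: (build (~~ zA)%:R (~~ zB)%:R (S0 / - tau / 2)); rewrite ?W0 ?addr_ge0 //; try exact: ltW.
  rewrite ZC ZD (negbTE zW) -!ind (gt_eqF S2); split=> //; apply/esym/gt_eqF; rewrite ltr_wpDl //.
(* If both sides have zeros, balance makes the near and far zeros agree and slope [0] works. If only
   the far side has, slope [-1] works with near values [1] or [2]. *)
have [AB|/norP[zA0 zB0]] := boolP (zA || zB).
  have [CA DB] : zC = zA /\ zD = zB.
    by move: Z2 zCD AB; case: (zA) (zB) (zC) (zD) => [] [] [] [].
  have W0 : al * (~~ zA)%:R + be * (~~ zB)%:R + tau * 0 + s = S0 by rewrite mulr0 addr0.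
  by apply: (build (~~ zA)%:R (~~ zB)%:R 0); rewrite ?W0 ?addr0 // ?ltW // CA DB
    (negbTE zW) -!ind gt_eqF.
pose A : R := if zC then 1 else 2; pose B : R := if zD then 1 else 2.
have [A0 B0] : 0 < A /\ 0 < B by rewrite /A /B; case: ifP => _; case: ifP => _; rewrite ?ltr01 ?ltr0n.
have [C0 CZ] : 0 <= A + -1 /\ zC = (A + -1 == 0).
  rewrite /A; case: ifP => _; first by rewrite subrr lexx eqxx.
  by split; [lra|apply/esym/gt_eqF; lra].
have [D0 DZ] : 0 <= B + -1 /\ zD = (B + -1 == 0).
  rewrite /B; case: ifP => _; first by rewrite subrr lexx eqxx.
  by split; [lra|apply/esym/gt_eqF; lra].
have W0 : 0 < al * A + be * B + tau * -1 + s.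
  by rewrite mulrN1 ltr_wpDr ?addr_gt0 ?mulr_gt0 ?oppr_gt0.
apply: (build A B (-1)) => //; try exact: ltW.
by rewrite -CZ -DZ (negbTE zA0) (negbTE zB0) (negbTE zW) !gt_eqF.
Qed.

Lemma balanced_off (w : pvertex r -> R) (u : bool * bool) :
  exists w', balanced w' /\ forall v, v != inl u -> w' v = w v.
Proof.
pose e (v : pvertex r) : R := if v is inl (i, j) then ((i == u.1) && (j == u.2))%:R else 0.
pose t := w (inl (false, false)) + w (inl (true, true)) - w (inl (false, true)) - w (inl (true, false)).
exists (fun v => w v - (if u.1 == u.2 then t else - t) * e v); split.
  by rewrite /balanced /e /t; case: u {e} => [[] []] /=; lra.
move=> [[i j]|k] vu; rewrite /e ?mulr0 ?subr0 //.
suff /negbTE -> : ~~ ((i == u.1) && (j == u.2)) by rewrite mulr0 subr0.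
by apply: contra vu => /andP[/eqP -> /eqP ->]; rewrite -surjective_pairing.
Qed.

(** If the stacking apex is a zero, the far corners are unconstrained and the slope can fit the
    apex. Otherwise some corner lies outside the basis and absorbs the parallelogram relation. *)
Lemma pattern_basis_free Z (w : J -> R) : zero_pattern Z ->
  exists w', balanced w' /\ forall i, i \in pattern_basis Z -> pattern_value w' i = w i.
Proof.
move=> Zp; have [apex|apex] := boolP (inr tt \in Z).
  have /and3P[_ _ /implyP/(_ apex)/andP[tf /negbTE tt]] := Zp.
  have -> : pattern_basis Z = Z.
    rewrite /pattern_basis; case: ifP => // /forallP/(_ (true, true)).
    by rewrite -/(sq r true true) tt.
  pose E := (w (inr Datatypes.tt) - (al * w (sq r false false) + be * w (sq r false true)
    + \sum_k nu k * w (inl (inr k)))) / tau.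
  exists (fun v => if v is inl (i, j) then w (sq r false j) + (if i then E else 0) else w (inl v)).
  split; first by rewrite /balanced; ring.
  case=> [[[[] j]|k]|[]] //= iZ; last by rewrite /apex_value /E; field; rewrite lt_eqF.
    by case: j iZ => iZ; [move: tt|move: tf]; rewrite /sq iZ.
  by rewrite addr0.
have [u uZ] : exists u : bool * bool, inl (inl u) \notin pattern_basis Z.
  rewrite /pattern_basis; case: ifP => [_|/negbT]; first by exists (true, true); rewrite setD11.
  by rewrite negb_forall => /existsP.
have [w' [w'b w'E]] := balanced_off (fun v => w (inl v)) u.
exists w'; split=> // -[v|[]] iZ /=.
  by apply: w'E; apply: contraTneq iZ => ->.
exfalso; move: iZ apex; rewrite /pattern_basis; case: ifP => _; last by move=> ->.
by rewrite !inE => /andP[_ ->].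
Qed.

Lemma pattern_basis_sub Z : pattern_basis Z \subset Z.
Proof. by rewrite /pattern_basis; case: ifP => // _; exact: subsetDl. Qed.

Lemma polar_fnum k : poly_fnum (polar c S) k = pattern_count r k.
Proof.
rewrite polar_polyhedron (@poly_fnum_polyhedron _ _ _ _ (fun Z => #|pattern_basis Z|)).
  apply: eq_card => Z; rewrite !inE; congr (_ && _).
  by apply/asboolP/idP => /zero_patternP.
move=> y Py; exists (pattern_basis (act y)); split=> //.
- exact: pattern_basis_sub.
- move=> w; have [|w' [w'b w'E]] := @pattern_basis_free (act y) (fun i => - w i).
    by apply/zero_patternP; exists y.
  have [g [b gb]] := xf.2 _ w'b; pose s := slack g b c.
  have gbE : (fun v => slack g b (x v)) = w' by apply/funext.
  have ptE i : slack g b (pt i) = pattern_value w' i by rewrite pt_value gbE.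
  (* Since [dot (pt i - c) y = 1] for active [i], subtracting [s *: y] cancels the value [s] at
     [c]. *)
  exists (g - s *: y) => i iB; have iy := fintype.subsetP (pattern_basis_sub (act y)) i iB.
  have := ptE i; rewrite w'E // /slack => gi.
  have /eqP yi : dot (pt i - c) y == 1 by move: iy; rewrite inE.
  rewrite dotBr dotZr yi dotBl !(dotC _ g).
  by move: gi; rewrite /s /slack; lra.
move=> h h0 i iy; have [iB|] := boolP (i \in pattern_basis (act y)); first exact: h0.
move: h0; rewrite /pattern_basis; case: ifP => [full h0|_ _]; last by rewrite iy.
rewrite in_setD1 iy andbT negbK => /eqP ->.
have {}h0 u : u != (true, true) -> dot (x (inl u)) h = dot c h.
  move=> ut; have := h0 (inl (inl u)); rewrite in_setD1 (forallP full) andbT /= dotBl.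
  have -> : inl (inl u) != sq r true true by apply: contra ut => /eqP[->].
  by move=> /(_ isT)/eqP; rewrite subr_eq0 => /eqP.
have := congr1 (fun z => dot z h) xf.1; rewrite !dotDl dotNl /=.
rewrite (h0 (false, false)) // (h0 (false, true)) // (h0 (true, false)) //; lra.
Qed.

End PolarFaces.

(** * Existence of the polytope *)

Lemma convex_comb (R : realType) n (A : set 'rV[R]_n) x0 (J : finType) (w : J -> 'rV[R]_n)
    (l : J -> R) : convex_set A -> A x0 -> (forall j, A (x0 + w j)) ->
  (forall j, 0 <= l j) -> \sum_j l j < 1 -> A (x0 + \sum_j l j *: w j).
Proof.
move=> /convex_setP cA A0 Aw l0 l1.
have key s t : \sum_(j <- s) l j < t -> A (x0 + t^-1 *: \sum_(j <- s) l j *: w j).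
  elim: s t => [|j s IH] t; first by rewrite !big_nil scaler0 addr0.
  have s0 : 0 <= \sum_(i <- s) l i by exact: sumr_ge0.
  rewrite !big_cons; have [->|lj] := eqVneq (l j) 0.
    by rewrite add0r scale0r add0r; exact: IH.
  have {lj} lj : 0 < l j by rewrite lt_neqAle eq_sym lj l0.
  move=> st; have tl : 0 < t - l j by rewrite subr_gt0; apply: le_lt_trans st; rewrite lerDl.
  have t0 : 0 < t by apply: lt_trans lj _; rewrite -subr_gt0.
  have := cA _ _ (l j / t) (Aw j) (IH (t - l j) _); rewrite ltrBrDl => /(_ st).
  rewrite divr_gt0 // ltr_pdivrMr // mul1r -subr_gt0 tl => /(_ isT); congr A.
  have -> : 1 - l j / t = (t - l j) / t by field; exact: lt0r_neq0.
  rewrite !scalerDr !scalerA addrACA -scalerDl; congr (_ + (_ + _)).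
  - by rewrite -mulrDl addrC subrK divff ?scale1r // gt_eqF.
  - by rewrite mulrC.
  - by rewrite mulrAC divff ?mul1r // gt_eqF.
by have := key (index_enum J) 1 l1; rewrite invr1 scale1r.
Qed.

Lemma continuous_cst_sub (R : realType) (T : topologicalType) (h : T -> R) a :
  continuous h -> continuous (fun z => a - h z).
Proof. by move=> ch z; apply: cvgB; [exact: cvg_cst|exact: ch]. Qed.

Lemma interior_gt0 (R : realType) (T : topologicalType) (J : finType) (h : J -> T -> R)
    (A : set T) c : (forall j, continuous (h j)) -> (forall j, 0 < h j c) ->
  (forall z, (forall j, 0 < h j z) -> A z) -> A° c.
Proof.
move=> ch c0 hA; apply: (@filterS _ (nbhs c) _ [set z | forall j, 0 < h j z]) => //.
by apply: filter_forall => j; have /cvgr_gt/(_ _ (c0 j)) := ch j c.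
Qed.

Lemma simplex_interior (R : realType) n x0 (W : 'M[R]_n) : W \in unitmx ->
  exists c, (conv_hull ([set x0] `|` [set x0 + row i W | i in setT]))° c.
Proof.
move=> Wu; pose mu (i : 'I_n) z := ((z - x0) *m invmx W) 0 i.
pose G i : 'rV[R]_n := (col i (invmx W))^T.
pose e : R := n.+1%:R^-1; have e0 : 0 < e by rewrite invr_gt0 ltr0n.
pose c := x0 + const_mx e *m W; exists c.
have muE i z : mu i z = slack (- G i) (- dot (G i) x0) z.
  by rewrite /mu dot_mxE dotBr /slack dotNl opprK addrC.
have sE z : 1 - \sum_i mu i z = slack (- \sum_i - G i) (1 - \sum_i - dot (G i) x0) z.
  have -> : slack (- \sum_i - G i) (1 - \sum_i - dot (G i) x0) z =
      1 - slack (\sum_i - G i) (\sum_i - dot (G i) x0) z by rewrite /slack dotNl; ring.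
  by rewrite slack_sum; congr (_ - _); apply: eq_bigr => i _.
pose h (j : option 'I_n) z := if j is Some i then mu i z else 1 - \sum_i mu i z.
have muc i : mu i c = e by rewrite /mu /c addrC addKr mulmxK // mxE.
have slack_cont (g : 'rV[R]_n) b : continuous (slack g b).
  apply: continuous_cst_sub; apply: continuous_dot => j; first exact: cst_continuous.
  exact: coord_continuous.
apply: (interior_gt0 (h := h)) => [[i|]|[i|]|z z0] /=.
- by rewrite (_ : h _ = slack (- G i) (- dot (G i) x0)) //; apply/funext => z; exact: muE.
- rewrite (_ : h _ = slack (- \sum_i - G i) (1 - \sum_i - dot (G i) x0)) //.
  by apply/funext => z; exact: sE.
- by rewrite muc.
- rewrite (eq_bigr (fun=> e)) => [|i _]; last exact: muc.
  rewrite sumr_const card_ord subr_gt0 -mulr_natr mulrC /e.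
  by rewrite ltr_pdivrMr ?ltr0n // mul1r ltr_nat.
have -> : z = x0 + \sum_i mu i z *: row i W.
  by rewrite -mulmx_sum_row -mulmxA mulVmx // mulmx1 addrC subrK.
apply: convex_comb => //; first exact: conv_hull_convex.
- by apply: sub_conv_hull; left.
- by move=> i; apply: sub_conv_hull; right; exists i.
- by move=> i; apply/ltW; exact: (z0 (Some i)).
- by have := z0 None; rewrite /h subr_gt0.
Qed.

(** The support condition leaves the next coordinate vector free to serve as the next apex. *)
Lemma square_pyramid_exists (R : realType) n r : (r.+2 <= n)%N ->
  exists2 T : set 'rV[R]_n, square_pyramid r T &
    T `<=` [set z | forall j : 'I_n, (r.+2 <= j)%N -> z 0 j = 0].
Proof.
have aff m : affine_set [set z : 'rV[R]_n | forall j : 'I_n, (m <= j)%N -> z 0 j = 0].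
  by move=> y z t y0 z0 j mj; rewrite !mxE y0 // z0 // !mulr0 addr0.
elim: r => [|r IH] rn.
  pose u : 'rV[R]_n := delta_mx 0 (Ordinal (ltnW rn)); pose v : 'rV[R]_n := delta_mx 0 (Ordinal rn).
  have dd (i j : 'I_n) : dot (delta_mx 0 i : 'rV[R]_n) (delta_mx 0 j) = (i == j)%:R.
    rewrite /dot (bigD1 i) //= !mxE !eqxx mul1r big1 ?addr0 // => k ki.
    by rewrite !mxE (negbTE ki) andbF mul0r.
  exists (conv_hull [set 0; 0 + u; 0 + v; 0 + u + v]).
    exists 0, u, v; split=> //; rewrite ?dd //.
    by apply/eqP => u0; have := dd (Ordinal (ltnW rn)) (Ordinal (ltnW rn));
      rewrite -/u u0 dot0l eqxx => /eqP; rewrite eq_sym oner_eq0.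
  apply: smallest_sub; first exact/affine_convex/aff.
  have u0 (j : 'I_n) : (2 <= j)%N -> u 0 j = 0.
    by move=> j2; rewrite mxE; case: (j =P _) j2 => [->|]; rewrite ?andbF.
  have v0 (j : 'I_n) : (2 <= j)%N -> v 0 j = 0.
    by move=> j2; rewrite mxE; case: (j =P _) j2 => [->|]; rewrite ?andbF.
  move=> z [[[|]|]|] -> j j2; rewrite ?add0r; [by rewrite mxE|exact: u0|exact: v0|].
  by rewrite mxE u0 // v0 // addr0.
have [B sB B0] := IH (ltnW rn); pose v : 'rV[R]_n := delta_mx 0 (Ordinal rn).
exists (conv_hull (B `|` [set v])).
  exists B => //; exists v => // vB.
  have : [set z : 'rV[R]_n | forall j : 'I_n, (r.+2 <= j)%N -> z 0 j = 0] v.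
    by apply: smallest_sub B0 _ vB; exact: aff.
  by move=> /(_ (Ordinal rn) (leqnn _)); rewrite mxE !eqxx => /eqP; rewrite oner_eq0.
apply: smallest_sub; first exact/affine_convex/aff.
move=> z [/B0 z0|->] j jr; first by apply: z0; exact: ltnW.
by rewrite mxE; case: (j =P _) jr => [->|]; rewrite ?andbF ?ltnn.
Qed.

Lemma nabla_exists (R : realType) r : exists N : set 'rV[R]_r.+2, is_nabla N.
Proof.
have [T sT _] := @square_pyramid_exists R r.+2 r (leqnn _).
have [x [xf TE]] := square_pyramid_frame sT.
pose ff : pvertex r := inl (false, false); pose ft : pvertex r := inl (false, true).
pose f1 : pvertex r := inl (false, true).
have [g1 [b1 [gb1 vg1 fg1]]] := pfacet_slack xf f1.
pose a : R := r.+2%:R^-1; have a0 : 0 < a by rewrite invr_gt0 ltr0n.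
(* Slope coefficient [-1] puts [p] beyond the near side. The other [r.+2] weights are [a] and sum to
   [1], so the expansion holds for affine functions. *)
pose p := a *: x ff + a *: x ft - (x (inl (true, false)) - x ff) + \sum_k a *: x (inr k).
have pE g b : slack g b p = a * slack g b (x ff) + a * slack g b (x ft)
    - (slack g b (x (inl (true, false))) - slack g b (x ff)) + \sum_k a * slack g b (x (inr k)).
  have bE : b = a * b + a * b + \sum_(k < r) a * b.
    rewrite sumr_const card_ord -mulrnAl -!mulrDl -mulr2n -mulrnDr /a addnC addn2.
    by rewrite -(mulr_natr _^-1) mulVf ?mul1r // pnatr_eq0.
  have sE : \sum_k a * slack g b (x (inr k)) = \sum_(k < r) a * b - dot g (\sum_k a *: x (inr k)).
    rewrite dotC; elim/big_ind3: _ => [|? ? ? ? ? ? -> ->|k _]; rewrite ?dot0l ?subrr //.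
      by rewrite dotDl; ring.
    by rewrite dotZl /slack dotC; ring.
  rewrite sE {1}/slack /p !dotDr dotNr dotBr !dotZr {1}bE /slack.
  ring.
have xT v : T (x v) by rewrite TE; apply: sub_conv_hull; exists v.
pose S := conv_hull (T `|` [set p]).
have [c cT] := simplex_interior (x ff) (frame_mx_unit xf).
exists (polar c S), T, (exposed T g1 b1), S, c; split=> //.
- by rewrite subn2.
- split; first by rewrite TE.
  pose e (i : 'I_r.+1) : pvertex r := if unlift ord0 i is Some k then inr k else ft.
  exists (x ff), (\matrix_i (x (e i) - x ff)); split.
    apply: frame_row_free => //.
      move=> i j; rewrite /e; case: unliftP => [k ->|->]; case: unliftP => [l ->|->] //.
      by move=> [->].
    by move=> i j; rewrite /e; case: unliftP => [k|] _ //; case: j.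
  rewrite TE (exposed_pfacet (t := f1) (k := 1)) ?ltr01 // => [|v]; last by rewrite gb1 mul1r.
  congr conv_hull; apply/seteqP; split=> [_ [v /= v0 <-]|_ [->|[i _ <-]]].
  + case: v v0 => [[[] []]|k] /=; rewrite ?eqxx => v0.
    * by move/eqP: v0; rewrite oner_eq0.
    * by move/eqP: v0; rewrite oner_eq0.
    * by right; exists ord0 => //; rewrite rowK /e unlift_none addrC subrK.
    * by left.
    * by right; exists (lift ord0 k) => //; rewrite rowK /e liftK addrC subrK.
  + by exists ff.
  + by rewrite rowK addrC subrK; exists (e i) => //=; rewrite /e; case: unlift.
- exists p => // g b vg [_ fg]; rewrite TE in vg fg.
  have [t [k [k0 gt]]] := facet_classification xf vg fg.
  have gE : exposed T g b = conv_hull (x @` [set v | pfacet t v = 0 :> R]).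
    by rewrite TE; apply: exposed_pfacet gt.
  have g1E : exposed T g1 b1 = conv_hull (x @` [set v | pfacet f1 v = 0 :> R]).
    by rewrite TE; apply: (exposed_pfacet (k := 1)) => // v; rewrite gb1 mul1r.
  have [tf|tf] := eqVneq t f1.
    rewrite gE g1E tf; split=> // _; rewrite -subr_lt0 -/(slack g b p) pE !gt tf /=.
    by rewrite big1 => [|l _]; [lra|rewrite gt tf !mulr0].
  have lt_p : 0 < slack g b p.
    have ak : 0 < a * k by rewrite mulr_gt0.
    case: t gt tf {gE} => [[[] i]|l] gt tf; rewrite pE !gt /=.
    + by rewrite big1 => [|l _]; rewrite ?gt ?mulr0 //; case: i {tf gt} => /=; lra.
    + rewrite big1 => [|l _]; rewrite ?gt ?mulr0 //.
      case: i tf {gt} => [/negP[]//|_] /=; lra.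
    rewrite (bigD1 l) //= big1 => [|l' ll]; rewrite gt /=; last by rewrite eq_sym (negbTE ll) !mulr0.
    by rewrite eqxx mulr1; lra.
  split=> [gg|_]; last by rewrite -subr_gt0.
  have [v v0 v1] : exists2 v, pfacet f1 v = 0 :> R & pfacet t v = 1 :> R.
    case: t tf {gt gE} => [[[] i]|l] tf.
    + by exists (inl (false, i)); rewrite /= ?eqxx.
    + by exists ff; case: i tf => //; rewrite eqxx.
    by exists (inr l); rewrite /= ?eqxx.
  have : exposed T g b (x v) by rewrite gg g1E; apply: sub_conv_hull; exists v.
  rewrite exposedE => -[_ /=]; rewrite gt v1 mulr1 => k00; by rewrite k00 ltxx in k0.
- apply: interiorS cT; apply: conv_hullS => _ [->|[i _ <-]]; left; rewrite ?rowK.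
    exact: xT.
  by rewrite addrC subrK.
Qed.

Lemma nabla_fnum (R : realType) r (N : set 'rV[R]_r.+2) k : is_nabla N ->
  poly_fnum N k = pattern_count r k.
Proof.
move=> /nabla_structure[x [p [c [al [be [tau [nu [xf pE [al0 be0 tau0 nu0] cS ->]]]]]]]].
exact: (polar_fnum xf pE al0 be0 tau0 nu0 cS).
Qed.

Theorem theorem5p1 (R : realType) (X : topologicalType) (P : cw_complex R X)
    (d : nat) :
  (2 <= d)%N ->
  strongly_regular P ->
  normal_pseudomanifold P d.-1 ->
  (2 * d + 1 <= fnum P 0)%N ->
  (d + 3 <= fnum P d.-1)%N ->
  (exists N : set 'rV[R]_d, is_nabla N) /\
  forall N : set 'rV[R]_d, is_nabla N ->
    [/\ poly_fnum N 0 = (2 * d + 1)%N,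
        forall m : nat, (0 < m <= d.-1)%N ->
          poly_fnum N m =
            ('C(d + 1, m + 1) + 'C(d, m + 1) + 'C(d.-1, m))%N &
        forall m : nat, (m <= d.-1)%N -> (poly_fnum N m <= fnum P m)%N].
Proof.
case: d => [|[|r]] // d2 srP [pmP _ _ _] f0 fd; split; first exact: nabla_exists.
move=> N nN; have N0 : poly_fnum N 0 = (2 * r.+2 + 1)%N by rewrite nabla_fnum ?pattern_count0.
have Nm m : (0 < m <= r.+1)%N -> poly_fnum N m =
    ('C(r.+2 + 1, m + 1) + 'C(r.+2, m + 1) + 'C(r.+1, m))%N.
  by case: m => // m _; rewrite nabla_fnum // pattern_countS !addn1.
split=> // -[|m] mr; first by rewrite N0.
by rewrite Nm ?mr //; exact: fnum_lower_bound.
Qed.
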